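(* Let $\mathfrak{g}=A_{2l}^{(2)}$ ($l\ge 1$). Then the two variable Kostka-Foulkes polynomials satisfy $$K_{\Lambda_0,\,\Lambda_0-p\delta}(s,t)\in\mathbb{Z}_{\ge 0}[s,t]\qquad\text{for all integers } p\ge 0 .$$
   Context: $\mathfrak{g}$ is the twisted affine Kac-Moody algebra of type $A_{2l}^{(2)}$ over $\mathbb{C}$, with the conventions of Kac's book ''Infinite dimensional Lie algebras'': removing node $0$ from the Dynkin diagram leaves $C_l$, $\delta$ is the null root, and the real roots have norms $1,2,4$ with respect to the normalized invariant form. Explicitly, with $\epsilon_1,\dots,\epsilon_l$ the standard orthonormal basis of $\mathbb{R}^l$, the real roots are $S_1\cup S_2\cup S_4$ where $S_1=\{\tfrac12(\alpha+(2n-1)\delta):\alpha=\pm2\epsilon_i,\ n\in\mathbb{Z}\}$, $S_2=\{\alpha+n\delta:\alpha=\pm\epsilon_i\pm\epsilon_j,\ i<j,\ n\in\mathbb{Z}\}$, $S_4=\{\alpha+2n\delta:\alpha=\pm2\epsilon_i,\ n\in\mathbb{Z}\}$, the elements of $S_m$ having norm $m$. The imaginary roots are $n\delta$ ($n\ne 0$), each of multiplicity $l$. Let $\Delta_+$ be the set of positive roots, $W$ the Weyl group, $\epsilon$ its sign character, $\rho$ a Weyl vector, and $\Lambda_0$ the fundamental weight of the zeroth node. Let $s,t$ be indeterminates. The two variable Kostant partition function $\mathcal{P}(\beta;s,t)$ is the coefficient of $e^\beta$ in $$\prod_{\alpha\in\Delta_+}(1-u_\alpha e^\alpha)^{-\operatorname{mult}\alpha},$$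 where $\operatorname{mult}\alpha=\dim\mathfrak{g}_\alpha$, $u_\alpha=s$ if $\alpha$ is a real root of norm $1$, and $u_\alpha=t$ for all other roots (imaginary roots and real roots of norms $2$ and $4$). The two variable Kostka-Foulkes polynomial is $$K_{\lambda\mu}(s,t)=\sum_{w\in W}\epsilon(w)\,\mathcal{P}(w(\lambda+\rho)-(\mu+\rho);s,t).$$ *)

(* Defs.v *)
From HB Require Import structures.
From mathcomp Require Import all_boot all_order all_algebra finmap.
From mathcomp Require Import boolp classical_sets functions fsbigop reals complex.
Set Implicit Arguments.
Unset Strict Implicit.
Unset Printing Implicit Defensive.
Import Order.TTheory GRing.Theory Num.Theory.
Local Open Scope classical_set_scope.
Local Open Scope ring_scope.

(* The dual h* of the Cartan subalgebra of A_{2l}^(2), over the base field F,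
   in the basis Lambda_0, eps_1, ..., eps_l, delta (coordinates 0, ..., l+1). *)
Notation hdual F l := ('rV[F]_(l.+2)).

Definition Lambda0 (F : numFieldType) (l : nat) : hdual F l :=
  delta_mx 0 (inord 0).

(* Meaningful for 1 <= i <= l. *)
Definition eps (F : numFieldType) (l i : nat) : hdual F l :=
  delta_mx 0 (inord i).

Definition delta (F : numFieldType) (l : nat) : hdual F l :=
  delta_mx 0 (inord l.+1).

Arguments Lambda0 {F l}.
Arguments eps {F l}.
Arguments delta {F l}.

(* Normalized invariant form: (eps_i, eps_j) = [i = j], (delta, Lambda_0) = 1,
   and all other pairings of basis vectors vanish. *)
Definition form (F : numFieldType) (l : nat) (x y : hdual F l) : F :=
  \sum_(1 <= i < l.+1) x 0 (inord i) * y 0 (inord i)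
  + x 0 (inord 0) * y 0 (inord l.+1) + x 0 (inord l.+1) * y 0 (inord 0).

(* <x, a^vee>, for a non-isotropic a. *)
Definition coroot_pairing (F : numFieldType) (l : nat) (x a : hdual F l) : F :=
  2 * form x a / form a a.

(* alpha_0 = (delta - theta)/2 with theta = 2 eps_1; alpha_1, ..., alpha_l is
   the standard base of C_l. *)
Definition simple_root (F : numFieldType) (l : nat) (i : 'I_l.+1) : hdual F l :=
  if i == 0 :> nat then 2^-1 *: delta - eps 1
  else if i == l :> nat then 2 *: eps l
  else eps i - eps i.+1.

Arguments simple_root F {l} i.

Definition S1 (F : numFieldType) (l : nat) : set (hdual F l) :=
  [set a | exists (i : nat) (b : bool) (n : int),
     (1 <= i <= l)%N /\
     a = 2^-1 *: ((-1) ^+ b *: (2 *: eps i) + (2 * n - 1)%:~R *: delta)].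

Definition S2 (F : numFieldType) (l : nat) : set (hdual F l) :=
  [set a | exists (i j : nat) (b c : bool) (n : int),
     [/\ (1 <= i)%N, (i < j)%N, (j <= l)%N &
     a = (-1) ^+ b *: eps i + (-1) ^+ c *: eps j + n%:~R *: delta]].

Definition S4 (F : numFieldType) (l : nat) : set (hdual F l) :=
  [set a | exists (i : nat) (b : bool) (n : int),
     (1 <= i <= l)%N /\
     a = (-1) ^+ b *: (2 *: eps i) + (2 * n)%:~R *: delta].

Definition real_roots (F : numFieldType) (l : nat) : set (hdual F l) :=
  @S1 F l `|` @S2 F l `|` @S4 F l.

Definition imaginary_roots (F : numFieldType) (l : nat) : set (hdual F l) :=
  [set a | exists n : int, n != 0 /\ a = n%:~R *: delta].

Definition roots (F : numFieldType) (l : nat) : set (hdual F l) :=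
  @real_roots F l `|` @imaginary_roots F l.

Definition positive_roots (F : numFieldType) (l : nat) : set (hdual F l) :=
  @roots F l `&`
  [set a | exists c : 'I_l.+1 -> nat, a = \sum_i simple_root F i *+ c i].

Arguments real_roots F l : clear implicits.
Arguments imaginary_roots F l : clear implicits.
Arguments positive_roots F l : clear implicits.

(* Dimension of the root space of a, for a != 0. *)
Definition mult (F : numFieldType) (l : nat) (a : hdual F l) : nat :=
  if `[< imaginary_roots F l a >] then l
  else if `[< real_roots F l a >] then 1 else 0.

Definition reflection (F : numFieldType) (l : nat) (a : hdual F l) :
    'M[F]_(l.+2) :=
  lin1_mx (fun x : hdual F l => x - coroot_pairing x a *: a).

(* The Weyl group as a group of matrices, w acting on h* by x |-> x *m w.  The
   simple reflections are involutions, so inverses need not be adjoined. *)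
Definition weyl_group (F : numFieldType) (l : nat) : set 'M[F]_(l.+2) :=
  [set w | exists s : seq 'I_l.+1,
     w = \prod_(i <- s) reflection (simple_root F i)].

Arguments weyl_group F l : clear implicits.

(* The sign character is the determinant on h*, viewed as an integer. *)
Definition sign (F : numFieldType) (l : nat) (w : 'M[F]_(l.+2)) : int :=
  sgz (\det w).

(* rho is determined up to multiples of delta only. *)
Definition weyl_vector (F : numFieldType) (l : nat) (rho : hdual F l) : Prop :=
  forall i : 'I_l.+1, coroot_pairing rho (simple_root F i) = 1.

(* Z[s,t]: the coefficient of s^a t^b in f is f`_b`_a. *)
Notation Zst := {poly {poly int}}.
Definition s_var : Zst := 'X%:P.
Definition t_var : Zst := 'X.

Definition nonneg_coefs (f : Zst) : Prop := forall a b : nat, 0 <= f`_b`_a.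

(* A formal sum \sum_b c_b e^b over h* is the function b |-> c_b. *)
Notation formal_sum F l := (hdual F l -> Zst).

Definition fs_one (F : numFieldType) (l : nat) : formal_sum F l :=
  fun b => (b == 0)%:R.

(* The index set is infinite; on the series used below, supported in the cone
   spanned by the simple roots, only finitely many terms are nonzero. *)
Definition fs_mul (F : numFieldType) (l : nat) (f g : formal_sum F l) :
    formal_sum F l :=
  fun b => \sum_(c \in [set: hdual F l]) f c * g (b - c).

(* (1 - u e^a)^-1 = \sum_k u^k e^(k a), for a != 0. *)
Definition fs_geom (F : numFieldType) (l : nat) (u : Zst) (a : hdual F l) :
    formal_sum F l :=
  fun b => \sum_(k \in [set k : nat | b = a *+ k]) u ^+ k.

Definition root_var (F : numFieldType) (l : nat) (a : hdual F l) : Zst :=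
  if `[< real_roots F l a /\ form a a = 1 >] then s_var else t_var.

(* (1 - u_a e^a)^(- mult a) *)
Definition root_factor (F : numFieldType) (l : nat) (a : hdual F l) :
    formal_sum F l :=
  iter (mult a) (fs_mul (fs_geom (root_var a) a)) (@fs_one F l).

Definition fs_prod (F : numFieldType) (l : nat) (A : {fset (hdual F l)}) :
    formal_sum F l :=
  \big[@fs_mul F l/@fs_one F l]_(a <- A) root_factor a.

(* p is the coefficient of e^b in the infinite product over the positive roots:
   the value at which the coefficients of the finite subproducts stabilize. *)
Definition is_kostant_coef (F : numFieldType) (l : nat) (b : hdual F l)
    (p : Zst) : Prop :=
  exists A : {fset (hdual F l)},
    (forall a, a \in A -> positive_roots F l a) /\
    forall B : {fset (hdual F l)},
      (forall a, a \in B -> positive_roots F l a) ->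
      {subset A <= B} -> fs_prod B b = p.

(* The default value 0 is not used: the limit exists for every b. *)
Definition kostant_partition (F : numFieldType) (l : nat) (b : hdual F l) :
    Zst :=
  xget 0 [set p | is_kostant_coef b p].

(* Only finitely many w contribute when lambda is dominant of positive level. *)
Definition kostka_foulkes (F : numFieldType) (l : nat)
    (rho lambda mu : hdual F l) : Zst :=
  \sum_(w \in weyl_group F l)
    (sign w)%:~R * kostant_partition ((lambda + rho) *m w - (mu + rho)).

(* Main.v *)
From HB Require Import structures.
From mathcomp Require Import all_boot all_order all_algebra all_fingroup all_field finmap.
From mathcomp Require Import zify ring lra.
From mathcomp Require Import boolp classical_sets functions cardinality fsbigop.
From mathcomp Require Import reals complex.
Require Import Defs.
Set Implicit Arguments.
Unset Strict Implicit.
Unset Printing Implicit Defensive.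
Import Order.TTheory GRing.Theory Num.Theory.
Local Open Scope ring_scope.

(** Write q = e^{delta}, Q = e^{delta / 2}, t = tau^2, and let n be the rank.  The
    polynomials K_p = K_{Lambda_0, Lambda_0 - p delta} have a product generating
    function:

      sum_p K_p q^p =
        prod_{j = 1}^{n} prod_{m >= 0} 1 / ((1 - t^{2j} q^{2m+2}) (1 - s^2 t^{2j-1} q^{2m+1})),

    and the right-hand side has nonnegative coefficients.

    The left-hand side is the constant term, in the variables x_i = e^{eps_i}, of
    e^{-rho} times the alternating sum of the e^{w (Lambda_0 + rho)} times the
    product of the (1 - u_a e^a)^{- mult a}.  The Weyl group is generated by signed
    permutations and translations, so the alternating sum is a determinant of
    theta functions.  Instead of summing over the group, [weyl_coef_theta]
    compares two functions on Z^n with the same antisymmetry: such a function is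
    determined by its value at rho ([antisym_affine]).

    The product over the positive roots is, after inverting the variables, the
    product of (tq; q)^{-n} from the imaginary roots, of the factors 1 - t e^a over
    the positive roots a of C_n, and of a factor that is invariant under the
    finite Weyl group ([root_set_value]).  The middle product may be replaced by a
    constant because the theta determinant is antisymmetric
    ([CT_finite_factor]); the constant does not depend on q, and q = 0 gives its
    value.  What remains is Gustafson's q-Selberg integral with parameters
    tau, - tau, s Q.  It is evaluated ([gustafson_eval]) by relating the ranks l + 1
    and l through a double integral whose two inner integrals are type I
    integrals, and the type I integral ([typeI_full]) is the determinant of a
    sequence of vectors with a linear recurrence ([det_tridiag_step]).

    No Laurent series are needed.  All identities hold in a commutative ring in
    which q, s and tau are nilpotent, where a constant term is an average over the
    M-th roots of unity for M large ([lam_pow], [CT_mono]).  The ring used at the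
    end is K[s, tau][h] / (h^N), K the algebraic numbers, with s, tau and Q multiplied by h; the coefficient
    of s^a t^b in K_p is read off in degree a + 2 b + 2 p < N ([extract_phi]).  In
    the range of degrees below N only the finitely many roots of [root_set] matter
    ([kostant_partitionE]). *)

(** * A determinant identity for odd sequences of vectors *)

Section DetStep.
Variables (k : comUnitRingType) (l : nat).

(** The generating polynomial of the signed elementary symmetric functions of s. *)
Definition factor_poly (s : seq k) : {poly k} := \prod_(b <- s) (1 - b *: 'X).

Lemma size_factor_poly s : (size (factor_poly s) <= (size s).+1)%N.
Proof.
rewrite /factor_poly; elim: s => [|b s IH]; first by rewrite big_nil size_poly1.
rewrite big_cons /=; apply: leq_trans (size_polyMleq _ _) _.
suff H2: (size (1 - b *: 'X : {poly k})%R <= 2)%N.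
  by have := leq_add H2 IH; rewrite add2n; move: (_ + _)%N => n; case: n.
apply: leq_trans (size_polyD _ _) _; rewrite size_poly1 size_polyN geq_max /=.
by apply: leq_trans (size_scale_leq _ _) _; rewrite size_polyX.
Qed.

Lemma factor_poly_cons b s : factor_poly (b :: s) = (1 - b *: 'X) * factor_poly s.
Proof. by rewrite /factor_poly big_cons. Qed.

Lemma horner_factor_poly s x :
  (factor_poly s).[x] = \prod_(b <- s) (1 - b * x).
Proof.
rewrite /factor_poly horner_prod; apply: eq_bigr => b _.
by rewrite hornerD hornerN hornerZ hornerC hornerX.
Qed.

Lemma coef_factor_cons b s i : (factor_poly (b :: s))`_i.+1 =
  (factor_poly s)`_i.+1 - b * (factor_poly s)`_i.
Proof. by rewrite factor_poly_cons mulrBl mul1r -scalerAl coefB coefZ coefXM. Qed.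

Lemma coef_factor_cons0 b s : (factor_poly (b :: s))`_0 = (factor_poly s)`_0.
Proof.
by rewrite factor_poly_cons mulrBl mul1r -scalerAl coefB coefZ coefXM /= mulr0 subr0.
Qed.

Lemma coef0_factor_poly s : (factor_poly s)`_0 = 1.
Proof.
elim: s => [|b s IH]; first by rewrite /factor_poly big_nil coef1.
by rewrite coef_factor_cons0.
Qed.

Lemma factor_poly_rev s x y :
  \sum_(i < (size s).+1) (factor_poly s)`_i * x ^+ i * y ^+ (size s - i)
   = \prod_(b <- s) (y - b * x).
Proof.
elim: s => [|b s IH].
  by rewrite big_ord1 big_nil coef0_factor_poly expr0 !mulr1.
rewrite big_cons -IH mulrBl !mulr_sumr /= big_ord_recl coef_factor_cons0.
under [X in _ + X = _]eq_bigr => i _ do rewrite lift0 coef_factor_cons !mulrBl subSS.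
rewrite sumrB addrA; congr (_ - _); last first.
  by apply: eq_bigr => i _; rewrite exprS; ring.
rewrite big_ord_recr /= [(factor_poly s)`_(size s).+1]nth_default ?size_factor_poly //.
rewrite !mul0r addr0 [RHS]big_ord_recl /=; congr (_ + _).
  by rewrite !subn0 exprS; ring.
apply: eq_bigr => i _; rewrite /bump leq0n add1n.
have -> : (size s - i = (size s - i.+1).+1)%N by have := ltn_ord i; lia.
rewrite !exprS; ring.
Qed.

Lemma coef_factor_last s : (factor_poly s)`_(size s) = (-1) ^+ size s * \prod_(b <- s) b.
Proof.
elim: s => [|b s IH]; first by rewrite coef0_factor_poly big_nil mulr1.
rewrite /= coef_factor_cons IH nth_default ?size_factor_poly // big_cons exprS; ring.
Qed.

(** Pairs the indices that are symmetric about l + 1, where an odd sequence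
    vanishes. *)
Lemma sum_center (V : zmodType) (f : nat -> V) :
  \sum_(n < (2 * l).+3) f n =
  f l.+1 + \sum_(m < l.+1) (f (l.+1 + m.+1)%N + f (l.+1 - m.+1)%N).
Proof.
rewrite big_split /= addrA -(big_mkord xpredT f) (@big_cat_nat _ _ _ l.+2) //=; last lia.
rewrite big_nat_recr //= [_ + f l.+1]addrC addrAC; congr (_ + _ + _).
- rewrite -{1}[l.+2]add0n big_addn.
  have -> : ((2 * l).+3 - l.+2 = l.+1)%N by lia.
  by rewrite big_mkord; apply: eq_bigr => i _; congr f; lia.
- rewrite -(big_mkord xpredT (fun m => f (l.+1 - m.+1)%N)) big_nat_rev /= add0n.
  by apply: eq_big_nat => i lt_i; congr f; lia.
Qed.

Lemma det_lower_bidiag n (R : nat -> 'rV[k]_n) a :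
  \det (\matrix_(i < n) (if (i : nat) is i'.+1 then R i - a *: R i' else R 0)) =
  \det (\matrix_(i < n) R i).
Proof.
pose T : 'M[k]_n := \matrix_(i, j) ((i == j)%:R - a *+ (i == j.+1 :> nat)).
have dT : \det T = 1.
  rewrite det_trig; last first.
    apply/is_trig_mxP => i j lt_ij; rewrite mxE.
    by rewrite -val_eqE ltn_eqF //= ltn_eqF ?subr0 // ltnS ltnW.
  by apply: big1 => i _; rewrite mxE eqxx ltn_eqF ?subr0.
rewrite -[RHS]mul1r -dT -det_mulmx; congr (\det _); apply/row_matrixP => i.
rewrite rowK row_mul mulmx_sum_row.
under eq_bigr => j _ do rewrite rowK 2!mxE scalerBl.
rewrite sumrB (bigD1 i) //= eqxx scale1r big1 ?addr0; last first.
  by move=> j; rewrite eq_sym => /negPf ->; rewrite scale0r.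
case: i => -[|i] lt_in /=.
  by rewrite big1 ?subr0 // => j _; rewrite mulr0n scale0r.
rewrite (bigD1 (Ordinal (ltnW lt_in))) //= eqxx big1 ?addr0 // => j.
by rewrite -val_eqE /= eqSS eq_sym => /negPf ->; rewrite mulr0n scale0r.
Qed.

Lemma det_upper_bidiag n (R : nat -> 'rV[k]_n) a :
  \det (\matrix_(i < n) (if (i.+1 < n)%N then R i - a *: R i.+1 else R i)) =
  \det (\matrix_(i < n) R i).
Proof.
pose T : 'M[k]_n := \matrix_(i, j) ((i == j)%:R - a *+ (j == i.+1 :> nat)).
have dT : \det T = 1.
  rewrite -det_tr det_trig; last first.
    apply/is_trig_mxP => i j lt_ij; rewrite !mxE eq_sym.
    by rewrite -val_eqE ltn_eqF //= ltn_eqF ?subr0 // ltnS ltnW.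
  by apply: big1 => i _; rewrite !mxE eqxx ltn_eqF ?subr0.
rewrite -[RHS]mul1r -dT -det_mulmx; congr (\det _); apply/row_matrixP => i.
rewrite rowK row_mul mulmx_sum_row.
under eq_bigr => j _ do rewrite rowK 2!mxE scalerBl.
rewrite sumrB (bigD1 i) //= eqxx scale1r big1 ?addr0; last first.
  by move=> j; rewrite eq_sym => /negPf ->; rewrite scale0r.
case: ifP => lt_in.
  rewrite (bigD1 (Ordinal lt_in)) //= eqxx big1 ?addr0 // => j.
  by rewrite -val_eqE /= => /negPf ->; rewrite mulr0n scale0r.
rewrite big1 ?subr0 // => j _; rewrite ltn_eqF ?mulr0n ?scale0r //.
by apply: leq_trans (ltn_ord j) _; rewrite leqNgt lt_in.
Qed.

(** Since u is odd, the relation is a linear one among u 1, ..., u (l + 1).  The rows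
    u i are bordered by the scalars kap i, a solution of the tridiagonal
    recurrence.  Two bidiagonal row operations turn the bordered matrix into the
    tridiagonal combination; the linear relation evaluates its determinant as a
    multiple of det (u i). *)
Lemma det_tridiag_step (u : int -> 'rV[k]_l) (a : k) (s : seq k) :
    size s = (2 * l).+1 -> 1 - a ^+ 2 \is a GRing.unit ->
    u 0 = 0 -> (forall m, u (- m) = - u m) ->
    \sum_(n < (2 * l).+3)
       (factor_poly (a :: s))`_n *: u (n%:Z - l.+1%:Z) = 0 ->
  \det (\matrix_(i < l) ((1 + a ^+ 2) *: u i.+1 - a *: u i.+2 - a *: u i)) *
     (1 - a * \prod_(b <- s) b)
  = \det (\matrix_(i < l) u i.+1) * \prod_(b <- s) (1 - a * b).
Proof.
move=> size_s Ua u0 uN rel.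
(* kap m is, up to a factor, a ^- m - a ^ m, which the tridiagonal operator kills. *)
pose kap m := (a ^+ (l.+1 - m) - a ^+ (l.+1 + m)) / (1 - a ^+ 2).
have kap0 : kap 0%N = 0 by rewrite /kap subn0 addn0 subrr mul0r.
have kapS m : (m <= l)%N -> kap m.+1 - a * kap m = a ^+ (l - m).
  move=> le_ml; rewrite /kap subSS mulrA -mulrBl.
  have -> : (l.+1 - m = (l - m).+1)%N by lia.
  apply: (mulIr Ua); rewrite /= divrK // addnS addSn !exprS; ring.
pose row_of i : 'rV[k]_(l + 1) := row_mx (u (i.+1 : nat)) (kap i.+1)%:M.
pose E := (factor_poly (a :: s)).
pose A := \matrix_(i < l + 1) row_of i.
(* The bordered determinant is computed in two ways. *)
have detA1 : \det A =
  \det (\matrix_(i < l) ((1 + a ^+ 2) *: u i.+1 - a *: u i.+2 - a *: u i)).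
  pose row1 i : 'rV[k]_(l + 1) :=
    row_mx (u (i.+1 : nat) - a *: u (i : nat)) (a ^+ (l - i))%:M.
  rewrite /A -(det_lower_bidiag row_of a).
  have -> : \matrix_(i < l + 1)
     (if (i : nat) is i'.+1 then row_of i - a *: row_of i' else row_of 0%N) =
     \matrix_(i < l + 1) row1 i.
    apply/row_matrixP => -[i lt_i]; rewrite !rowK /=.
    have le_il : (i <= l)%N by lia.
    case: i le_il {lt_i} => [|i] le_il.
      rewrite /row_of /row1 u0 scaler0 subr0; congr (row_mx _ _%:M).
      by rewrite -(kapS _ le_il) kap0 mulr0 subr0.
    rewrite /row_of /row1 scale_row_mx opp_row_mx add_row_mx; congr row_mx.
    by rewrite -(kapS _ le_il) scale_scalar_mx -raddfB.
  rewrite -(det_upper_bidiag row1 a).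
  set B := (X in \det X = _); set U' := (X in _ = \det X).
  have -> : B = block_mx U' 0 (u l.+1 - a *: u l) 1%:M.
    apply/row_matrixP => i; rewrite rowK; case: (split_ordP i) => j ->.
      have lt_jl := ltn_ord j; have lt_jl1 : (j.+1 < l + 1)%N by lia.
      rewrite block_mxEv rowKu row_row_mx rowK /row1 /= lt_jl1.
      rewrite scale_row_mx opp_row_mx add_row_mx; congr row_mx.
        by apply/rowP => x; rewrite !mxE; ring.
      have -> : (l - j = (l - j.+1).+1)%N by lia.
      by rewrite scale_scalar_mx -raddfB exprS subrr row0 /= raddf0.
    have nlt : (l.+1 < l + 1)%N = false by rewrite addn1 ltnn.
    rewrite ord1 /= addn0 nlt block_mxEv rowKd row_row_mx /row1 subnn.
    by rewrite !row_id expr0.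
  by rewrite det_lblock det1 mulr1.
pose c m := E`_(l.+1 + m) - E`_(l.+1 - m).
have relu : \sum_(m < l.+1) c m.+1 *: u m.+1 = 0.
  rewrite -[RHS]rel (sum_center (fun n => E`_n *: u (n%:Z - l.+1%:Z))) subrr u0 scaler0 add0r.
  apply: eq_bigr => m _; rewrite /c scalerBl; congr (_ + _).
    by congr (_ *: u _); lia.
  rewrite -scalerN -uN; congr (_ *: u _); have := ltn_ord m; lia.
have relk : \sum_(m < l.+1) c m.+1 * kap m.+1 = - \prod_(b <- s) (1 - a * b).
  apply: (mulIr Ua); rewrite /= mulr_suml.
  under [LHS]eq_bigr => m _ do rewrite /kap -mulrA divrK //.
  have size_as : size (a :: s) = (2 * l).+2 by rewrite /= size_s.
  have := factor_poly_rev (a :: s) a 1.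
  have := factor_poly_rev (a :: s) 1 a.
  rewrite !big_cons mulr1 subrr mul0r size_as -/E.
  rewrite (sum_center (fun n => E`_n * a ^+ n * 1 ^+ ((2 * l).+2 - n))).
  rewrite (sum_center (fun n => E`_n * 1 ^+ n * a ^+ ((2 * l).+2 - n))).
  have -> : ((2 * l).+2 - l.+1 = l.+1)%N by lia.
  rewrite !expr1n !mulr1.
  set S1 := (\sum_i _); set S2 := (\sum_i _) => e1 e2.
  have -> : \sum_(i < l.+1) c i.+1 * (a ^+ (l.+1 - i.+1) - a ^+ (l.+1 + i.+1)) = S1 - S2.
    rewrite -sumrB; apply: eq_bigr => i _; rewrite !expr1n !mulr1 /c.
    have lt_i := ltn_ord i.
    have -> : ((2 * l).+2 - (l.+1 + i.+1) = l.+1 - i.+1)%N by lia.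
    have -> : ((2 * l).+2 - (l.+1 - i.+1) = l.+1 + i.+1)%N by lia.
    ring.
  have -> : S1 - S2 = 0 - (1 - a * a) * \prod_(j <- s) (1 - j * a).
    by rewrite -e1 -e2; ring.
  under eq_bigr => b _ do rewrite mulrC.
  ring.
have cl : c l.+1 = a * \prod_(b <- s) b - 1.
  rewrite /c subnn coef0_factor_poly.
  have -> : (l.+1 + l.+1 = size (a :: s))%N by rewrite /= size_s; lia.
  rewrite coef_factor_last big_cons; congr (_ - _).
  have -> : size (a :: s) = (l.+1 * 2)%N by rewrite /= size_s; lia.
  by rewrite mulnC exprM sqrrN !expr1n mul1r.
pose T : 'M[k]_(l + 1) := block_mx 1%:M 0 (\row_(j < l) c j.+1) (c l.+1)%:M.
have detTA : T *m A = block_mx (\matrix_(i < l) u i.+1) (\col_(i < l) kap i.+1)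
   0 (- \prod_(b <- s) (1 - a * b))%:M.
  have -> : A = block_mx (\matrix_(i < l) u i.+1) (\col_(i < l) kap i.+1)
                  (u l.+1) (kap l.+1)%:M.
    apply/row_matrixP => i; rewrite rowK; case: (split_ordP i) => j ->.
      rewrite block_mxEv rowKu row_row_mx rowK /row_of /=; congr row_mx.
      by apply/rowP => x; rewrite !mxE ord1.
    by rewrite ord1 /= addn0 block_mxEv rowKd row_row_mx !row_id.
  rewrite /T mulmx_block !mul1mx !mul0mx !addr0; congr block_mx.
    rewrite mulmx_sum_row mul_scalar_mx.
    under eq_bigr => j _ do rewrite rowK mxE.
    by rewrite -[RHS]relu big_ord_recr.
  rewrite mul_scalar_mx; apply/matrixP => x y.
  rewrite !ord1 !mxE -relk [RHS]big_ord_recr /= !mulr1n; congr (_ + _).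
  by apply: eq_bigr => j _; rewrite !mxE.
have := congr1 determinant detTA.
rewrite det_mulmx det_lblock det_ublock det1 mul1r !det_scalar1 cl detA1 => e.
apply: oppr_inj; move: e; rewrite mulrN => <-; ring.
Qed.

End DetStep.

(** * Coefficients of theta functions *)

Section Theta.
Variables (k : comUnitRingType) (N : nat) (q : k).
Hypothesis qN : q ^+ N = 0.

Definition period (l : nat) : int := (2 * l).+2%:Z.

Definition theta_exp (l r : nat) (m : int) : int := l.+1%:Z * m ^+ 2 + r%:Z * m.

Lemma theta_exp_ge l r m : (r <= l)%N -> m ^+ 2 <= theta_exp l r m.
Proof.
move=> le_rl; rewrite /theta_exp.
have H : 0 <= m ^+ 2 + m by nia.
have H2 : 0 <= m ^+ 2 - m by nia.
have : 0 <= (l%:Z - r%:Z) * m ^+ 2 by apply: mulr_ge0; [lia | exact: sqr_ge0].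
have : 0 <= r%:Z * (m ^+ 2 + m) by apply: mulr_ge0.
have -> : l.+1%:Z = l%:Z + 1 by lia.
nia.
Qed.

(** The n-th coefficient of sum_m q^{(l + 1) m^2 + r m} x^{(2 l + 2) m + r} is
    theta_half; theta_coef belongs to the difference of this series and its image
    under x |-> 1 / x.  Since q is nilpotent these are Laurent polynomials. *)
Definition theta_half (l r : nat) (n : int) : k :=
  if (period l %| n - r%:Z)%Z
  then q ^+ `|theta_exp l r ((n - r%:Z) %/ period l)%Z|%N else 0.

Definition theta_coef l r n := theta_half l r n - theta_half l r (- n).

Lemma theta_half_period l r m : theta_half l r (m * period l + r%:Z) =
  q ^+ `|theta_exp l r m|%N.
Proof. by rewrite /theta_half addrK dvdz_mull ?dvdzz // mulzK. Qed.

Variant theta_half_spec l r n : k -> Type :=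
  | ThetaHalf m of n = m * period l + r%:Z :
      theta_half_spec l r n (q ^+ `|theta_exp l r m|%N)
  | ThetaHalf0 of (forall m, n <> m * period l + r%:Z) : theta_half_spec l r n 0.

Lemma theta_halfP l r n : theta_half_spec l r n (theta_half l r n).
Proof.
rewrite /theta_half; case: ifPn => [dv|ndv].
  by apply: ThetaHalf; rewrite divzK // subrK.
apply: ThetaHalf0 => m e; move: ndv; rewrite e addrK dvdz_mull ?dvdzz //.
Qed.

(** Moving n by one period towards 0 lowers the exponent theta_exp by u. *)
Lemma theta_half_shift l r (u : nat) n : (r <= l)%N ->
  n = l.+1%:Z + u%:Z \/ n = - (l.+1%:Z + u%:Z) ->
  theta_half l r n =
  q ^+ u * theta_half l r (n - sgz n * period l).
Proof.
move=> le_rl n_def.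
have sn : (n = l.+1%:Z + u%:Z /\ sgz n = 1) \/ (n = - (l.+1%:Z + u%:Z) /\ sgz n = -1).
  by case: n_def => ->; [left|right]; (split; first by []);
    [apply: gtr0_sgz | apply: ltr0_sgz]; lia.
case: (theta_halfP l r n) => [m nE|nE].
  have -> : n - sgz n * period l = (m - sgz n) * period l + r%:Z by rewrite nE; ring.
  rewrite theta_half_period -exprD; congr (_ ^+ _).
  have H1 := theta_exp_ge m le_rl; have H2 := theta_exp_ge (m - sgz n) le_rl.
  have : theta_exp l r m = u%:Z + theta_exp l r (m - sgz n).
    rewrite /theta_exp; move: nE; rewrite /period => nE.
    by case: sn => -[e1 ->]; nia.
  have := sqr_ge0 m; have := sqr_ge0 (m - sgz n); lia.
case: theta_halfP => [m e|]; rewrite ?mulr0 //.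
case: (nE (m + sgz n)); rewrite mulrDl addrAC -e; ring.
Qed.

Lemma theta_coef_odd l r n : theta_coef l r (- n) = - theta_coef l r n.
Proof. by rewrite /theta_coef opprK opprB. Qed.

(** The mirror of the affine reflection is at l + 1. *)
Lemma theta_coef_reflect l r (u : nat) : (r <= l)%N ->
  theta_coef l r (l.+1%:Z + u%:Z) = - q ^+ u * theta_coef l r (l.+1%:Z - u%:Z).
Proof.
move=> le_rl; rewrite /theta_coef (@theta_half_shift l r u (_ + _)) //; last by left.
rewrite (@theta_half_shift l r u (- (_ + _))) //; last by right.
rewrite gtr0_sgz; last by lia.
rewrite ltr0_sgz; last by lia.
have -> : l.+1%:Z + u%:Z - 1 * period l = - (l.+1%:Z - u%:Z) by rewrite /period; lia.
have -> : - (l.+1%:Z + u%:Z) - (-1) * period l = l.+1%:Z - u%:Z by rewrite /period; lia.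
ring.
Qed.

Lemma theta_coef_small l r n : (0 < r <= l)%N -> `|n| <= l%:Z ->
  theta_coef l r n = (n == r%:Z)%:R - (n == - r%:Z)%:R.
Proof.
move=> r_rng n_rng.
have half p : `|p| <= l%:Z -> theta_half l r p = (p == r%:Z)%:R.
  move=> p_rng; case: (theta_halfP l r p) => [m pE|pE].
    have m0 : m = 0 by move: pE; rewrite /period; nia.
    by rewrite pE m0 mul0r add0r eqxx /theta_exp !mulr0 expr0.
  by case: eqP => // e; case: (pE 0); rewrite mul0r add0r.
by rewrite /theta_coef !half ?normrN // eqr_oppLR.
Qed.

(** A bound for the degrees of the theta functions of period 2 l + 2. *)
Definition theta_deg l : nat := (N * (2 * l).+2 + l)%N.

Lemma theta_coef_large l r n : (r <= l)%N -> (theta_deg l)%:Z < `|n| ->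
  theta_coef l r n = 0.
Proof.
move=> le_rl n_rng.
have half p : (theta_deg l)%:Z < `|p| -> theta_half l r p = 0.
  move=> p_rng; case: (theta_halfP l r p) => // m pE.
  have m_big : N%:Z <= `|m| by move: p_rng; rewrite pE /theta_deg /period; nia.
  have := theta_exp_ge m le_rl => H.
  have le_N : (N <= `|theta_exp l r m|)%N by nia.
  by rewrite -(subnK le_N) exprD qN mulr0.
by rewrite /theta_coef !half ?normrN // subrr.
Qed.

End Theta.

(** * Constant terms as averages over roots of unity *)

Lemma unit_nilp (k : comUnitRingType) N (y : k) : y ^+ N = 0 -> 1 - y \is a GRing.unit.
Proof.
move=> yN; apply/unitrP; exists (\sum_(i < N) y ^+ i).
have e : (1 - y) * \sum_(i < N) y ^+ i = 1 by rewrite -opprB mulNr -subrX1 yN; ring.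
by rewrite mulrC e.
Qed.

Lemma inv_nilp (k : comUnitRingType) N (y : k) :
  y ^+ N = 0 -> (1 - y)^-1 = \sum_(i < N) y ^+ i.
Proof.
move=> yN; have U := unit_nilp yN; apply: (mulrI U); rewrite divrr //.
by rewrite -opprB mulNr -subrX1 yN sub0r opprK.
Qed.

Lemma nilpM (k : comNzRingType) N (x y : k) : x ^+ N = 0 -> (x * y) ^+ N = 0.
Proof. by move=> xN; rewrite exprMn xN mul0r. Qed.

Section RootNodes.
Variables (k : comUnitRingType) (N : nat) (q : k).
Hypothesis qN : q ^+ N = 0.
Variables (M' : nat) (w : k).
Let M := M'.+1.
Hypothesis MU : (M%:R : k) \is a GRing.unit.
Hypothesis wM : w ^+ M = 1.
Hypothesis sum_w : forall j : int,
  \sum_(i < M) (w ^+ i) ^ j = if (M %| j)%Z then M%:R else 0.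

Definition node (i : 'I_M) : k := w ^+ i.

Lemma unit_w : w \is a GRing.unit.
Proof. by apply/unitrP; exists (w ^+ M'); rewrite -exprS -exprSr wM. Qed.

Lemma node_unit i : node i \is a GRing.unit.
Proof. by rewrite unitrX ?unit_w. Qed.

(** Indices in Z / M count modulo M, so negation of the index is inversion. *)
Lemma nodeN i : node (- i) = (node i)^-1.
Proof.
apply: (mulrI (node_unit i)); rewrite divrr ?node_unit // -exprD -(expr_mod _ wM).
by rewrite /= modnDmr subnKC ?modnn ?expr0 // ltnW.
Qed.

Definition theta l r (x : k) : k :=
  \sum_(n < (2 * theta_deg N l).+1)
    theta_coef q l r (n%:Z - (theta_deg N l)%:Z) * x ^ (n%:Z - (theta_deg N l)%:Z).

(** The constant term of theta_r g. *)
Definition lam l r (g : k -> k) : k :=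
  M%:R^-1 * \sum_(i < M) theta l r (node i) * g (node i).

Lemma theta_inv l r x : x \is a GRing.unit -> theta l r x^-1 = - theta l r x.
Proof.
move=> Ux; rewrite /theta -sumrN (reindex_inj rev_ord_inj); apply: eq_bigr => n _.
set d := theta_deg N l; rewrite -mulNr -theta_coef_odd.
have -> : (rev_ord n)%:Z - d%:Z = - (n%:Z - d%:Z) by have := ltn_ord n; rewrite /= -/d; lia.
by rewrite exprz_inv opprK.
Qed.

Lemma eq_lam l r g g' : (forall x, x \is a GRing.unit -> g x = g' x) ->
  lam l r g = lam l r g'.
Proof. by move=> e; congr (_ * _); apply: eq_bigr => i _; rewrite e ?node_unit. Qed.

Lemma lamD l r g g' : lam l r (fun x => g x + g' x) = lam l r g + lam l r g'.
Proof.
rewrite /lam -mulrDr -big_split; congr (_ * _); apply: eq_bigr => i _.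
by rewrite mulrDr.
Qed.

Lemma lamZ l r c g : lam l r (fun x => c * g x) = c * lam l r g.
Proof.
rewrite /lam mulrCA; congr (_ * _); rewrite mulr_sumr; apply: eq_bigr => i _.
by rewrite mulrCA.
Qed.

Lemma lam_sum l r n (g : 'I_n -> k -> k) :
  lam l r (fun x => \sum_i g i x) = \sum_i lam l r (g i).
Proof.
rewrite /lam -mulr_sumr exchange_big; congr (_ * _); apply: eq_bigr => i _.
by rewrite mulr_sumr.
Qed.

Lemma lam_odd l r g : lam l r (fun x => g x^-1) = - lam l r g.
Proof.
rewrite /lam -mulrN -sumrN (reindex_inj oppr_inj); congr (_ * _).
apply: eq_bigr => i _; rewrite nodeN theta_inv ?node_unit // invrK.
by rewrite mulNr.
Qed.

(** Averaging over the nodes extracts constant terms as soon as the exponents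
    involved stay below the number of nodes. *)
Lemma lam_pow l r d (m : int) : (r <= l)%N -> (theta_deg N l + d < M)%N ->
  `|m| <= d%:Z -> lam l r (fun x => x ^ m) = theta_coef q l r (- m).
Proof.
move=> le_rl lt_M le_md; rewrite /lam /theta.
under eq_bigr => i _ do rewrite mulr_suml.
rewrite exchange_big /=; set D := theta_deg N l.
have dv (n : 'I_(2 * D).+1) : (M %| n%:Z - D%:Z + m)%Z = (n%:Z - D%:Z == - m).
  apply/idP/eqP => [/dvdzP[c e]|->]; last by rewrite addNr dvdz0.
  have lt_n := ltn_ord n.
  have c0 : c = 0 by move: lt_M e; rewrite -/D; nia.
  by move: e; rewrite c0 mul0r; lia.
transitivity (\sum_(n < (2 * D).+1)
  (if n%:Z - D%:Z == - m then theta_coef q l r (- m) else 0)).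
  rewrite mulr_sumr; apply: eq_bigr => n _.
  transitivity (M%:R^-1 * (theta_coef q l r (n%:Z - D%:Z) *
     \sum_(i < M) (w ^+ i) ^ (n%:Z - D%:Z + m))).
    congr (_ * _); rewrite mulr_sumr; apply: eq_bigr => i _.
    by rewrite -mulrA -exprzDr ?node_unit.
  rewrite sum_w dv; case: eqP => [->|_]; last by rewrite !mulr0.
  by rewrite mulrCA mulVr // mulr1.
case: (leP `|m| D%:Z) => [le_mD|lt_Dm].
  have lt_n : (`|D%:Z - m|%N < (2 * D).+1)%N by lia.
  rewrite (bigD1 (Ordinal lt_n)) //= big1 ?addr0; last first.
    move=> n; rewrite -val_eqE /= => ne; case: eqP => // e; lia.
  by case: eqP => //; lia.
rewrite (theta_coef_large qN) ?normrN // big1 ?mulr0 // => n _.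
by case: eqP => // e; rewrite (theta_coef_large qN) ?normrN.
Qed.

(** The reflection x |-> 1 / (q x) fixes q x + x^-1 and changes the sign of
    theta_r after the shift by x^{l + 1}; the induction expands powers of q x + x^-1
    until theta_coef_reflect applies to single monomials. *)
Lemma lam_reflect_pow l r b d (u : nat) : (r <= l)%N ->
  (theta_deg N l + (l.+1 + b) < M)%N -> (d + u <= b)%N ->
  lam l r (fun x => x ^ (- l.+1%:Z) * ((q * x + x^-1) ^+ d *
     (x ^ (- u%:Z) + q ^+ u * x ^ u%:Z))) = 0.
Proof.
move=> le_rl lt_M; elim: d u => [|d IH] u le_b.
  rewrite (@eq_lam _ _ _ (fun x => x ^ (- l.+1%:Z - u%:Z) + q ^+ u * x ^ (- l.+1%:Z + u%:Z))).
    rewrite lamD lamZ !(lam_pow le_rl lt_M); try lia.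
    have -> : - (- l.+1%:Z - u%:Z) = l.+1%:Z + u%:Z by ring.
    have -> : - (- l.+1%:Z + u%:Z) = l.+1%:Z - u%:Z by ring.
    rewrite theta_coef_reflect //; ring.
  by move=> x Ux; rewrite expr0 mul1r mulrDr mulrCA -!exprzDr.
case: u le_b => [|u] le_b.
  rewrite (@eq_lam _ _ _ (fun x => 2 * (x ^ (- l.+1%:Z) * ((q * x + x^-1) ^+ d *
     (x ^ (- 1%:Z) + q ^+ 1 * x ^ 1%:Z))))).
    by rewrite lamZ IH ?mulr0 //; lia.
  move=> x Ux; rewrite exprSr oppr0 !expr0z expr1 exprN1 expr1z; ring.
rewrite (@eq_lam _ _ _ (fun x => x ^ (- l.+1%:Z) * ((q * x + x^-1) ^+ d *
     (x ^ (- u.+2%:Z) + q ^+ u.+2 * x ^ u.+2%:Z)) +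
     q * (x ^ (- l.+1%:Z) * ((q * x + x^-1) ^+ d *
     (x ^ (- u%:Z) + q ^+ u * x ^ u%:Z))))).
  by rewrite lamD lamZ !IH ?mulr0 ?addr0 //; lia.
move=> x Ux; rewrite exprSr.
have e1 : x ^ (- u.+2%:Z) = x ^ (- u.+1%:Z) * x^-1.
  by rewrite -exprN1 -exprzDr //; congr (_ ^ _); lia.
have e2 : x ^ (- u%:Z) = x ^ (- u.+1%:Z) * x.
  by rewrite -[X in _ = _ * X]expr1z -exprzDr //; congr (_ ^ _); lia.
have e3 : x ^ (u.+2%:Z) = x ^ u.+1%:Z * x.
  by rewrite -[X in _ = _ * X]expr1z -exprzDr //; congr (_ ^ _); lia.
have e4 : x ^ u%:Z = x ^ u.+1%:Z * x^-1.
  by rewrite -exprN1 -exprzDr //; congr (_ ^ _); lia.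
rewrite e1 e2 e3 e4 !exprS; ring.
Qed.

(** The case u = 0 of the preceding identity gives twice each coefficient. *)
Lemma lam_reflect l r b (p : {poly k}) : (2 : k) \is a GRing.unit -> (r <= l)%N ->
  (theta_deg N l + (l.+1 + b) < M)%N -> (size p <= b.+1)%N ->
  lam l r (fun x => x ^ (- l.+1%:Z) * p.[q * x + x^-1]) = 0.
Proof.
move=> U2 le_rl lt_M size_p.
rewrite (@eq_lam _ _ _ (fun x => \sum_(i < size p)
   p`_i * (x ^ (- l.+1%:Z) * (q * x + x^-1) ^+ i))).
  rewrite lam_sum big1 // => i _; rewrite lamZ.
  have : (i + 0 <= b)%N by have := ltn_ord i; lia.
  move/(lam_reflect_pow le_rl lt_M) => e.
  apply: (mulrI U2); rewrite mulr0 mulrCA -lamZ.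
  rewrite (eq_lam _ _ (g' := fun x => x ^ (- l.+1%:Z) * ((q * x + x^-1) ^+ i *
     (x ^ (- 0%:Z) + q ^+ 0 * x ^ 0%:Z)))) ?e ?mulr0 //.
  move=> x Ux; rewrite oppr0 !expr0z expr0; ring.
move=> x Ux; rewrite horner_coef mulr_sumr; apply: eq_bigr => i _; ring.
Qed.

End RootNodes.

(** * q-Pochhammer products *)

Section Pochhammer.
Variables (k : comUnitRingType) (N : nat) (q : k).
Hypothesis qN : q ^+ N = 0.

Lemma nilp_index_gt0 : (0 < N)%N.
Proof. by case: N qN => // /eqP; rewrite expr0 oner_eq0. Qed.

Definition nilp (a : k) := a ^+ N = 0.

Lemma nilp0 : nilp 0.
Proof. by rewrite /nilp expr0n eqn0Ngt nilp_index_gt0. Qed.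

Lemma nilpMr a b : nilp a -> nilp (a * b).
Proof. exact: nilpM. Qed.

Lemma nilpMl a b : nilp a -> nilp (b * a).
Proof. by rewrite mulrC; apply: nilpM. Qed.

Lemma nilp_unit a : nilp a -> 1 - a \is a GRing.unit.
Proof. exact: unit_nilp. Qed.

(** The infinite product (u; q), because q ^+ N = 0. *)
Definition poch (u : k) : k := \prod_(n < N) (1 - u * q ^+ n).

Lemma poch_unit u : nilp u -> poch u \is a GRing.unit.
Proof.
move=> uN; apply: (big_rec (fun x => x \is a GRing.unit)); first exact: unitr1.
by move=> i x _ Ux; rewrite unitrMl // nilp_unit //; apply: nilpMr.
Qed.

Lemma poch0 : poch 0 = 1.
Proof. by apply: big1 => i _; rewrite mul0r subr0. Qed.

Lemma poch_shift u : poch u = (1 - u) * poch (q * u).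
Proof.
rewrite /poch; have := nilp_index_gt0; case: N qN => // n qn _.
rewrite big_ord_recl expr0 mulr1; congr (_ * _).
rewrite [RHS]big_ord_recr /= [q * u]mulrC -mulrA -exprS qn mulr0 subr0 mulr1.
by apply: eq_bigr => i _; rewrite /bump leq0n add1n exprS mulrA.
Qed.

Definition fac (a x : k) : k := (poch (a * x))^-1 * (poch (a / x))^-1.

Definition facs (s : seq k) (x : k) : k := \prod_(a <- s) fac a x.

Lemma facE a x : fac a x = (poch (a * x))^-1 * (poch (a / x))^-1.
Proof. by []. Qed.

Lemma facsE s x : facs s x = \prod_(a <- s) fac a x.
Proof. by []. Qed.

Lemma fac0 x : fac 0 x = 1.
Proof. by rewrite /fac !mul0r poch0 invr1 mulr1. Qed.

Lemma fac_inv a x : fac a x^-1 = fac a x.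
Proof. by rewrite /fac invrK mulrC. Qed.

Lemma facs_inv s x : facs s x^-1 = facs s x.
Proof. by apply: eq_bigr => a _; rewrite fac_inv. Qed.

Lemma pochV_shift u : nilp u -> (poch u)^-1 * (1 - u) = (poch (q * u))^-1.
Proof.
move=> uN; rewrite [poch u]poch_shift invrM ?nilp_unit ?poch_unit //; last exact: nilpMl.
by rewrite -mulrA mulVr ?mulr1 ?nilp_unit.
Qed.

Lemma fac_shift a x : nilp a -> fac (q * a) x = fac a x * ((1 - a * x) * (1 - a / x)).
Proof.
move=> aN; rewrite /fac mulrACA !pochV_shift ?mulrA //; exact: nilpMr.
Qed.

(** (a q x; q) (a / x; q) is a product of polynomials in q x + x^-1, and so is
    its inverse because a is nilpotent.  Each of the N factors contributes a
    geometric series of length N, whence the bound on the size. *)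
Lemma fac_reflect_poly a : nilp a -> exists p : {poly k},
  (size p <= (N * N).+1)%N /\ forall x, x \is a GRing.unit ->
    fac a x * (1 - a * x) = p.[q * x + x^-1].
Proof.
move=> aN; (* 1 - b n evaluated at q x + x^-1 is (1 - a q^n / x) (1 - a q^(n+1) x) *)
pose b n : {poly k} := (a * q ^+ n) *: ('X - (a * q ^+ n * q)%:P).
pose f n : {poly k} := \sum_(i < N) b n ^+ i.
have size_b n : (size (b n) <= 2)%N.
  by apply: leq_trans (size_scale_leq _ _) _; rewrite size_XsubC.
have size_f n : (size (f n) <= N.+1)%N.
  apply: leq_trans (size_sum _ _ _) _; apply/bigmax_leqP => i _.
  apply: leq_trans (size_poly_exp_leq _ _) _.
  have sb : ((size (b n)).-1 <= 1)%N by move: (size_b n); case: (size (b n)) => [|z].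
  by have := leq_mul sb (leqnn i); have := ltn_ord i; lia.
have size_prod m : (size (\prod_(n < m) f n)%R <= (m * N).+1)%N.
  elim: m => [|m IH]; first by rewrite big_ord0 size_poly1.
  rewrite big_ord_recr /=; apply: leq_trans (size_polyMleq _ _) _.
  have := leq_add IH (size_f m); move: (_ + _)%N => t; rewrite mulSn; lia.
exists (\prod_(n < N) f n); split=> // x Ux.
rewrite /fac mulrAC pochV_shift; last exact: nilpMr.
have inv_poch u : nilp u -> (poch u)^-1 = \prod_(n < N) (1 - u * q ^+ n)^-1.
  move=> uN; rewrite /poch; elim: (N : nat) => [|m IH]; first by rewrite !big_ord0 invr1.
  have U' : 1 - u * q ^+ m \is a GRing.unit by rewrite nilp_unit //; apply: nilpMr.
  rewrite !big_ord_recr /= invrM ?IH //; first by rewrite mulrC.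
  apply: (big_rec (fun x => x \is a GRing.unit)); first exact: unitr1.
  by move=> i y _ Uy; rewrite unitrMl // nilp_unit //; apply: nilpMr.
rewrite !inv_poch; try by do ?[apply: nilpMr | apply: nilpMl].
rewrite -big_split horner_prod; apply: eq_bigr => n _ /=.
have bN : (b n).[q * x + x^-1] ^+ N = 0.
  by rewrite hornerZ; do 2!apply: nilpM.
rewrite horner_sum; under eq_bigr => i _ do rewrite horner_exp.
rewrite -(inv_nilp bN) -invrM; first last.
- by rewrite nilp_unit //; do ?[apply: nilpMr | apply: nilpMl].
- by rewrite nilp_unit //; do ?[apply: nilpMr | apply: nilpMl].
congr (_^-1); rewrite hornerZ hornerXsubC.
have : x / x = 1 by rewrite divrr.
move: (x^-1) => y xy.
have -> : (1 - a * y * q ^+ n) * (1 - q * (a * x) * q ^+ n) =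
  1 - a * q ^+ n * y - a * q ^+ n * q * x + (a * q ^+ n) ^+ 2 * q * (x * y) by ring.
rewrite xy; ring.
Qed.

Lemma facs_reflect_poly s : (forall a, a \in s -> nilp a) -> exists p : {poly k},
  (size p <= (size s * (N * N)).+1)%N /\ forall x, x \is a GRing.unit ->
    facs s x * \prod_(a <- s) (1 - a * x) = p.[q * x + x^-1].
Proof.
elim: s => [|a s IH] nil_s.
  exists 1; rewrite size_poly1; split=> // x Ux.
  by rewrite /facs !big_nil hornerC mulr1.
have [p [size_p pE]] := IH (fun b bs => nil_s b (@mem_behead _ (a :: s) b bs)).
have [p' [size_p' p'E]] := fac_reflect_poly (nil_s a (mem_head a s)).
exists (p' * p); split.
  apply: leq_trans (size_polyMleq _ _) _; have := leq_add size_p' size_p.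
  move: (_ + _)%N => t; rewrite /= mulSn; lia.
by move=> x Ux; rewrite hornerM -pE // -p'E // /facs !big_cons mulrACA.
Qed.

End Pochhammer.

(** * The type I integral *)

Fixpoint pair_poch (k : comUnitRingType) N (q : k) (s : seq k) : k :=
  if s is a :: s' then \prod_(b <- s') poch N q (a * b) * pair_poch N q s' else 1.

Section TypeI.
Variables (k : comUnitRingType) (N : nat) (q : k).
Hypothesis qN : q ^+ N = 0.
Variables (M' : nat) (w : k).
Let M := M'.+1.
Hypothesis MU : (M%:R : k) \is a GRing.unit.
Hypothesis U2 : (2 : k) \is a GRing.unit.
Hypothesis wM : w ^+ M = 1.
Hypothesis sum_w : forall j : int,
  \sum_(i < M) (w ^+ i) ^ j = if (M %| j)%Z then M%:R else 0.
Variable l : nat.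
Hypothesis M_big : (theta_deg N l + (l.+1 + (2 * l).+2 * (N * N)) < M)%N.

Local Notation lam := (lam N q M' w).
Local Notation facs := (facs N q).

Definition moment (s : seq k) (m : int) : 'rV[k]_l :=
  \row_j lam l j.+1 (fun x => x ^ m * facs s x).

(** For 2 l + 2 parameters this is Gustafson's C_l integral of type I, with a
    theta determinant in the role of the Weyl denominator. *)
Definition typeI (s : seq k) : k := \det (\matrix_(i < l) moment s (- i.+1%:Z)).

Lemma momentN s m : moment s (- m) = - moment s m.
Proof.
apply/rowP => j; rewrite !mxE -(lam_odd N q MU wM); apply: (eq_lam N q wM) => x Ux.
by rewrite facs_inv exprz_inv.
Qed.

Lemma moment0 s : moment s 0 = 0.
Proof.
apply/rowP => j; rewrite !mxE; apply: (mulrI U2); rewrite mulr0 mulr_natl mulr2n.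
have /rowP /(_ j) := momentN s 0; rewrite !mxE oppr0 => e; by rewrite {1}e addNr.
Qed.

Lemma typeI_neg s : typeI s = (- 1) ^+ l * \det (\matrix_(i < l) moment s i.+1).
Proof.
rewrite -detZ; congr (\det _); apply/row_matrixP => i.
by rewrite linearZ /= !rowK momentN scaleN1r.
Qed.

(** Multiplying the weight by prod (1 - a x) leaves a polynomial in q x + x^-1, whose
    moments vanish by reflection. *)
Lemma moment_relation s : size s = (2 * l).+2 -> (forall a, a \in s -> nilp N a) ->
  \sum_(n < (2 * l).+3) (factor_poly s)`_n *: moment s (n%:Z - l.+1%:Z) = 0.
Proof.
move=> size_s nil_s; apply/rowP => j; rewrite summxE [RHS]mxE.
have [p [size_p pE]] := facs_reflect_poly qN nil_s.
rewrite size_s in size_p.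
transitivity (lam l j.+1 (fun x => x ^ (- l.+1%:Z) * p.[q * x + x^-1])); last first.
  exact: (lam_reflect qN MU wM sum_w U2 (ltn_ord j) M_big size_p).
under eq_bigr => n _ do rewrite 2!mxE -(lamZ N q M' w).
rewrite -(lam_sum N q M' w); apply: (eq_lam N q wM) => x Ux.
rewrite -pE // -horner_factor_poly (horner_coef_wide _ (size_factor_poly s)) size_s.
rewrite mulrA mulr_sumr; apply: eq_bigr => n _; rewrite exprzDr // -exprnP; ring.
Qed.

Lemma moment_shift a s m : nilp N a -> moment (q * a :: s) m =
  (1 + a ^+ 2) *: moment (a :: s) m - a *: moment (a :: s) (m + 1) - a *: moment (a :: s) (m - 1).
Proof.
move=> aN; apply/rowP => j; rewrite !mxE -!mulNr -!(lamZ N q M' w) -!(lamD N q M' w).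
apply: (eq_lam N q wM) => x Ux; rewrite !facsE !big_cons fac_shift //.
rewrite !exprzDr // expr1z exprN1.
have : x / x = 1 by rewrite divrr.
move: (x^-1) => y xy.
have -> : (1 - a * x) * (1 - a * y) = 1 - a * x - a * y + a ^+ 2 * (x * y) by ring.
rewrite xy; ring.
Qed.

(** Under a |-> q a each moment becomes a combination of three consecutive ones, so
    the determinant identity for odd sequences applies. *)
Lemma typeI_step a s : size s = (2 * l).+1 -> nilp N a ->
  (forall b, b \in s -> nilp N b) ->
  typeI (q * a :: s) * (1 - a * \prod_(b <- s) b) =
  typeI (a :: s) * \prod_(b <- s) (1 - a * b).
Proof.
move=> size_s aN nil_s; rewrite !typeI_neg -!mulrA; congr (_ * _).
rewrite -(@det_tridiag_step _ l (moment (a :: s))) //.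
- congr (\det _ * _); apply/row_matrixP => i; rewrite !rowK moment_shift //.
  by congr (_ - _ *: moment _ _ - _ *: moment _ _); lia.
- by rewrite (@unit_nilp _ N) // expr2; apply: nilpM.
- exact: moment0.
- exact: momentN.
apply: moment_relation; first by rewrite /= size_s.
by move=> b; rewrite inE => /orP[/eqP->|/nil_s].
Qed.

(** N steps of a |-> q a make the parameter 0. *)
Lemma typeI_clear a s : size s = (2 * l).+1 -> nilp N a ->
  (forall b, b \in s -> nilp N b) ->
  typeI (0 :: s) * poch N q (a * \prod_(b <- s) b) =
  typeI (a :: s) * \prod_(b <- s) poch N q (a * b).
Proof.
move=> size_s aN nil_s.
have step n : typeI (q ^+ n * a :: s) *
      \prod_(i < n) (1 - a * \prod_(b <- s) b * q ^+ i) =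
    typeI (a :: s) * \prod_(b <- s) \prod_(i < n) (1 - a * b * q ^+ i).
  elim: n => [|n IH].
    rewrite expr0 mul1r big_ord0 big1 // => b _; exact: big_ord0.
  rewrite exprS -mulrA big_ord_recr /= [_ * (1 - _)]mulrC [LHS]mulrA.
  have -> : 1 - a * \prod_(b <- s) b * q ^+ n =
    1 - (q ^+ n * a) * \prod_(b <- s) b by ring.
  rewrite typeI_step //; last exact: nilpMl.
  rewrite mulrAC IH -mulrA -big_split; congr (_ * _).
  by apply: eq_bigr => b _; rewrite big_ord_recr /=; congr (_ * (1 - _)); ring.
by have := step N; rewrite qN mul0r.
Qed.

Lemma perm_typeI s s' : perm_eq s s' -> typeI s = typeI s'.
Proof.
move=> ps; congr (\det _); apply/row_matrixP => i; rewrite !rowK.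
apply/rowP => j; rewrite !mxE; apply: (eq_lam N q wM) => x Ux.
by rewrite !facsE (perm_big _ ps).
Qed.

Lemma typeI_drop0 s : typeI (0 :: s) = typeI s.
Proof.
congr (\det _); apply/row_matrixP => i; rewrite !rowK.
apply/rowP => j; rewrite !mxE; apply: (eq_lam N q wM) => x Ux.
by rewrite !facsE big_cons fac0 mul1r.
Qed.

Lemma typeI_nil : typeI [::] = 1.
Proof.
rewrite -[RHS](det1 k l); congr (\det _); apply/matrixP => i j.
rewrite !mxE (eq_lam N q wM _ _ (g' := fun x => x ^ (- i.+1%:Z))); last first.
  by move=> x Ux; rewrite !facsE big_nil mulr1.
have lt_i := ltn_ord i; have lt_j := ltn_ord j.
rewrite (lam_pow (d := l.+1 + (2 * l).+2 * (N * N)) qN MU wM sum_w) //; last by lia.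
have H1 : (0 < j.+1 <= l)%N by lia.
have H2 : `|i.+1%:Z| <= l%:Z by lia.
rewrite opprK (theta_coef_small q H1 H2).
have -> : (i.+1%:Z == j.+1%:Z) = (i == j) by [].
have /negbTE -> : i.+1%:Z != - j.+1%:Z by apply/eqP; lia.
by rewrite subr0.
Qed.

Lemma typeI_pad s n : typeI (s ++ nseq n 0) = typeI s.
Proof.
elim: n => [|n IH]; first by rewrite cats0.
rewrite -IH /= -(perm_typeI (s := 0 :: (s ++ nseq n 0))) ?typeI_drop0 //.
by rewrite -cat1s perm_catCA.
Qed.

(** Parameters equal to 0 do not contribute, so fewer than 2 l + 2 parameters can be
    cleared one after the other; then the product of all parameters is 0 as well. *)
Lemma typeI_small s : (size s <= (2 * l).+1)%N -> (forall b, b \in s -> nilp N b) ->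
  typeI s * pair_poch N q s = 1.
Proof.
elim: s => [|a s IH] size_s nil_s; first by rewrite typeI_nil mulr1.
have aN := nil_s a (mem_head a s).
have nil_s' b : b \in s -> nilp N b by move=> bs; apply: nil_s; rewrite inE bs orbT.
rewrite /= mulrA -[RHS]IH //; last exact: ltnW.
congr (_ * _); pose z := nseq ((2 * l).+1 - size s) (0 : k).
have size_z : size (s ++ z) = (2 * l).+1 by rewrite size_cat size_nseq subnKC // ltnW.
have z_pos : (0 < (2 * l).+1 - size s)%N by rewrite subn_gt0.
have := @typeI_clear a (s ++ z) size_z aN.
rewrite typeI_drop0 typeI_pad !big_cat /=.
rewrite (_ : \prod_(i <- z) i = 0); last first.
  by rewrite /z; case: (_ - _)%N z_pos => // n _; rewrite /= big_cons mul0r.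
rewrite (_ : \prod_(i <- z) poch N q (a * i) = 1); last first.
  by rewrite big_seq big1 // => b /nseqP[-> _]; rewrite mulr0 poch0.
rewrite !mulr0 poch0 !mulr1 -cat_cons typeI_pad => -> //.
move=> b; rewrite mem_cat => /orP[/nil_s' //|/nseqP[-> _]]; exact: (nilp0 qN).
Qed.

(** With 2 l + 2 nonzero parameters the first clearing step leaves the factor
    (prod s; q). *)
Lemma typeI_full s : size s = (2 * l).+2 -> (forall b, b \in s -> nilp N b) ->
  typeI s * pair_poch N q s = poch N q (\prod_(b <- s) b).
Proof.
case: s => // a s [size_s] nil_s.
have aN := nil_s a (mem_head a s).
have nil_s' b : b \in s -> nilp N b by move=> bs; apply: nil_s; rewrite inE bs orbT.
rewrite big_cons /= mulrA -typeI_clear // typeI_drop0 mulrAC typeI_small ?size_s //.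
by rewrite mul1r.
Qed.

End TypeI.

(** * Gustafson's q-Selberg integral *)

Section ConstantTerm.
Variables (k : comUnitRingType) (N : nat) (q : k).
Hypothesis qN : q ^+ N = 0.
Variables (M' : nat) (w : k).
Let M := M'.+1.
Hypothesis MU : (M%:R : k) \is a GRing.unit.
Hypothesis U2 : (2 : k) \is a GRing.unit.
Hypothesis wM : w ^+ M = 1.
Hypothesis sum_w : forall j : int,
  \sum_(i < M) (w ^+ i) ^ j = if (M %| j)%Z then M%:R else 0.

Local Notation lam := (lam N q M' w).
Local Notation fac := (fac N q).
Local Notation facs := (facs N q).
Local Notation poch := (poch N q).
Local Notation nilp := (nilp N).
Local Notation node := (node w).
Local Notation typeI := (typeI N q M' w).

(** The constant term of F against the alternating sum of the
    e^{w (Lambda_0 + rho)}, written as a determinant of theta functions. *)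
Definition CT l (F : ('I_l -> k) -> k) : k :=
  M%:R^-1 ^+ l * \sum_(xi : {ffun 'I_l -> 'I_M})
    \det (\matrix_(i < l, j < l) theta N q l (l - j) (node (xi i))) *
    F (fun i => node (xi i)).

Lemma eq_CT l F G : (forall x : 'I_l -> k, (forall i, x i \is a GRing.unit) -> F x = G x) ->
  CT F = CT G.
Proof.
by move=> e; congr (_ * _); apply: eq_bigr => xi _; rewrite e // => i; exact: node_unit.
Qed.

Lemma CTZ l c (F : ('I_l -> k) -> k) : CT (fun x => c * F x) = c * CT F.
Proof.
rewrite /CT mulrCA; congr (_ * _); rewrite mulr_sumr.
by apply: eq_bigr => xi _; rewrite mulrCA.
Qed.

Lemma CT_sum l (I : Type) (r : seq I) P (F : I -> ('I_l -> k) -> k) :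
  CT (fun x => \sum_(i <- r | P i) F i x) = \sum_(i <- r | P i) CT (F i).
Proof.
rewrite /CT -mulr_sumr exchange_big; congr (_ * _).
by apply: eq_bigr => xi _; rewrite mulr_sumr.
Qed.

Lemma CT_exchange l l' (F : ('I_l -> k) -> ('I_l' -> k) -> k) :
  CT (fun x => CT (F x)) = CT (fun y => CT (F ^~ y)).
Proof.
rewrite /CT.
under eq_bigr => xi _ do rewrite mulrCA mulr_sumr.
rewrite -[X in _ = _ * X]mulr1.
under [in RHS]eq_bigr => yi _ do rewrite mulrCA mulr_sumr.
rewrite mulr1 -!mulr_sumr mulrCA exchange_big; congr (_ * (_ * _)).
by apply: eq_bigr => yi _; apply: eq_bigr => xi _; rewrite mulrCA.
Qed.

Lemma CT_prod l (g : 'I_l -> k -> k) : CT (fun x => \prod_i g i (x i)) =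
  \det (\matrix_(i < l, j < l) lam l (l - j) (g i)).
Proof.
rewrite /CT /determinant.
transitivity (\sum_(s : 'S_l) (-1) ^+ s * (M%:R^-1 ^+ l *
   \sum_(xi : {ffun 'I_l -> 'I_M})
     \prod_i (theta N q l (l - s i) (node (xi i)) * g i (node (xi i))))).
  under eq_bigr => xi _ do rewrite mulr_suml.
  rewrite exchange_big mulr_sumr; apply: eq_bigr => s _.
  rewrite [RHS]mulrCA; congr (_ * _); rewrite mulr_sumr; apply: eq_bigr => xi _.
  rewrite -mulrA big_split; congr (_ * (_ * _)).
  by apply: eq_bigr => i _; rewrite mxE.
apply: eq_bigr => s _; congr (_ * _).
rewrite -(bigA_distr_bigA (fun i m => theta N q l (l - s i) (node m) * g i (node m))).
rewrite -[X in _ ^+ X](card_ord l) -prodr_const -big_split.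
by apply: eq_bigr => i _; rewrite mxE.
Qed.

Definition xrho l (x : 'I_l -> k) : k := \prod_i x i ^ (- (l - i)%:Z).

Lemma det_rev n (A : 'M[k]_n) : \det (\matrix_(i, j) A (rev_ord i) (rev_ord j)) = \det A.
Proof.
pose s : 'S_n := perm (can_inj (@rev_ordK n)).
have -> : \matrix_(i, j) A (rev_ord i) (rev_ord j) = row_perm s (col_perm s A).
  by apply/matrixP => i j; rewrite !mxE !permE.
rewrite row_permE col_permE !det_mulmx !det_perm odd_permV mulrC -mulrA -expr2.
by rewrite sqrr_sign mulr1.
Qed.

(** Reversing rows and columns matches e^{-rho}, whose exponents decrease, with the
    increasing ones of the type I determinant. *)
Lemma CT_typeI l s : CT (fun x : 'I_l -> k => xrho x * \prod_i facs s (x i)) = typeI l s.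
Proof.
rewrite (@eq_CT _ _ (fun x => \prod_i (x i ^ (- (l - i)%:Z) * facs s (x i)))); last first.
  by move=> x Ux; rewrite /xrho -big_split.
rewrite (CT_prod (fun i x => x ^ (- (l - i)%:Z) * facs s x)) -det_rev.
congr (\det _); apply/matrixP => i j; rewrite !mxE /=.
have -> : (l - (l - i.+1) = i.+1)%N by have := ltn_ord i; lia.
by have -> : (l - (l - j.+1) = j.+1)%N by have := ltn_ord j; lia.
Qed.

(** The type I parameters that couple one set of variables to another. *)
Definition sym_params (tau : k) (xs : seq k) : seq k :=
  flatten [seq [:: tau * x; tau / x] | x <- xs].

(** The contribution of the four roots that involve both variables. *)
Definition cross_poch (t x y : k) : k :=
  poch (t * x * y) * poch (t * x / y) * (poch (t * y / x) * poch (t / x / y)).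

Fixpoint cross (t : k) (xs : seq k) : k :=
  if xs is x :: xs' then \prod_(y <- xs') cross_poch t x y * cross t xs' else 1.

Lemma size_sym_params tau xs : size (sym_params tau xs) = (2 * size xs)%N.
Proof. by elim: xs => //= x xs ->; rewrite mulnS. Qed.

Lemma prod_sym_params tau xs : (forall x, x \in xs -> x \is a GRing.unit) ->
  \prod_(a <- sym_params tau xs) a = (tau ^+ 2) ^+ size xs.
Proof.
elim: xs => [|x xs IH] Uxs; first by rewrite big_nil expr0.
rewrite /= !big_cons IH; last by move=> y ys; apply: Uxs; rewrite inE ys orbT.
by rewrite mulrA [RHS]exprS; congr (_ * _); rewrite mulrACA divrr ?Uxs ?mem_head // mulr1 expr2.
Qed.

Lemma nilp_sym_params tau xs : nilp tau -> forall a, a \in sym_params tau xs -> nilp a.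
Proof.
move=> tN a /flattenP[_ /mapP[x _ ->]].
by rewrite !inE => /orP[/eqP->|/eqP->]; apply: nilpM.
Qed.

(** Both sides are 1 / prod (tau x^{+-1} y^{+-1}; q). *)
Lemma fac_sym tau x y : x \is a GRing.unit -> y \is a GRing.unit ->
  fac (tau * x) y * fac (tau / x) y = fac (tau * y) x * fac (tau / y) x.
Proof.
move=> Ux Uy; rewrite !facE.
have -> : tau / x * y = tau * y / x by rewrite mulrAC.
have -> : tau * y * x = tau * x * y by rewrite mulrAC.
have -> : tau / y * x = tau * x / y by rewrite mulrAC.
have -> : tau / x / y = tau / y / x by rewrite mulrAC.
by rewrite mulrACA.
Qed.

Lemma facs_sym_params tau xs y : facs (sym_params tau xs) y =
  \prod_(x <- xs) (fac (tau * x) y * fac (tau / x) y).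
Proof.
rewrite !facsE; elim: xs => [|x xs IH]; first by rewrite !big_nil.
by rewrite /= !big_cons IH mulrA.
Qed.

(** The kernel of the double integral may be read as a weight in either set of
    variables. *)
Lemma facs_sym_params_exchange tau l l' (x : 'I_l -> k) (y : 'I_l' -> k) :
  (forall i, x i \is a GRing.unit) -> (forall j, y j \is a GRing.unit) ->
  \prod_j facs (sym_params tau (codom x)) (y j) =
  \prod_i facs (sym_params tau (codom y)) (x i).
Proof.
move=> Ux Uy; rewrite codomE codomE.
under eq_bigr => j _ do rewrite facs_sym_params big_map big_enum /=.
under [RHS]eq_bigr => i _ do rewrite facs_sym_params big_map big_enum /=.
rewrite exchange_big; apply: eq_bigr => i _; apply: eq_bigr => j _.
exact: fac_sym.
Qed.

(** The pairs tau x, tau / x give (tau^2; q); two pairs for x and y give the cross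
    factor; a pair and a parameter p give the weight with parameter tau p. *)
Lemma pair_poch_sym_params tau xs ps : (forall x, x \in xs -> x \is a GRing.unit) ->
  nilp tau -> (forall p, p \in ps -> nilp p) ->
  pair_poch N q (sym_params tau xs ++ ps) *
    \prod_(x <- xs) facs [seq tau * p | p <- ps] x =
  poch (tau ^+ 2) ^+ size xs * cross (tau ^+ 2) xs * pair_poch N q ps.
Proof.
move=> Uxs tN nil_ps; elim: xs Uxs => [|x xs IH] Uxs.
  by rewrite big_nil expr0 !mulr1 mul1r.
have Ux : x \is a GRing.unit by rewrite Uxs ?mem_head.
have Uxs' y : y \in xs -> y \is a GRing.unit by move=> ys; apply: Uxs; rewrite inE ys orbT.
have xx : x / x = 1 by rewrite divrr.
rewrite /= !big_cons !big_cat /=.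
have -> : tau * x * (tau / x) = tau ^+ 2.
  by rewrite -[RHS]mulr1 -xx; move: (x^-1) => y; ring.
have cross_part : (\prod_(b <- sym_params tau xs) poch (tau * x * b)) *
    (\prod_(b <- sym_params tau xs) poch (tau / x * b)) =
    \prod_(y <- xs) cross_poch (tau ^+ 2) x y.
  elim: xs {IH Uxs Uxs'} => [|y ys IHy]; first by rewrite !big_nil mulr1.
  rewrite /= !big_cons -IHy /cross_poch.
  have -> : tau * x * (tau * y) = tau ^+ 2 * x * y by ring.
  have -> : tau * x * (tau / y) = tau ^+ 2 * x / y by ring.
  have -> : tau / x * (tau * y) = tau ^+ 2 * y / x by ring.
  have -> : tau / x * (tau / y) = tau ^+ 2 / x / y by ring.
  ring.
have ps_part : (\prod_(b <- ps) poch (tau * x * b)) *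
    (\prod_(b <- ps) poch (tau / x * b)) * facs [seq tau * p | p <- ps] x = 1.
  rewrite !facsE big_map -!big_split big_seq big1 // => p ps_p /=.
  have pN := nil_ps p ps_p.
  rewrite !facE.
  have -> : tau * x * p = tau * p * x by ring.
  have -> : tau / x * p = tau * p / x by ring.
  rewrite mulrACA !divrr ?mulr1 // (poch_unit q) //.
    by do 2!apply: nilpM.
  by do 2!apply: nilpM.
rewrite -cross_part [poch _ ^+ _]exprS.
set A := \prod_(b <- sym_params _ _) _; set B := \prod_(b <- sym_params _ _) _.
set C := \prod_(b <- ps) _ in ps_part *; set D := \prod_(b <- ps) _ in ps_part *.
set f := facs _ x in ps_part *; set T := poch _.
transitivity ((C * D * f) * (T * A * B) * (pair_poch N q (sym_params tau xs ++ ps) *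
    \prod_(x <- xs) facs [seq tau * p | p <- ps] x)); first by ring.
rewrite ps_part IH // -/T; ring.
Qed.

Lemma cross_unit t xs : nilp t -> cross t xs \is a GRing.unit.
Proof.
move=> tN; elim: xs => [|x xs IH] /=; first exact: unitr1.
rewrite unitrMl //; apply: (big_rec (fun x => x \is a GRing.unit)); first exact: unitr1.
move=> y z _ Uz; rewrite unitrMl // /cross_poch.
by rewrite !unitrM !(poch_unit q) //; do 2?apply: nilpM.
Qed.

(** The constant term of Koornwinder's weight, with its numerator replaced by the
    theta determinant and e^{-rho}. *)
Definition gustafson l (tau : k) (ps : seq k) : k :=
  CT (fun x : 'I_l -> k =>
    xrho x * ((cross (tau ^+ 2) (codom x))^-1 * \prod_i facs ps (x i))).

Definition enough_nodes l := (theta_deg N l + (l.+1 + (2 * l).+2 * (N * N)) < M)%N.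

Lemma enough_nodesW l l' : (l <= l')%N -> enough_nodes l' -> enough_nodes l.
Proof.
rewrite /enough_nodes => le_l; apply: leq_ltn_trans; rewrite /theta_deg.
have H1 : (N * (2 * l).+2 <= N * (2 * l').+2)%N by rewrite leq_mul2l; lia.
have H2 : ((2 * l).+2 * (N * N) <= (2 * l').+2 * (N * N))%N by rewrite leq_mul2r; lia.
lia.
Qed.

(** The x-integral and the y-integral of
    prod 1 / (tau x_i^{+-1} y_j^{+-1}; q), with l + 1 variables x and l variables
    y, are both of type I; computing the double integral in both orders relates
    the ranks l + 1 and l. *)
Lemma gustafson_rec l tau (ps : seq k) : enough_nodes l.+1 -> nilp tau ->
  (forall p, p \in ps -> nilp p) -> size ps = 3 ->
  gustafson l.+1 tau ps * (poch ((tau ^+ 2) ^+ l.+1) * pair_poch N q ps) =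
  gustafson l tau [seq tau * p | p <- ps] * poch (tau ^+ 2).
Proof.
move=> M_big tN nil_ps size_ps.
have t2N : nilp (tau ^+ 2) by rewrite expr2; exact: nilpMr.
have Ut := poch_unit q t2N.
pose t := tau ^+ 2.
pose D := CT (fun x : 'I_l.+1 -> k => CT (fun y : 'I_l -> k =>
  xrho x * \prod_i facs ps (x i) *
  (xrho y * \prod_j facs (sym_params tau (codom x)) (y j)))).
have D1 : D * poch t ^+ l.+1 = gustafson l.+1 tau ps * poch (t ^+ l.+1).
  rewrite /gustafson mulrC [RHS]mulrC -!CTZ; apply: eq_CT => x Ux.
  have Ucx a : a \in codom x -> a \is a GRing.unit by move=> /codomP[i ->].
  rewrite CTZ CT_typeI.
  have size_x : size (codom x) = l.+1 by rewrite size_codom card_ord.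
  have size_s : size (sym_params tau (codom x)) = (2 * l).+2.
    by rewrite size_sym_params size_x; lia.
  have nil_x := nilp_sym_params (xs := codom x) tN.
  have := typeI_full qN MU U2 wM sum_w (enough_nodesW (leqnSn l) M_big) size_s nil_x.
  have := @pair_poch_sym_params tau (codom x) [::] Ucx tN.
  rewrite cats0 big1 => [|a _]; last by rewrite !facsE big_nil.
  rewrite !mulr1 size_x prod_sym_params // size_x -/t => -> // e.
  have cV := divrr (cross_unit (codom x) t2N).
  rewrite -e; move: cV; set c := cross _ _; move: (c^-1) => c' cV.
  set X := xrho x; set F := \prod_i _; set V := typeI _ _; set T := poch _ ^+ _.
  transitivity (V * T * (c * c') * X * F); last by rewrite /t -/c; ring.
  by rewrite cV; ring.
have D2 : D * (poch t ^+ l * pair_poch N q ps) = gustafson l tau [seq tau * p | p <- ps].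
  rewrite /D CT_exchange mulrC -CTZ; apply: eq_CT => y Uy.
  have Ucy a : a \in codom y -> a \is a GRing.unit by move=> /codomP[i ->].
  have size_y : size (codom y) = l by rewrite size_codom card_ord.
  rewrite (@eq_CT _ _ (fun x => xrho y * (xrho x *
     \prod_i facs (sym_params tau (codom y) ++ ps) (x i)))); last first.
    move=> x Ux; rewrite facs_sym_params_exchange // mulrCA; congr (_ * _).
    rewrite -mulrA -big_split; congr (_ * _); apply: eq_bigr => i _.
    by rewrite !facsE big_cat /= mulrC.
  rewrite CTZ CT_typeI.
  have := pair_poch_sym_params Ucy tN nil_ps; rewrite size_y -/t big_map big_enum /= => e.
  have nil_s b : b \in sym_params tau (codom y) ++ ps -> nilp b.
    by rewrite mem_cat => /orP[/(nilp_sym_params tN)|/nil_ps].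
  have size_s : (size (sym_params tau (codom y) ++ ps) <= (2 * l.+1).+1)%N.
    by rewrite size_cat size_sym_params size_y size_ps; lia.
  have e1 := typeI_small qN MU U2 wM sum_w M_big size_s nil_s.
  have cV := divrr (cross_unit (codom y) t2N).
  move: cV e e1; rewrite -/t; set c := cross _ _; move: (c^-1) => c' cV.
  set X := xrho y; set F := \prod_i _; set V := typeI _ _; set T := poch _ ^+ _.
  set p := pair_poch _ _ _; set p' := pair_poch _ _ _ => e e1.
  transitivity (X * V * c' * (T * c * p')).
    by rewrite -[LHS]mul1r -cV; ring.
  rewrite -e; transitivity (V * p * (X * (c' * F))); first by ring.
  by rewrite e1 mul1r.
rewrite mulrA -/t -D1 exprS -D2; ring.
Qed.

(** Induction on the rank.  With exactly three parameters both integrals in the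
    recursion have as many parameters as the type I evaluation admits. *)
Lemma gustafson_eval l tau (ps : seq k) : enough_nodes l -> nilp tau ->
  (forall p, p \in ps -> nilp p) -> size ps = 3 ->
  gustafson l tau ps *
    \prod_(j < l) (poch ((tau ^+ 2) ^+ j.+1) * pair_poch N q [seq tau ^+ j * p | p <- ps])
  = poch (tau ^+ 2) ^+ l.
Proof.
move=> M_big tN; elim: l ps M_big => [|l IH] ps M_big nil_ps size_ps.
  rewrite big_ord0 expr0 mulr1 /gustafson /CT expr0 mul1r.
  rewrite (eq_bigr (fun _ => 1)); last first.
    move=> xi _; rewrite det_mx00 /xrho !big_ord0 !mul1r mulr1.
    rewrite (_ : codom _ = [::]) ?invr1 //; apply: size0nil.
    by rewrite size_codom card_ord.
  by rewrite sumr_const card_ffun !card_ord expn0.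
have nil_ps' p : p \in [seq tau * p | p <- ps] -> nilp p.
  by move=> /mapP[p' _ ->]; apply: nilpM.
have prodE : \prod_(j < l.+1) (poch ((tau ^+ 2) ^+ j.+1) *
      pair_poch N q [seq tau ^+ j * p | p <- ps]) =
    (poch ((tau ^+ 2) ^+ l.+1) * pair_poch N q ps) *
    \prod_(j < l) (poch ((tau ^+ 2) ^+ j.+1) *
      pair_poch N q [seq tau ^+ j * p | p <- [seq tau * p | p <- ps]]).
  rewrite !big_split /= [\prod_(i < l.+1) poch _]big_ord_recr /=.
  rewrite [\prod_(i < l.+1) pair_poch _ _ _]big_ord_recl /= expr0.
  have -> : [seq 1 * p | p <- ps] = ps.
    by rewrite -[RHS]map_id; apply: eq_map => p; rewrite mul1r.
  have -> : \prod_(i < l) pair_poch N q [seq tau ^+ bump 0 i * p | p <- ps] =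
    \prod_(i < l) pair_poch N q [seq tau ^+ i * p | p <- [seq tau * p | p <- ps]].
    apply: eq_bigr => i _; rewrite -map_comp; congr pair_poch; apply: eq_map => p /=.
    by rewrite /bump leq0n add1n exprSr mulrA.
  ring.
have := IH _ (enough_nodesW (leqnSn l) M_big) nil_ps'; rewrite size_map => /(_ size_ps) e.
rewrite prodE mulrA gustafson_rec // [poch _ ^+ _]exprSr -e; ring.
Qed.

End ConstantTerm.

(** * Antisymmetric functions on the weight lattice *)

Section Alcove.
Variables (k : comUnitRingType) (l : nat).
Hypothesis U2 : (2 : k) \is a GRing.unit.

Implicit Type g : {ffun 'I_l.+1 -> int}.

Definition swap_at (i j : 'I_l.+1) g : {ffun 'I_l.+1 -> int} :=
  [ffun x => g (tperm i j x)].

Definition negate_at (i : 'I_l.+1) g : {ffun 'I_l.+1 -> int} :=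
  [ffun x => if x == i then - g x else g x].

(** The affine reflection, with mirror at l + 2. *)
Definition affine_at (i : 'I_l.+1) g : {ffun 'I_l.+1 -> int} :=
  [ffun x => if x == i then 2 * l.+2%:Z - g x else g x].

Definition rho_wt : {ffun 'I_l.+1 -> int} := [ffun i : 'I_l.+1 => (l.+1 - i)%N%:Z].

Definition finite_antisym (B : {ffun 'I_l.+1 -> int} -> k) : Prop :=
  (forall (i j : 'I_l.+1) g, j = i.+1 :> nat -> B (swap_at i j g) = - B g) /\
  (forall g, B (negate_at ord_max g) = - B g).

Lemma eq_opp0 (x : k) : x = - x -> x = 0.
Proof. by move=> e; apply: (mulrI U2); rewrite mulr0 mulr_natl mulr2n {1}e addNr. Qed.

(** A nonnegative quantity that every simple reflection towards the dominant chamber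
    decreases. *)
Definition depth g : int :=
  \sum_(i < l.+1) (l.+1%:Z * `|g i| - (l.+1 - i)%N%:Z * g i).

Lemma depth_ge0 g : 0 <= depth g.
Proof. by apply: sumr_ge0 => i _; have := ltn_ord i; nia. Qed.

Lemma depth_swap (i j : 'I_l.+1) g : j = i.+1 :> nat ->
  depth (swap_at i j g) = depth g - (g j - g i).
Proof.
move=> ij; have nij : j != i by rewrite -val_eqE /= ij; lia.
pose F x := l.+1%:Z * `|g x| - (l.+1 - tperm i j x)%N%:Z * g x.
have dE : depth (swap_at i j g) = \sum_x F x.
  rewrite /depth (reindex_inj (@perm_inj _ (tperm i j))) /=.
  by apply: eq_bigr => x _; rewrite ffunE tpermK.
have : \sum_x (F x - (l.+1%:Z * `|g x| - (l.+1 - x)%N%:Z * g x)) = - (g j - g i).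
  rewrite (bigD1 i) //= (bigD1 j) //= big1 ?addr0 /F.
    by rewrite tpermL tpermR; have := ltn_ord i; have := ltn_ord j; nia.
  move=> x /andP[xi xj]; rewrite tpermD ?subrr // eq_sym //.
by rewrite sumrB -dE => <-; rewrite addrCA subrr addr0.
Qed.

Lemma depth_negate g : g ord_max < 0 -> depth (negate_at ord_max g) < depth g.
Proof.
move=> g_neg; rewrite /depth (bigD1 ord_max) //= [X in _ < X](bigD1 ord_max) //=.
rewrite [X in _ + X](eq_bigr (fun i : 'I_l.+1 => l.+1%:Z * `|g i| - (l.+1 - i)%N%:Z * g i)).
  by rewrite ltrD2r !ffunE eqxx; nia.
by move=> i /negPf ni; rewrite !ffunE ni.
Qed.

Definition strictly_dominant g : Prop :=
  (forall i j : 'I_l.+1, j = i.+1 :> nat -> g j < g i) /\ 0 < g ord_max.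

(** Sort the coordinates and make them positive by simple reflections; on a mirror
    B vanishes because 2 is a unit. *)
Lemma antisym_dominant (B : {ffun 'I_l.+1 -> int} -> k) (P : {ffun 'I_l.+1 -> int} -> Prop) :
    finite_antisym B ->
    (forall (i j : 'I_l.+1) g, P g -> P (swap_at i j g)) ->
    (forall i g, P g -> P (negate_at i g)) ->
    (forall g, P g -> strictly_dominant g -> B g = 0) ->
  forall g, P g -> B g = 0.
Proof.
move=> [Bswap Bneg] Pswap Pneg Bdom g.
have [n] := ubnP `|depth g|%N; elim: n g => // n IH g lt_n Pg.
case: (ltgtP (g ord_max) 0) => [g_neg|g_pos|g_0].
- have lt_d := depth_negate g_neg; have d0 := depth_ge0 (negate_at ord_max g).
  have : B (negate_at ord_max g) = 0 by apply: IH; [lia | exact: Pneg].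
  by rewrite Bneg => /eqP; rewrite oppr_eq0 => /eqP.
- case: (boolP [exists i : 'I_l.+1, exists j : 'I_l.+1, (j == i.+1 :> nat) && (g i <= g j)]).
    move=> /existsP[i /existsP[j /andP[/eqP ij]]]; rewrite le_eqVlt => /orP[/eqP e|lt_g].
      apply: eq_opp0; rewrite -(Bswap i j) //; congr B; apply/ffunP => x.
      by rewrite ffunE; case: tpermP => // ->.
    have d0 := depth_ge0 (swap_at i j g); have dE := depth_swap g ij.
    have : B (swap_at i j g) = 0 by apply: IH; [lia | exact: Pswap].
    by rewrite Bswap // => /eqP; rewrite oppr_eq0 => /eqP.
  move=> /existsPn nd; apply: Bdom => //; split=> // i j ij.
  by move: (nd i) => /existsPn /(_ j); rewrite ij eqxx /= -ltNge.
apply: eq_opp0; rewrite -Bneg; congr B; apply/ffunP => x.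
by rewrite ffunE; case: eqP => // ->; rewrite g_0.
Qed.

(** The only strictly decreasing sequence of l + 1 positive integers bounded by
    l + 1 is l + 1, ..., 1. *)
Lemma dominant_rho g : strictly_dominant g -> g ord0 <= l.+1%:Z -> g = rho_wt.
Proof.
move=> [g_dec g_pos] g_le; pose f n := g (inord n).
have f_dec n : (n.+1 < l.+1)%N -> f n.+1 < f n.
  by move=> lt_n; apply: g_dec; rewrite !inordK // ltnW.
have f_up n : (n < l.+1)%N -> f n <= l.+1%:Z - n%:Z.
  elim: n => [|n IH] lt_n.
    by rewrite /f (_ : inord 0 = ord0) ?subr0 //; apply: val_inj; rewrite /= inordK.
  by have := f_dec n lt_n; have := IH (ltnW lt_n); lia.
have f_down n : (n <= l)%N -> n%:Z < f (l - n)%N.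
  elim: n => [|n IH] lt_n.
    by rewrite subn0 /f (_ : inord l = ord_max) //; apply: val_inj; rewrite /= inordK.
  have lt_l : ((l - n.+1).+1 < l.+1)%N by lia.
  have := f_dec _ lt_l; have -> : (l - n.+1).+1 = (l - n)%N by lia.
  by have := IH (ltnW lt_n); lia.
apply/ffunP => i; rewrite ffunE -[i in LHS]inord_val -/(f i).
have lt_i := ltn_ord i; have := f_up _ lt_i.
have := f_down (l - i)%N (leq_subr _ _); have -> : (l - (l - i) = i)%N by lia.
lia.
Qed.

(** A function that is antisymmetric under signed permutations is determined on the
    cube of half-side l + 1 by its value at rho, the only strictly dominant point
    of the cube. *)
Lemma antisym_box (B : {ffun 'I_l.+1 -> int} -> k) : finite_antisym B -> B rho_wt = 0 ->
  forall g, (forall i, `|g i| <= l.+1%:Z) -> B g = 0.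
Proof.
move=> aB B0; apply: (antisym_dominant aB) => //.
- by move=> i j g g_le x; rewrite ffunE.
- by move=> i g g_le x; rewrite ffunE; case: eqP; rewrite ?normrN.
move=> g g_le dom_g; rewrite (dominant_rho dom_g) //.
by have := g_le ord0; lia.
Qed.

Definition affine_antisym (q : k) (B : {ffun 'I_l.+1 -> int} -> k) : Prop :=
  finite_antisym B /\
  forall g (u : nat), g ord0 = l.+2%:Z + u%:Z -> B g = - q ^+ u * B (affine_at ord0 g).

(** Every orbit of the affine group meets the closed fundamental alcove, whose only
    interior lattice point is rho; reflecting in the affine mirror decreases the
    length, which the signed permutations preserve. *)
Lemma antisym_affine q (B : {ffun 'I_l.+1 -> int} -> k) : affine_antisym q B ->
  B rho_wt = 0 -> forall g, B g = 0.
Proof.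
move=> [aB Baff] B0 g.
pose sq g := \sum_i `|g i| ^+ 2.
have sq0 h : 0 <= sq h by apply: sumr_ge0 => i _; exact: sqr_ge0.
have [n] := ubnP `|sq g|%N; elim: n g => // n IH g.
apply: (antisym_dominant aB (P := fun g => (`|sq g| < n.+1)%N)).
- move=> i j h; suff -> : sq (swap_at i j h) = sq h by [].
  rewrite /sq (reindex_inj (@perm_inj _ (tperm i j))) /=.
  by apply: eq_bigr => x _; rewrite ffunE tpermK.
- move=> i h; suff -> : sq (negate_at i h) = sq h by [].
  by apply: eq_bigr => x _; rewrite ffunE; case: eqP; rewrite ?normrN.
move=> h lt_h dom_h; case: (leP (h ord0) l.+1%:Z) => [h_le|h_gt].
  by rewrite (dominant_rho dom_h).
have [u uE] : exists u : nat, h ord0 = l.+2%:Z + u%:Z.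
  by exists `|h ord0 - l.+2%:Z|%N; lia.
rewrite (Baff _ _ uE); case: u uE => [|u] uE.
  have e : affine_at ord0 h = h.
    by apply/ffunP => x; rewrite ffunE; case: eqP => // ->; rewrite uE; lia.
  by rewrite e; apply/eqP; rewrite expr0 mulN1r oppr_eq0; apply/eqP;
    apply: eq_opp0; rewrite {1}(Baff _ _ uE) expr0 mulN1r e.
rewrite IH ?mulr0 //; suff : sq (affine_at ord0 h) < sq h.
  by have := sq0 h; have := sq0 (affine_at ord0 h); lia.
rewrite /sq (bigD1 ord0) //= [X in _ < X](bigD1 ord0) //=.
rewrite (eq_bigr (fun i => `|h i| ^+ 2)); last by move=> i /negPf ni; rewrite ffunE ni.
by rewrite ltrD2r ffunE eqxx uE; nia.
Qed.

End Alcove.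

(** * Monomials and theta determinants *)

Section Mono.
Variables (k : comUnitRingType) (n : nat).
Implicit Types (g h : {ffun 'I_n -> int}) (x : 'I_n -> k).

Definition mono g x : k := \prod_i x i ^ g i.

Lemma monoD g h x : (forall i, x i \is a GRing.unit) ->
  mono (g + h) x = mono g x * mono h x.
Proof.
move=> Ux; rewrite /mono -big_split; apply: eq_bigr => i _.
by rewrite ffunE exprzDr.
Qed.

Lemma mono0 x : mono 0 x = 1.
Proof. by apply: big1 => i _; rewrite ffunE expr0z. Qed.

Lemma mono_unit g x : (forall i, x i \is a GRing.unit) -> mono g x \is a GRing.unit.
Proof.
move=> Ux; apply: (big_rec (fun y => y \is a GRing.unit)); first exact: unitr1.
by move=> i y _ Uy; rewrite unitrM Uy unitrXz ?Ux.
Qed.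

Lemma monoN g x : (forall i, x i \is a GRing.unit) -> mono (- g) x = (mono g x)^-1.
Proof.
move=> Ux; have Um := mono_unit g Ux; apply: (mulrI Um).
by rewrite divrr // -monoD // subrr mono0.
Qed.

Lemma monoMn g x m : (forall i, x i \is a GRing.unit) -> mono (g *+ m) x = mono g x ^+ m.
Proof.
move=> Ux; elim: m => [|m IH]; first by rewrite mulr0n mono0 expr0.
by rewrite mulrS monoD // IH exprS.
Qed.

Lemma mono_sum (I : Type) (r : seq I) (P : pred I) (f : I -> {ffun 'I_n -> int}) x :
  (forall i, x i \is a GRing.unit) ->
  mono (\sum_(i <- r | P i) f i) x = \prod_(i <- r | P i) mono (f i) x.
Proof.
move=> Ux; apply: (big_rec2 (fun a b => mono a x = b)); first exact: mono0.
by move=> i a b _ <-; rewrite monoD.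
Qed.

End Mono.

Lemma mono_rho (k : comUnitRingType) l (x : 'I_l.+1 -> k) : xrho x = mono (- rho_wt l) x.
Proof. by apply: eq_bigr => i _; rewrite !ffunE. Qed.

Section ThetaDet.
Variables (k : comUnitRingType) (q : k) (l : nat).
Notation n := l.+1.

Definition theta_det (g : {ffun 'I_n -> int}) : k :=
  \det (\matrix_(i < n, j < n) theta_coef q n (n - j) (g i)).

Lemma det_swap_rows (A : 'M[k]_n) (i j : 'I_n) : i != j ->
  \det (\matrix_(a, b) A (tperm i j a) b) = - \det A.
Proof.
move=> nij; have -> : \matrix_(a, b) A (tperm i j a) b = row_perm (tperm i j) A.
  by apply/matrixP => a b; rewrite !mxE.
by rewrite row_permE det_mulmx det_perm odd_tperm nij expr1 mulN1r.
Qed.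

Lemma det_scale_row (A : 'M[k]_n) (i : 'I_n) c :
  \det (\matrix_(a, b) (if a == i then c * A a b else A a b)) = c * \det A.
Proof.
have -> : \matrix_(a, b) (if a == i then c * A a b else A a b) =
    diag_mx (\row_a (if a == i then c else 1)) *m A.
  by rewrite mul_diag_mx; apply/matrixP => a b; rewrite !mxE; case: eqP; rewrite ?mul1r.
rewrite det_mulmx det_diag (bigD1 i) //= mxE eqxx big1 ?mulr1 // => a /negPf na.
by rewrite mxE na.
Qed.

Lemma theta_det_antisym : affine_antisym q theta_det.
Proof.
split; [split|].
- move=> i j g ij; rewrite -(@det_swap_rows _ i j); last by rewrite -val_eqE /= ij; lia.
  by congr (\det _); apply/matrixP => a b; rewrite !mxE ffunE.
- move=> g; rewrite -mulN1r -(det_scale_row _ ord_max); congr (\det _).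
  apply/matrixP => a b; rewrite !mxE ffunE; case: eqP => // _.
  by rewrite theta_coef_odd mulN1r.
move=> g u g0; rewrite -(det_scale_row _ ord0); congr (\det _).
apply/matrixP => a b; rewrite !mxE ffunE; case: eqP => // ->.
rewrite g0 theta_coef_reflect ?leq_subr //; congr (_ * theta_coef _ _ _ _); lia.
Qed.

Lemma theta_det_rho : theta_det (rho_wt l) = 1.
Proof.
rewrite -[RHS](det1 k n); congr (\det _); apply/matrixP => i j; rewrite !mxE ffunE.
have lt_i := ltn_ord i; have lt_j := ltn_ord j.
rewrite theta_coef_small; [|lia|lia].
have -> : ((n - i)%N%:Z == (n - j)%N%:Z) = (i == j).
  by rewrite eqz_nat -val_eqE /=; apply/eqP/eqP; lia.
have /negbTE -> : (n - i)%N%:Z != - (n - j)%N%:Z by apply/eqP; lia.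
by rewrite subr0.
Qed.

End ThetaDet.

(** * Symmetries of the constant term *)

Section Symmetry.
Variables (k : comUnitRingType) (N : nat) (q : k).
Hypothesis qN : q ^+ N = 0.
Variables (M' : nat) (w : k).
Let M := M'.+1.
Hypothesis MU : (M%:R : k) \is a GRing.unit.
Hypothesis U2 : (2 : k) \is a GRing.unit.
Hypothesis wM : w ^+ M = 1.
Hypothesis sum_w : forall j : int,
  \sum_(i < M) (w ^+ i) ^ j = if (M %| j)%Z then M%:R else 0.
Variable l : nat.
Notation n := l.+1.
Local Notation CT := (CT N q M' w).
Local Notation node := (node w).

(** The constant term of a single monomial is the coefficient at g of the
    alternating sum. *)
Lemma CT_mono d (g : {ffun 'I_n -> int}) : (theta_deg N n + d < M)%N ->
  (forall i, `|g i| <= d%:Z) -> CT (mono (- g)) = theta_det q g.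
Proof.
move=> lt_M g_le; rewrite /mono.
rewrite (CT_prod N q M' w (fun i x => x ^ (- g) i)).
congr (\det _); apply/matrixP => i j; rewrite !mxE.
rewrite (lam_pow (d := d) qN MU wM sum_w) ?leq_subr //; last by rewrite ffunE normrN.
by rewrite ffunE opprK.
Qed.

Definition weyl_invariant (F : ('I_n -> k) -> k) : Prop :=
  (forall (i j : 'I_n) x, j = i.+1 :> nat -> F (fun a => x (tperm i j a)) = F x) /\
  (forall x, (forall a, x a \is a GRing.unit) ->
     F (fun a => if a == ord_max then (x a)^-1 else x a) = F x).

(** Substituting permuted or inverted nodes changes the sign of the theta
    determinant and fixes F. *)
Lemma CT_antisym F : weyl_invariant F ->
  finite_antisym (fun g => CT (fun x => mono (- g) x * F x)).
Proof.
move=> [Fswap Fneg]; split.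
  move=> i j g ij; rewrite /CT -mulrN -sumrN; congr (_ * _).
  pose h (xi : {ffun 'I_n -> 'I_M}) : {ffun 'I_n -> 'I_M} := [ffun a => xi (tperm i j a)].
  have hK : involutive h by move=> xi; apply/ffunP => a; rewrite !ffunE tpermK.
  rewrite (reindex_inj (inv_inj hK)); apply: eq_bigr => xi _ /=.
  rewrite -mulNr; congr (_ * (_ * _)).
  - rewrite -(@det_swap_rows _ _ _ i j); last by rewrite -val_eqE /= ij; lia.
    by congr (\det _); apply/matrixP => a b; rewrite !mxE ffunE.
  - rewrite /mono (reindex_inj (@perm_inj _ (tperm i j))) /=.
    by apply: eq_bigr => a _; rewrite !ffunE tpermK.
  rewrite -[RHS](Fswap i j) //; congr F; apply/funext => a.
  by rewrite ffunE.
move=> g; rewrite /CT -mulrN -sumrN; congr (_ * _).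
pose h (xi : {ffun 'I_n -> 'I_M}) : {ffun 'I_n -> 'I_M} :=
  [ffun a => if a == ord_max then - xi a else xi a].
have hK : involutive h.
  by move=> xi; apply/ffunP => a; rewrite !ffunE; case: eqP; rewrite ?opprK.
rewrite (reindex_inj (inv_inj hK)); apply: eq_bigr => xi _ /=.
rewrite -mulNr; congr (_ * (_ * _)).
- rewrite -mulN1r -(det_scale_row _ ord_max); congr (\det _).
  apply/matrixP => a b; rewrite !mxE ffunE; case: eqP => // _.
  by rewrite nodeN // (theta_inv N q MU) ?node_unit // mulN1r.
- apply: eq_bigr => a _; rewrite !ffunE; case: eqP => // _.
  by rewrite nodeN // opprK exprz_inv.
rewrite -[RHS]Fneg; last by move=> a; exact: node_unit.
congr F; apply/funext => a; rewrite ffunE; case: eqP => // _; exact: nodeN.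
Qed.

End Symmetry.

(** The sign of the signed permutation taking rho to g, and 0 if there is none. *)
Definition box_sign l (g : {ffun 'I_l.+1 -> int}) : int :=
  \det (\matrix_(i < l.+1, j < l.+1)
     ((g i == (l.+1 - j)%N%:Z)%:R - (g i == - (l.+1 - j)%N%:Z)%:R)).

Lemma box_sign_map (k : comUnitRingType) l (g : {ffun 'I_l.+1 -> int}) :
  (box_sign g)%:~R = \det (\matrix_(i < l.+1, j < l.+1)
     ((g i == (l.+1 - j)%N%:Z)%:R - (g i == - (l.+1 - j)%N%:Z)%:R)) :> k.
Proof.
rewrite /box_sign -det_map_mx; congr (\det _); apply/matrixP => i j.
by rewrite !mxE rmorphB /= !rmorph_nat.
Qed.

Section BoxSign.
Variables (k : comUnitRingType) (l : nat).
Hypothesis U2 : (2 : k) \is a GRing.unit.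

Lemma box_sign_antisym : finite_antisym (fun g => (@box_sign l g)%:~R : k).
Proof.
split.
  move=> i j g ij; rewrite !box_sign_map -(@det_swap_rows _ _ _ i j); last first.
    by rewrite -val_eqE /= ij; lia.
  by congr (\det _); apply/matrixP => a b; rewrite !mxE ffunE.
move=> g; rewrite !box_sign_map -mulN1r -(det_scale_row _ ord_max); congr (\det _).
apply/matrixP => a b; rewrite !mxE ffunE; case: (a == ord_max) => //.
by rewrite eqr_oppLR eqr_opp mulN1r opprB.
Qed.

Lemma box_sign_rho : (box_sign (rho_wt l))%:~R = 1 :> k.
Proof.
rewrite box_sign_map -[RHS](det1 k l.+1); congr (\det _); apply/matrixP => i j.
rewrite !mxE ffunE; have lt_i := ltn_ord i; have lt_j := ltn_ord j.
have -> : ((l.+1 - i)%N%:Z == (l.+1 - j)%N%:Z) = (i == j).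
  by rewrite eqz_nat -val_eqE /=; apply/eqP/eqP; lia.
have /negbTE -> : (l.+1 - i)%N%:Z != - (l.+1 - j)%N%:Z by apply/eqP; lia.
by rewrite subr0.
Qed.

Lemma antisym_box_sign (B : {ffun 'I_l.+1 -> int} -> k) : finite_antisym B ->
  forall g : {ffun 'I_l.+1 -> int}, (forall i, `|g i| <= l.+1%:Z) -> B g = (box_sign g)%:~R * B (rho_wt l).
Proof.
move=> [Bs Bn] g g_le; have [Ss Sn] := box_sign_antisym.
apply/eqP; rewrite -subr_eq0; apply/eqP.
apply: (antisym_box U2 (B := fun h : {ffun 'I_l.+1 -> int} => B h - (box_sign h)%:~R * B (rho_wt l))) => //.
  split=> [i j h ij|h]; first by rewrite Bs // Ss // mulNr opprB opprK addrC.
  by rewrite Bn Sn mulNr opprB opprK addrC.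
by rewrite box_sign_rho mul1r subrr.
Qed.

End BoxSign.

(** * The finite part of the product over the positive roots *)

(** The triple (i, j, b) stands for the finite root eps_i + eps_j if b, and
    eps_i - eps_j otherwise; the triple (i, i, true) is the long root 2 eps_i. *)
Section FiniteRoots.
Variable n : nat.

Definition froot : Type := ('I_n * 'I_n * bool)%type.

Definition froot_pos (p : froot) : bool :=
  (p.1.1 < p.1.2)%N || ((p.1.1 == p.1.2) && p.2).

Definition froot_wt (p : froot) : {ffun 'I_n -> int} :=
  [ffun a => (a == p.1.1)%:R + (if p.2 then (a == p.1.2)%:R else - (a == p.1.2)%:R)].

Definition froot_factor (k : comUnitRingType) (t : k) (x : 'I_n -> k) : k :=
  \prod_(p : froot | froot_pos p) (1 - t * mono (froot_wt p) x).

(** These bounds keep rho minus the sum of a set of positive roots in the cube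
    [-n, n]^n.  At the coordinate a, the roots that involve eps_b contribute between
    -1 and 1 if b < a, and between 0 and 2 otherwise. *)
Lemma froot_sum_box (S : {set froot}) (a : 'I_n) :
  - a%:Z <= (\sum_(p in S | froot_pos p) froot_wt p) a <= (2 * n - a)%N%:Z.
Proof.
pose c (p : froot) : int := ((p \in S) && froot_pos p)%:R.
have -> : (\sum_(p in S | froot_pos p) froot_wt p) a = \sum_(b : 'I_n)
    (c (a, b, true) + c (a, b, false) + (c (b, a, true) - c (b, a, false))).
  rewrite sum_ffunE big_mkcond /=.
  rewrite (eq_bigr (fun p : froot => c p * (a == p.1.1)%:R +
    c p * (if p.2 then (a == p.1.2)%:R else - (a == p.1.2)%:R))); last first.
    by move=> p _; rewrite /c ffunE; case: ifP; rewrite ?mul1r ?mul0r ?addr0.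
  rewrite big_split /=.
  have two (f : froot -> int) : \sum_p f p =
      \sum_(b : 'I_n) \sum_(b' : 'I_n) (f (b, b', true) + f (b, b', false)).
    rewrite pair_big /= (eq_bigr (fun p : 'I_n * 'I_n => \sum_b f (p, b))).
      by rewrite pair_big /=; apply: eq_bigr => -[p b].
    by move=> p _; rewrite big_bool; case: p.
  rewrite !two /= big_split /=; congr (_ + _).
    rewrite (bigD1 a) //= [X in _ + X]big1 ?addr0; last first.
      by move=> b /negPf nb; rewrite big1 // => b' _; rewrite eq_sym nb !mulr0 addr0.
    by apply: eq_bigr => b _; rewrite eqxx !mulr1.
  apply: eq_bigr => b _; rewrite (bigD1 a) //= big1 ?addr0.
    by rewrite eqxx mulr1 mulrN mulr1.
  by move=> b' /negPf nb; rewrite eq_sym nb oppr0 !mulr0 addr0.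
have bound (b : 'I_n) :
   (if (b < a)%N then - 1 else 0) <=
   c (a, b, true) + c (a, b, false) + (c (b, a, true) - c (b, a, false)) <=
   (if (b < a)%N then 1 else 2).
  rewrite /c /froot_pos /= -!val_eqE /=.
  by case: (ltngtP b a) => ba; rewrite ?andbT ?andbF ?orbF /=;
    do ?case: (_ \in _) => //; rewrite /= ?eqxx.
have lt_a := ltn_ord a.
have count_lt : \sum_(b < n) (b < a)%N%:R = a%:Z :> int.
  have H m : (\sum_(b < m) (b < a))%N = minn a m.
    elim: m => [|m IH]; first by rewrite big_ord0 minn0.
    by rewrite big_ord_recr /= IH; lia.
  by rewrite -natr_sum H natz; lia.
apply/andP; split.
  rewrite -count_lt -sumrN; apply: ler_sum => b _.
  by have /andP[+ _] := bound b; case: (_ < _)%N; rewrite ?oppr0.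
have -> : (2 * n - a)%N%:Z = \sum_(b < n) (2 - (b < a)%N%:R).
  by rewrite sumrB count_lt sumr_const card_ord -mulr_natl; lia.
apply: ler_sum => b _.
by have /andP[_ +] := bound b; case: (_ < _)%N; rewrite ?subr0.
Qed.

End FiniteRoots.

Lemma prod_froot (k : comNzRingType) n (f : froot n -> k) :
  \prod_(p | froot_pos p) f p =
  (\prod_(p : 'I_n * 'I_n | (p.1 < p.2)%N) (f (p, true) * f (p, false))) *
  \prod_(i < n) f (i, i, true).
Proof.
transitivity (\prod_(p : 'I_n * 'I_n) \prod_b (if froot_pos (p, b) then f (p, b) else 1)).
  rewrite big_mkcond pair_big /=; apply: eq_bigr => -[p b] _ //=.
transitivity (\prod_(p : 'I_n * 'I_n) ((if (p.1 < p.2)%N then f (p, true) * f (p, false) else 1)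
   * (if p.1 == p.2 then f (p, true) else 1))).
  apply: eq_bigr => -[i j] _; rewrite big_bool /froot_pos /= andbT andbF orbF.
  by case: (ltngtP i j) => [ij|ij|/val_inj ->]; rewrite ?eqxx ?mul1r ?mulr1 //=;
    rewrite -val_eqE /= ?(gtn_eqF ij) ?(ltn_eqF ij) ?mulr1.
rewrite big_split -!big_mkcond /=; congr (_ * _).
rewrite (reindex (fun i : 'I_n => (i, i))) /=; last first.
  by exists fst => [i _ //|[i j]]; rewrite inE /= => /eqP ->.
by apply: eq_bigl => i; rewrite eqxx.
Qed.

(** * The weight function and its constant term *)

Section Weight.
Variables (k : comUnitRingType) (N : nat) (q : k).
Hypothesis qN : q ^+ N = 0.
Local Notation poch := (poch N q).

Definition cross_pairs n (t : k) (x : 'I_n -> k) : k :=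
  \prod_(p : 'I_n * 'I_n | (p.1 < p.2)%N) cross_poch N q t (x p.1) (x p.2).

(** cross is defined on lists for the recursion in the rank; a product over pairs
    of indices is what permutations act on. *)
Lemma cross_codom n t (x : 'I_n -> k) : cross N q t (codom x) = cross_pairs t x.
Proof.
have gen (s : seq 'I_n) : sorted ltn [seq val i | i <- s] ->
    cross N q t [seq x i | i <- s] =
    \prod_(i <- s) \prod_(j <- s | (i < j)%N) cross_poch N q t (x i) (x j).
  elim: s => [|i s IH]; first by rewrite big_nil.
  rewrite /= path_sortedE; last exact: ltn_trans.
  move=> /andP[/allP lt_is sorted_s]; rewrite IH // big_cons big_cons ltnn big_map.
  have lt_i j : j \in s -> (i < j)%N by move=> js; apply: lt_is; apply: map_f.
  congr (_ * _).
    by rewrite big_seq [RHS]big_seq_cond; apply: eq_big => j; [rewrite andb_idr // => /lt_i|].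
  rewrite big_seq [RHS]big_seq; apply: eq_bigr => j js.
  by rewrite big_cons ltnNge ltnW ?lt_i.
rewrite codomE gen; last by rewrite val_enum_ord iota_ltn_sorted.
rewrite big_enum /= /cross_pairs (eq_bigr (fun i : 'I_n => \prod_(j : 'I_n | (i < j)%N)
   cross_poch N q t (x i) (x j))); last by move=> i _; rewrite big_enum_cond.
by rewrite pair_big_dep.
Qed.

Lemma cross_pochC t x y : cross_poch N q t x y = cross_poch N q t y x.
Proof.
rewrite /cross_poch; have -> : t / x / y = t / y / x by rewrite mulrAC.
have -> : t * x * y = t * y * x by rewrite mulrAC.
ring.
Qed.

Lemma cross_pochVl t x y : cross_poch N q t x^-1 y = cross_poch N q t x y.
Proof.
rewrite /cross_poch invrK.
have -> : t / x * y = t * y / x by rewrite mulrAC.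
have -> : t * y * x = t * x * y by rewrite mulrAC.
ring.
Qed.

Lemma cross_pochVr t x y : cross_poch N q t x y^-1 = cross_poch N q t x y.
Proof. by rewrite cross_pochC cross_pochVl cross_pochC. Qed.

Definition sym_weight n (tau : k) (ps : seq k) (x : 'I_n -> k) : k :=
  (cross N q (tau ^+ 2) (codom x))^-1 * \prod_i facs N q ps (x i).

Lemma sym_weight_invariant l tau ps : weyl_invariant (@sym_weight l.+1 tau ps).
Proof.
split.
  move=> i j x ij; rewrite /sym_weight !cross_codom.
  have nij : i != j by rewrite -val_eqE /= ij; lia.
  congr (_^-1 * _); last first.
    by rewrite [RHS](reindex_inj (@perm_inj _ (tperm i j))).
  rewrite /cross_pairs (bigD1 (i, j)) /=; last by rewrite ij.
  rewrite [RHS](bigD1 (i, j)) /=; last by rewrite ij.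
  rewrite tpermL tpermR cross_pochC; congr (_ * _).
  rewrite [RHS](reindex_inj (h := fun p => (tperm i j p.1, tperm i j p.2))) /=; last first.
    by move=> [a b] [a' b'] [/perm_inj -> /perm_inj ->].
  have sE (c : 'I_l.+1) : (tperm i j c : nat) =
      if c == i :> nat then j : nat else if c == j :> nat then i : nat else c.
    by case: tpermP => [->|->|/eqP ci /eqP cj]; rewrite ?eqxx //=;
      [case: eqP | rewrite -!val_eqE /= in ci cj; rewrite (negPf ci) (negPf cj)].
  apply: eq_bigl => -[a b] /=; rewrite !xpair_eqE -!val_eqE /= !sE ij.
  case: (eqVneq (a : nat) i) => ai; case: (eqVneq (a : nat) i.+1) => aj;
    case: (eqVneq (b : nat) i) => bi; case: (eqVneq (b : nat) i.+1) => bj; lia.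
move=> x Ux; rewrite /sym_weight !cross_codom; congr (_^-1 * _).
  by apply: eq_bigr => -[a b] _ /=; do 2?case: eqP => _; rewrite ?cross_pochVl ?cross_pochVr.
by apply: eq_bigr => a _; case: eqP => // _; rewrite facs_inv.
Qed.

End Weight.

Section Evaluation.
Variables (k : comUnitRingType) (N M' : nat) (w : k).
Let M := M'.+1.
Hypothesis MU : (M%:R : k) \is a GRing.unit.
Hypothesis U2 : (2 : k) \is a GRing.unit.
Hypothesis wM : w ^+ M = 1.
Hypothesis sum_w : forall j : int,
  \sum_(i < M) (w ^+ i) ^ j = if (M %| j)%Z then M%:R else 0.
Variable l : nat.
Notation n := l.+1.

(** The coefficient of e^{-rho} after antisymmetrizing e^{-rho} prod (1 - t e^a). *)
Definition fin_const (t : k) : k :=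
  \sum_(S : {set froot n}) (\prod_(p in S) (if froot_pos p then - t else 0)) *
    (box_sign (rho_wt l - \sum_(p in S | froot_pos p) froot_wt p))%:~R.

(** The product of 1 - t e^a over the finite positive roots, times e^{-rho}, is
    a combination of monomials in the cube [-n, n]^n, so antisymmetrizing it gives
    a multiple of e^{-rho}; the factor does not depend on q nor on F. *)
Lemma CT_finite_factor q t F : weyl_invariant F ->
  CT N q M' w (fun x : 'I_n -> k => xrho x * (froot_factor t x * F x)) =
  fin_const t * CT N q M' w (fun x => xrho x * F x).
Proof.
move=> Finv.
pose B g := CT N q M' w (fun x => mono (- g) x * F x).
have aB : finite_antisym B := CT_antisym N q MU U2 wM Finv.
pose wt (S : {set froot n}) := \sum_(p in S | froot_pos p) froot_wt p.
pose c (S : {set froot n}) : k := \prod_(p in S) (if froot_pos p then - t else 0).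
rewrite (@eq_CT _ N q _ _ wM _ _ (fun x => \sum_(S : {set froot n})
   c S * (mono (- (rho_wt l - wt S)) x * F x))); last first.
  move=> x Ux.
  have -> : froot_factor t x = \sum_(S : {set froot n}) c S * mono (wt S) x.
    transitivity (\prod_p ((if froot_pos p then - (t * mono (froot_wt p) x) else 0) + 1)).
      rewrite /froot_factor big_mkcond; apply: eq_bigr => p _.
      by case: ifP => _; rewrite ?add0r // addrC.
    rewrite bigA_distr; apply: eq_bigr => S _; rewrite -big_mkcond /=.
    rewrite /c /wt mono_sum // [X in _ * X]big_mkcondr -big_split.
    by apply: eq_bigr => p _ /=; case: ifP => _; rewrite ?mul0r // mulNr.
  rewrite mulr_suml mulr_sumr; apply: eq_bigr => S _.
  by rewrite opprB addrC monoD // mono_rho; ring.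
rewrite CT_sum /fin_const mulr_suml; apply: eq_bigr => S _.
rewrite CTZ -/(B (rho_wt l - wt S)) (antisym_box_sign U2 aB) //.
  rewrite mulrA -/(c S) -/(wt S); congr (_ * _); apply: (eq_CT N q wM) => x _.
  by rewrite mono_rho.
move=> i; have /andP[] := froot_sum_box S i; rewrite -/(wt S) !ffunE.
by move: (wt S i) => z; have := ltn_ord i; lia.
Qed.

Hypothesis M_big : enough_nodes N M' n.

Variables (tau s : k).
Hypotheses (tN : nilp N tau) (sN : nilp N s).
Notation t := (tau ^+ 2).

(** The parameters + - tau come from the long roots, because
    (t x^2; q^2) = (tau x; q) (- tau x; q), and s Q from the short ones. *)
Definition params Q : seq k := [:: tau; - tau; s * Q].

(** The factors of Gustafson's evaluation collect in this form for the present
    parameters, because (1 - y) (1 + y) = 1 - y^2. *)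
Definition denominator (Q : k) : k :=
  \prod_(j < n) \prod_(m < N)
    ((1 - (t ^+ j.+1 * (Q ^+ 2) ^+ m) ^+ 2) *
     (1 - (t ^+ j * tau * s * Q * (Q ^+ 2) ^+ m) ^+ 2)).

Lemma CT_weight Q : (Q ^+ 2) ^+ N = 0 ->
  CT N (Q ^+ 2) M' w (fun x : 'I_n -> k =>
    xrho x * (froot_factor t x * sym_weight N (Q ^+ 2) tau (params Q) x)) * denominator Q
  = fin_const t * poch N (Q ^+ 2) t ^+ n.
Proof.
move=> QN; rewrite CT_finite_factor; last exact: sym_weight_invariant.
have nil_ps p : p \in params Q -> nilp N p.
  rewrite !inE => /or3P[/eqP->|/eqP->|/eqP->] //; last exact: nilpM.
  by rewrite /nilp exprNn tN mulr0.
rewrite -mulrA -(gustafson_eval QN MU U2 wM sum_w M_big tN nil_ps) //; congr (_ * (_ * _)).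
apply: eq_bigr => j _; rewrite /= !big_cons !big_nil !mulr1 /poch -!big_split /=.
apply: eq_bigr => m _.
have e : t ^+ j = tau ^+ j * tau ^+ j by rewrite -exprM mulnC exprM expr2.
rewrite [t ^+ j.+1]exprS e; move: (tau ^+ j) ((Q ^+ 2) ^+ m) => a b; ring.
Qed.

Lemma poch_level0 (u : k) : (0 < N)%N -> poch N 0 u = 1 - u.
Proof.
case: N => // N0 _; rewrite /poch big_ord_recl expr0 mulr1 big1 ?mulr1 // => i _.
by rewrite exprS mul0r mulr0 subr0.
Qed.

(** At q = 0 the symmetric weight is 1 / ((1 - t e^a) (1 - t e^{-a})) over the
    positive roots; the finite factor cancels half of it. *)
Lemma weight_level0 (x : 'I_n -> k) : (0 < N)%N -> (forall i, x i \is a GRing.unit) ->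
  froot_factor t x * sym_weight N 0 tau (params 0) x =
  \prod_(p : froot n | froot_pos p) (1 - t * mono (- froot_wt p) x)^-1.
Proof.
move=> N0 Ux; have t2N : nilp N t by rewrite /nilp expr2; apply: nilpM.
have U y : 1 - t * y \is a GRing.unit by rewrite (@unit_nilp _ N) //; apply: nilpM.
have mono2 (i j : 'I_n) b : mono (froot_wt (i, j, b)) x = x i * (if b then x j else (x j)^-1).
  rewrite /mono (eq_bigr (fun a => x a ^ (a == i)%:R * x a ^ (if b then (a == j)%:R else - (a == j)%:R))).
    rewrite big_split /= (bigD1 i) //= eqxx expr1z big1 ?mulr1; last first.
      by move=> a /negPf ->; rewrite expr0z.
    congr (_ * _); rewrite (bigD1 j) //= eqxx big1 ?mulr1; last first.
      by move=> a /negPf ->; case: b; rewrite ?oppr0 expr0z.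
    by case: b; rewrite ?expr1z ?exprN1.
  by move=> a _; rewrite ffunE -exprzDr.
rewrite /froot_factor !prod_froot /sym_weight cross_codom /cross_pairs.
rewrite mulrACA; congr (_ * _).
  rewrite -[RHS]mulr1; set P := \prod_(p | _) cross_poch _ _ _ _ _.
  have UP : P \is a GRing.unit.
    apply: (big_rec (fun y => y \is a GRing.unit)); first exact: unitr1.
    move=> i y _ Uy; rewrite unitrMl // /cross_poch !poch_level0 //.
    by rewrite -!mulrA !unitrM; apply/and4P; split; rewrite mulrA -expr2; apply: U.
  apply: (mulIr UP); rewrite /= mulrVK // mulr1 /P -big_split.
  apply: eq_bigr => -[i j] _ /=; rewrite !monoN // !mono2 /cross_poch !poch_level0 //.
  rewrite !invrM ?unitrV // invrK.
  set A := 1 - t * (x i * x j); set B := 1 - t * (x i / x j).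
  have -> : t * x i * x j = t * (x i * x j) by rewrite mulrA.
  have -> : t * x i / x j = t * (x i / x j) by rewrite mulrA.
  have -> : t / x i / x j = t * ((x j)^-1 / x i) by rewrite mulrA mulrAC.
  rewrite -[t * x j / x i]mulrA.
  have VC := mulVr (U ((x j)^-1 / x i)); have VD := mulVr (U (x j / x i)).
  rewrite -/A -/B.
  set C := 1 - _ in VC *; set D := 1 - t * (x j / x i) in VD *.
  transitivity (A * B * (C^-1 * C) * (D^-1 * D)); last by ring.
  by rewrite VC VD; ring.
rewrite -big_split; apply: eq_bigr => i _ /=.
rewrite monoN // mono2 /facs /params mulr0 !big_cons big_nil fac0 !mulr1 /fac.
rewrite !poch_level0 //.
have Ut y : 1 - tau * y \is a GRing.unit by rewrite (@unit_nilp _ N) //; apply: nilpM.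
have Ut' y : 1 - (- tau) * y \is a GRing.unit by rewrite mulNr -mulrN.
transitivity ((1 - t * (x i * x i)) *
  (((1 - tau * x i) * (1 - - tau * x i))^-1 * ((1 - tau / x i) * (1 - - tau / x i))^-1)).
  by rewrite [in RHS]invrM // [((1 - tau / x i) * _)^-1]invrM //; ring.
have -> : (1 - tau * x i) * (1 - - tau * x i) = 1 - t * (x i * x i) by ring.
have -> : (1 - tau / x i) * (1 - - tau / x i) = 1 - t * ((x i)^-1 / x i) by ring.
by rewrite [LHS]mulrA divrr // mul1r [(x i * x i)^-1]invrM.
Qed.

(** At q = 0 the theta determinant is supported on the finite Weyl orbit of rho,
    where the length is constant: cutting it off elsewhere does not destroy the
    antisymmetry. *)
Lemma theta_det_level0 (g : {ffun 'I_n -> int}) :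
  \sum_i g i ^+ 2 != \sum_i rho_wt l i ^+ 2 -> theta_det (0 : k) g = 0.
Proof.
move=> ne_g.
pose B (h : {ffun 'I_n -> int}) : k := if \sum_i h i ^+ 2 == \sum_i rho_wt l i ^+ 2 then 0 else theta_det 0 h.
have [[ts tn] ta] := @theta_det_antisym k 0 l.
have B_rho : B (rho_wt l) = 0 by rewrite /B eqxx.
suff aB : affine_antisym 0 B.
  by have := antisym_affine U2 aB B_rho g; rewrite /B (negPf ne_g).
split; [split|].
- move=> i j h ij; rewrite /B ts //.
  have -> : \sum_a swap_at i j h a ^+ 2 = \sum_a h a ^+ 2.
    rewrite (reindex_inj (@perm_inj _ (tperm i j))) /=.
    by apply: eq_bigr => a _; rewrite ffunE tpermK.
  by case: ifP; rewrite ?oppr0.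
- move=> h; rewrite /B tn //.
  have -> : \sum_a negate_at ord_max h a ^+ 2 = \sum_a h a ^+ 2.
    by apply: eq_bigr => a _; rewrite ffunE; case: eqP; rewrite ?sqrrN.
  by case: ifP; rewrite ?oppr0.
move=> h [|u] h0.
  have e : affine_at ord0 h = h.
    by apply/ffunP => x; rewrite ffunE; case: eqP => // ->; rewrite h0; lia.
  rewrite e expr0 mulN1r /B; case: ifP => _; first by rewrite oppr0.
  by have := ta h 0%N h0; rewrite e expr0 mulN1r.
by rewrite exprS mul0r oppr0 mul0r /B (ta _ _ h0) exprS !mul0r oppr0 mul0r if_same.
Qed.

(** At q = 0 the weight is the product over all positive finite roots of
    1 / (1 - t e^{-a}), and only the trivial term contributes: rho + b is longer
    than rho for every nonzero b in the cone of the positive roots. *)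
Lemma CT_weight0 :
    (theta_deg N n + (n + 2 * (N * #|{: 'I_n * 'I_n * bool}|)) < M)%N ->
  CT N 0 M' w (fun x : 'I_n -> k =>
    xrho x * (froot_factor t x * sym_weight N 0 tau (params 0) x)) = 1.
Proof.
move=> lt_M; have N0 : (0 < N)%N.
  by case: N tN => // /eqP; rewrite /nilp expr0 oner_eq0.
have qN : (0 : k) ^+ N = 0 by rewrite expr0n eqn0Ngt N0.
have t2N : nilp N t by rewrite /nilp expr2; apply: nilpM.
pose wt (f : {ffun froot n -> 'I_N}) := \sum_(p | froot_pos p) froot_wt p *+ f p.
pose c (f : {ffun froot n -> 'I_N}) : k :=
  \prod_p (if froot_pos p then t ^+ f p else (f p == 0 :> nat)%:R).
transitivity (\sum_f c f * theta_det 0 (rho_wt l + wt f)).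
  rewrite (@eq_CT _ N 0 _ _ wM _ _ (fun x => \sum_f c f * mono (- (rho_wt l + wt f)) x)).
    rewrite CT_sum; apply: eq_bigr => f _; rewrite CTZ (CT_mono qN MU wM sum_w lt_M) //.
    move=> i; rewrite ffunE; apply: le_trans (ler_normD _ _) _.
    rewrite PoszD; apply: lerD; first by rewrite ffunE ger0_norm // lez_nat leq_subr.
    rewrite /wt sum_ffunE; apply: le_trans (ler_norm_sum _ _ _) _.
    have -> : (2 * (N * #|{: 'I_n * 'I_n * bool}|))%N%:Z = \sum_(p : froot n) (2 * N)%N%:Z.
      by rewrite sumr_const -mulr_natl natz -PoszM; congr Posz; rewrite mulnA mulnC.
    rewrite big_mkcond; apply: ler_sum => p _; case: ifP => // _.
    rewrite ffunMnE normrMn -mulr_natl natz.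
    have le1 : `|froot_wt p i| <= 2%:Z.
      rewrite ffunE; case: (i == _); case: (i == _); case: (p.2) => //.
    have le_f : (f p)%:Z <= N%:Z by rewrite lez_nat; exact: (ltnW (ltn_ord (f p))).
    by rewrite mulnC PoszM; apply: ler_pM.
  move=> x Ux; rewrite weight_level0 //.
  have nilm p : (t * mono (- froot_wt p) x) ^+ N = 0 by apply: nilpM.
  transitivity (xrho x * \prod_(p : froot n) \sum_(m < N)
      (if froot_pos p then (t * mono (- froot_wt p) x) ^+ m else (m == 0 :> nat)%:R)).
    congr (_ * _); rewrite big_mkcond; apply: eq_bigr => p _; case: ifP => _.
      by rewrite (inv_nilp (nilm p)).
    rewrite -(prednK N0).
    by rewrite big_ord_recl /= big1 ?addr0.
  rewrite bigA_distr_bigA mulr_sumr; apply: eq_bigr => f _.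
  have -> : - (rho_wt l + wt f) = - rho_wt l + \sum_(p | froot_pos p) (- froot_wt p) *+ f p.
    by rewrite opprD /wt -sumrN; congr (_ + _); apply: eq_bigr => p _; rewrite mulNrn.
  rewrite monoD // mono_sum // -mono_rho mulrCA; congr (_ * _).
  rewrite /c [X in _ * X]big_mkcond -big_split; apply: eq_bigr => p _ /=.
  by case: ifP => _; rewrite ?mulr1 // monoMn // exprMn.
have f0P : exists f0 : {ffun froot n -> 'I_N}, forall p, f0 p = 0%N :> nat.
  by exists [ffun => Ordinal N0] => p; rewrite ffunE.
have [f0 f0E] := f0P.
rewrite (bigD1 f0) //= [X in _ + X]big1 ?addr0.
  rewrite /c big1 ?mul1r; last by move=> p _; rewrite f0E expr0; case: ifP.
  rewrite /wt big1 ?addr0 ?theta_det_rho // => p _; by rewrite f0E mulr0n.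
move=> f ne_f.
case: (boolP [exists p, (~~ froot_pos p) && (f p != 0%N :> nat)]) => [/existsP[p /andP[np fp]]|].
  by rewrite /c (bigD1 p) //= (negPf np) (negPf fp) !mul0r.
move=> /existsPn small; rewrite theta_det_level0 ?mulr0 //.
have [p fp] : exists p, f p != 0%N :> nat.
  apply/existsP; apply: contraNT ne_f => /existsPn z; apply/eqP/ffunP => p.
  by apply: val_inj; rewrite /= f0E; apply/eqP; rewrite -[_ == _]negbK.
have pp : froot_pos p by have := small p; rewrite fp andbT negbK.
pose r p : int := \sum_i rho_wt l i * froot_wt p i.
have r_pos p' : froot_pos p' -> 0 < r p'.
  case: p' => [[i j] b] pos_p; rewrite /r.
  have rhoE (a0 : 'I_n) : \sum_a rho_wt l a * (a == a0)%:R = (n - a0)%N%:Z.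
    rewrite (bigD1 a0) //= eqxx mulr1 ffunE big1 ?addr0 // => a /negPf ->.
    by rewrite mulr0.
  rewrite (eq_bigr (fun a => rho_wt l a * (a == i)%:R +
     (if b then rho_wt l a * (a == j)%:R else - (rho_wt l a * (a == j)%:R)))); last first.
    by move=> a _; rewrite [froot_wt _ _]ffunE /=; case: b {pos_p}; rewrite ?mulrDr ?mulrN.
  have lt_i := ltn_ord i; have lt_j := ltn_ord j.
  rewrite big_split /= rhoE; case: b pos_p => pos_p; first by rewrite rhoE; lia.
  rewrite sumrN rhoE; move: pos_p; rewrite /froot_pos /= andbF orbF; lia.
have rE : \sum_i rho_wt l i * wt f i = \sum_(p' | froot_pos p') r p' * (f p')%:Z.
  rewrite /wt; under eq_bigr => i _ do rewrite sum_ffunE mulr_sumr.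
  rewrite exchange_big; apply: eq_bigr => p' _; rewrite /r mulr_suml.
  by apply: eq_bigr => i _; rewrite ffunMnE -mulr_natr natz mulrA.
have r1 : 0 < \sum_i rho_wt l i * wt f i.
  rewrite rE (bigD1 p) //=; apply: ltr_pwDl.
    by apply: mulr_gt0; [exact: r_pos | lia].
  by apply: sumr_ge0 => p' /andP[pp' _]; apply: mulr_ge0 => //; apply/ltW/r_pos.
have r2 : 0 <= \sum_i wt f i ^+ 2 by apply: sumr_ge0 => i _; exact: sqr_ge0.
have -> : \sum_i (rho_wt l + wt f) i ^+ 2 = \sum_i rho_wt l i ^+ 2 +
   2 * (\sum_i rho_wt l i * wt f i) + \sum_i wt f i ^+ 2.
  rewrite mulr_sumr -!big_split; apply: eq_bigr => i _ /=.
  by rewrite [(_ + _ : {ffun _ -> _}) _]ffunE; ring.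
apply/eqP; lia.
Qed.

Hypothesis M_big0 :
  (theta_deg N n + (n + 2 * (N * #|{: 'I_n * 'I_n * bool}|)) < M)%N.

(** Comparison of the two values of the constant term at q = 0. *)
Lemma fin_const_eval : fin_const t * (1 - t) ^+ n = \prod_(j < n) (1 - (t ^+ j.+1) ^+ 2).
Proof.
have N0 : (0 < N)%N.
  by case: N tN => // /eqP; rewrite /nilp expr0 oner_eq0.
have Q0 : (0 : k) ^+ 2 = 0 by rewrite expr0n.
have QN : ((0 : k) ^+ 2) ^+ N = 0 by rewrite Q0 expr0n eqn0Ngt N0.
have := CT_weight QN; rewrite Q0 poch_level0 // CT_weight0 // mul1r => <-.
rewrite /denominator; apply: eq_bigr => j _.
case: N N0 => // N' _; rewrite big_ord_recl big1 ?mulr1.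
  by rewrite mulr0 expr0n subr0 mulr1.
by move=> i _; rewrite Q0 lift0 [0 ^+ i.+1]exprS !(mul0r, mulr0) !expr0n !subr0 mulr1.
Qed.

(** The denominator without its factors at q = 0, which fin_const cancels. *)
Definition reduced_denominator (Q : k) : k :=
  \prod_(j < n) \prod_(m < N)
    ((1 - (t ^+ j.+1 * (Q ^+ 2) ^+ m.+1) ^+ 2) *
     (1 - (t ^+ j * tau * s * Q * (Q ^+ 2) ^+ m) ^+ 2)).

(** Up to the contribution of the imaginary roots, this is the product formula for
    the generating function. *)
Lemma CT_weight_eval Q : (Q ^+ 2) ^+ N = 0 ->
  CT N (Q ^+ 2) M' w (fun x : 'I_n -> k =>
    xrho x * (froot_factor t x * sym_weight N (Q ^+ 2) tau (params Q) x)) *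
  reduced_denominator Q = poch N (Q ^+ 2) (Q ^+ 2 * t) ^+ n.
Proof.
move=> QN; have t2N : nilp N t by rewrite /nilp expr2; apply: nilpM.
have U : \prod_(j < n) (1 - (t ^+ j.+1) ^+ 2) \is a GRing.unit.
  apply: (big_rec (fun y => y \is a GRing.unit)); first exact: unitr1.
  move=> j y _ Uy; rewrite unitrMl // (@unit_nilp _ N) // [t ^+ _]exprS expr2.
  by do 2!apply: nilpM.
have rhs : poch N (Q ^+ 2) (Q ^+ 2 * t) ^+ n * \prod_(j < n) (1 - (t ^+ j.+1) ^+ 2) =
    fin_const t * poch N (Q ^+ 2) t ^+ n.
  by rewrite -fin_const_eval mulrCA -exprMn (poch_shift QN t) [_ * (1 - t)]mulrC.
apply: (mulIr U); rewrite /= rhs -CT_weight // -mulrA; congr (_ * _).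
rewrite /reduced_denominator /denominator -big_split; apply: eq_bigr => j _.
rewrite !big_split /= mulrAC; congr (_ * _).
have : (Q ^+ 2) ^+ N = 0 := QN; case: N => [|N'] QN'; first by move: (oner_neq0 k); rewrite -QN' expr0 eqxx.
rewrite [RHS]big_ord_recl [X in X * _]big_ord_recr /= QN' mulr0 expr0n subr0 mulr1.
by rewrite mulrC expr0 mulr1; congr (_ * _); apply: eq_bigr => m _; rewrite /bump leq0n add1n.
Qed.

End Evaluation.

(** * Coordinates and simple reflections *)

Local Open Scope classical_set_scope.
Local Open Scope ring_scope.

(** Two block triangular factorizations of the same matrix. *)
Lemma det_rank1 (R : comNzRingType) m (u : 'cV[R]_m) (v : 'rV[R]_m) :
  \det (1%:M - u *m v) = 1 - (v *m u) 0 0.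
Proof.
pose A : 'M_(m + 1) := block_mx 1%:M 0 v 1%:M.
pose B : 'M_(m + 1) := block_mx (1%:M - u *m v) (- u) 0 1%:M.
have : A *m B = block_mx 1%:M (- u) 0 (1%:M - v *m u) *m A.
  rewrite !mulmx_block ?mul1mx ?mulmx1 ?mul0mx ?mulmx0 ?addr0 ?add0r mulNmx.
  by rewrite mulmxBr mulmx1 mulmxN mulmxBl mul1mx mulmxA [_ + 1%:M]addrC.
move/(congr1 determinant); rewrite !det_mulmx det_lblock !det_ublock !det1 !mul1r !mulr1.
by move=> ->; rewrite [_ - _]mx11_scalar det_scalar1 !mxE.
Qed.

Section Coordinates.
Variables (F : numFieldType) (l : nat).
Notation n := l.+1.
Implicit Type v : hdual F n.

(** The coefficients at Lambda_0, eps_{a+1} and delta. *)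
Definition level v : F := v 0 (inord 0).
Definition coord v (a : 'I_n) : F := v 0 (inord a.+1).
Definition dcoord v : F := v 0 (inord n.+1).

Lemma hdualP v v' : level v = level v' -> (forall a, coord v a = coord v' a) ->
  dcoord v = dcoord v' -> v = v'.
Proof.
move=> el ec ed; apply/rowP => i; rewrite -(inord_val i).
case: i => -[|i] lt_i //=; case: (ltnP i n) => lt_in; first exact: (ec (Ordinal lt_in)).
have -> : i = n by lia.
exact: ed.
Qed.

Lemma inord_eq i j : (i < n.+2)%N -> (j < n.+2)%N ->
  (inord i == inord j :> 'I_n.+2) = (i == j).
Proof. by move=> lt_i lt_j; rewrite -val_eqE /= !inordK. Qed.

Lemma delta_mx_coord i j : (i < n.+2)%N -> (j < n.+2)%N ->
  (delta_mx 0 (inord i) : hdual F n) 0 (inord j) = (i == j)%:R.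
Proof. by move=> lt_i lt_j; rewrite mxE eqxx inord_eq // eq_sym. Qed.

Lemma level_eps i : (0 < i < n.+2)%N -> level (eps i : hdual F n) = 0.
Proof.
move=> i_rng; rewrite /level delta_mx_coord //; last by lia.
by have -> : (i == 0)%N = false by lia.
Qed.

Lemma coord_eps i a : (0 < i < n.+2)%N -> coord (eps i : hdual F n) a = (i == a.+1)%:R.
Proof. by move=> i_rng; have lt_a := ltn_ord a; rewrite /coord delta_mx_coord //; lia. Qed.

Lemma dcoord_eps i : (0 < i <= n)%N -> dcoord (eps i : hdual F n) = 0.
Proof.
move=> i_rng; rewrite /dcoord delta_mx_coord //; last by lia.
by have -> : (i == n.+1)%N = false by lia.
Qed.

Lemma level_delta : level (delta : hdual F n) = 0.
Proof. by rewrite /level delta_mx_coord. Qed.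

Lemma coord_delta a : coord (delta : hdual F n) a = 0.
Proof.
have lt_a := ltn_ord a; rewrite /coord delta_mx_coord //; last by lia.
by have -> : (n.+1 == a.+1)%N = false by lia.
Qed.

Lemma dcoord_delta : dcoord (delta : hdual F n) = 1.
Proof. by rewrite /dcoord delta_mx_coord // eqxx. Qed.

Lemma level_Lambda0 : level (Lambda0 : hdual F n) = 1.
Proof. by rewrite /level delta_mx_coord. Qed.

Lemma coord_Lambda0 a : coord (Lambda0 : hdual F n) a = 0.
Proof. by have lt_a := ltn_ord a; rewrite /coord delta_mx_coord //; lia. Qed.

Lemma levelD v v' : level (v + v') = level v + level v'. Proof. by rewrite /level mxE. Qed.
Lemma levelN v : level (- v) = - level v. Proof. by rewrite /level mxE. Qed.
Lemma levelZ c v : level (c *: v) = c * level v. Proof. by rewrite /level mxE. Qed.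
Lemma coordD v v' a : coord (v + v') a = coord v a + coord v' a.
Proof. by rewrite /coord mxE. Qed.
Lemma coordN v a : coord (- v) a = - coord v a. Proof. by rewrite /coord mxE. Qed.
Lemma coordZ c v a : coord (c *: v) a = c * coord v a. Proof. by rewrite /coord mxE. Qed.
Lemma dcoordD v v' : dcoord (v + v') = dcoord v + dcoord v'.
Proof. by rewrite /dcoord mxE. Qed.
Lemma dcoordN v : dcoord (- v) = - dcoord v. Proof. by rewrite /dcoord mxE. Qed.
Lemma dcoordZ c v : dcoord (c *: v) = c * dcoord v. Proof. by rewrite /dcoord mxE. Qed.

Lemma formE v v' : form v v' =
  \sum_a coord v a * coord v' a + level v * dcoord v' + dcoord v * level v'.
Proof. by rewrite /form big_add1 /= big_mkord. Qed.

Lemma level_simple i : level (simple_root F i : hdual F n) = 0.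
Proof.
have lt_i := ltn_ord i; rewrite /simple_root; case: eqP => i0; last case: eqP => il.
- rewrite levelD levelN levelZ level_delta level_eps ?mulr0 ?subr0 //; lia.
- rewrite levelZ level_eps ?mulr0 //; lia.
rewrite levelD levelN !level_eps ?subr0 //; lia.
Qed.

Lemma dcoord_simple i : dcoord (simple_root F i : hdual F n) = if i == 0 :> nat then 2^-1 else 0.
Proof.
have lt_i := ltn_ord i; rewrite /simple_root; case: eqP => i0; last case: eqP => il.
- rewrite dcoordD dcoordN dcoordZ dcoord_delta dcoord_eps ?subr0 ?mulr1 //; lia.
- rewrite dcoordZ dcoord_eps ?mulr0 //; lia.
rewrite dcoordD dcoordN !dcoord_eps ?subr0 //; lia.
Qed.

Lemma coord_simple i (a : 'I_n) : coord (simple_root F i : hdual F n) a =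
  if i == 0 :> nat then - (a == 0 :> nat)%:R
  else if i == n :> nat then 2 * (a.+1 == n)%:R
  else (a.+1 == i :> nat)%:R - (a == i :> nat)%:R.
Proof.
have lt_i := ltn_ord i; rewrite /simple_root; case: eqP => i0; last case: eqP => il.
- rewrite coordD coordN coordZ coord_delta coord_eps; last by lia.
  by rewrite mulr0 sub0r eqSS eq_sym.
- rewrite coordZ coord_eps; last by lia.
  by rewrite eq_sym.
rewrite coordD coordN !coord_eps; try lia.
by rewrite eqSS; congr (_%:R - _%:R); rewrite eq_sym.
Qed.

Lemma form_linear a : linear_for *%R (fun v : hdual F n => form v a).
Proof.
move=> c v v'; rewrite !formE levelD levelZ dcoordD dcoordZ.
rewrite (eq_bigr (fun b => c * (coord v b * coord a b) + coord v' b * coord a b)).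
  by rewrite big_split -mulr_sumr /=; ring.
by move=> b _; rewrite coordD coordZ; ring.
Qed.

Lemma coroot_pairing_linear a : linear_for *%R (fun v : hdual F n => coroot_pairing v a).
Proof. by move=> c v v'; rewrite /coroot_pairing form_linear; ring. Qed.

Lemma reflection_rank1 (a : hdual F n) : reflection a =
  1%:M - (\col_i coroot_pairing (delta_mx 0 i : hdual F n) a) *m a.
Proof.
apply/matrixP => i j; rewrite !mxE big_ord1 !mxE; congr (_ - _).
by rewrite eq_sym.
Qed.

Lemma mul_reflection v (a : hdual F n) : v *m reflection a = v - coroot_pairing v a *: a.
Proof.
rewrite reflection_rank1 mulmxBr mulmx1 mulmxA; congr (_ - _).
rewrite [v *m _]mx11_scalar mul_scalar_mx; congr (_ *: _); rewrite mxE.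
have := row_sum_delta v; move=> {2}->.
pose f := fun v : hdual F n => coroot_pairing v a.
have fD x y : f (x + y) = f x + f y.
  by have := coroot_pairing_linear a 1 x y; rewrite scale1r mul1r.
have f0 : f 0 = 0.
  have := fD 0 0; rewrite addr0 => e.
  by apply: (addrI (f 0)); rewrite addr0 -e.
have fZ c x : f (c *: x) = c * f x.
  by have := coroot_pairing_linear a c x 0; rewrite addr0 -/(f 0) f0 addr0.
rewrite -/(f _) (big_morph f fD f0); apply: eq_bigr => i _.
by rewrite fZ mxE.
Qed.

Lemma pairing_simple v (i : 'I_n.+1) : coroot_pairing v (simple_root F i) =
  if i == 0 :> nat then level v - 2 * coord v ord0
  else if i == n :> nat then coord v ord_max
  else coord v (inord i.-1) - coord v (inord i).
Proof.
have lt_i := ltn_ord i.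
have n2 : (2 : F) != 0 by rewrite pnatr_eq0.
rewrite /coroot_pairing !formE !level_simple !dcoord_simple !mulr0 !addr0.
case: eqP => i0.
  rewrite (bigD1 ord0) //= big1 => [|a a0]; last first.
    by rewrite coord_simple i0 eqxx /= (_ : (a == 0 :> nat) = false) ?oppr0 ?mulr0 //; apply: negPf.
  rewrite (bigD1 ord0) //= big1 => [|a a0]; last first.
    by rewrite coord_simple i0 eqxx /= (_ : (a == 0 :> nat) = false) ?oppr0 ?mulr0 //; apply: negPf.
  rewrite !coord_simple i0 eqxx /= mul0r !addr0; by field.
case: eqP => il.
  rewrite (bigD1 ord_max) //= big1 => [|a]; last first.
    rewrite -val_eqE /= => a0; rewrite coord_simple il /= eqxx eqSS (negPf a0) !mulr0 //.
  rewrite (bigD1 ord_max) //= big1 => [|a]; last first.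
    rewrite -val_eqE /= => a0; rewrite coord_simple il /= eqxx eqSS (negPf a0) !mulr0 //.
  by rewrite !coord_simple il /= eqxx /= !mulr1 !mulr0 !addr0; field.
rewrite !mulr0 !addr0.
have lt_in : (i < n)%N by lia.
have sum2 (f : 'I_n -> F) : \sum_a f a * coord (simple_root F i) a =
    f (inord i.-1) - f (inord i).
  under eq_bigr => a _ do rewrite coord_simple (negPf (introN eqP i0)) (negPf (introN eqP il)) mulrBr.
  rewrite sumrB; congr (_ - _).
    rewrite (bigD1 (inord i.-1)) //= inordK ?prednK ?eqxx ?mulr1 ?big1 ?addr0 //; try lia.
    move=> a; rewrite -val_eqE /= inordK; last by lia.
    by move=> ne; rewrite (_ : (a.+1 == i) = false) ?mulr0 //; lia.
  rewrite (bigD1 (inord i)) //= inordK ?eqxx ?mulr1 ?big1 ?addr0 //.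
  move=> a; rewrite -val_eqE /= inordK // => ne.
  by rewrite (negPf ne) mulr0.
rewrite !sum2 !coord_simple (negPf (introN eqP i0)) (negPf (introN eqP il)) !inordK //; try lia.
rewrite prednK ?eqxx; last by lia.
have -> : (i.-1 == i) = false by lia.
have -> : (i.+1 == i) = false by lia.
by rewrite /= subr0 sub0r; field.
Qed.

Lemma pairing_simple_self (i : 'I_n.+1) :
  coroot_pairing (simple_root F i) (simple_root F i) = 2.
Proof.
have lt_i := ltn_ord i.
rewrite pairing_simple level_simple !coord_simple /=; case: eqP => i0.
  by rewrite /=; ring.
case: eqP => il; first by rewrite eqxx mulr1.
rewrite !inordK; try lia.
rewrite prednK ?eqxx; last by lia.
have -> : (i.-1 == i) = false by lia.
have -> : (i.+1 == i) = false by lia.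
by rewrite /=; ring.
Qed.

Lemma det_simple_reflection (i : 'I_n.+1) : \det (reflection (simple_root F i)) = - 1.
Proof.
rewrite reflection_rank1 det_rank1.
have -> : (simple_root F i *m \col_j coroot_pairing (delta_mx 0 j : hdual F n) (simple_root F i)) 0 0 = 2.
  rewrite -(pairing_simple_self i); have := mul_reflection (simple_root F i) (simple_root F i).
  rewrite reflection_rank1 mulmxBr mulmx1 mulmxA => /addrI /oppr_inj.
  rewrite [_ *m \col_j _]mx11_scalar mul_scalar_mx.
  move/rowP => e; have [j nz] : exists j, simple_root F i 0 j != 0.
    case: (pselect (exists j, simple_root F i 0 j != 0)) => // nE.
    have z : simple_root F i = 0.
      apply/rowP => j; rewrite mxE; apply/eqP; apply/negPn/negP => nz.
      by apply: nE; exists j.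
    have := pairing_simple_self i; rewrite z.
    have := coroot_pairing_linear 0 0 0 0; rewrite mul0r scale0r add0r.
    rewrite /coroot_pairing (_ : form 0 0 = 0) ?mulr0 ?mul0r.
      by move=> _ /eqP; rewrite eq_sym pnatr_eq0.
    by rewrite formE /level /dcoord /coord !mxE !mulr0 !addr0 big1 // => a _; rewrite mxE mulr0.
  have := e j; rewrite !mxE => /(mulIf nz).
  by rewrite eqxx mulr1n.
ring.
Qed.

End Coordinates.

(** * The affine Weyl group *)

Section WeylAction.
Variables (F : numFieldType) (l : nat).
Notation n := l.+1.
Implicit Type v : hdual F n.

Notation refl i := (reflection (simple_root F (i : 'I_n.+1))).

Lemma refl_level v i : level (v *m refl i) = level v.
Proof. by rewrite mul_reflection levelD levelN levelZ level_simple mulr0 subr0. Qed.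

Lemma refl0_coord v a : coord (v *m refl ord0) a =
  if a == ord0 then level v - coord v a else coord v a.
Proof.
rewrite mul_reflection coordD coordN coordZ pairing_simple coord_simple /=.
have -> : (a == 0 :> nat) = (a == ord0) by [].
case: eqP => [->|_] /=; first by ring.
by rewrite oppr0 mulr0 subr0.
Qed.

Lemma refl0_dcoord v : dcoord (v *m refl ord0) = dcoord v - (level v - 2 * coord v ord0) / 2.
Proof. by rewrite mul_reflection dcoordD dcoordN dcoordZ pairing_simple dcoord_simple. Qed.

Lemma refl_dcoord v i : i != ord0 -> dcoord (v *m refl i) = dcoord v.
Proof.
move=> /negPf i0; rewrite mul_reflection dcoordD dcoordN dcoordZ dcoord_simple.
by rewrite (_ : (i == 0 :> nat) = false) ?mulr0 ?subr0 // -i0.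
Qed.

Lemma refl_max_coord v a : coord (v *m refl ord_max) a =
  if a == ord_max then - coord v a else coord v a.
Proof.
rewrite mul_reflection coordD coordN coordZ pairing_simple coord_simple /= eqxx.
rewrite eqSS (_ : (a == l :> nat) = (a == ord_max)) //.
by case: eqP => [->|_] /=; ring.
Qed.

Lemma refl_mid_coord v (a b c : 'I_n) (i : 'I_n.+1) : b = a.+1 :> nat -> i = b :> nat ->
  coord (v *m refl i) c = coord v (tperm a b c).
Proof.
move=> ab ib; have lt_b := ltn_ord b.
rewrite mul_reflection coordD coordN coordZ pairing_simple coord_simple ib ab /=.
have -> : (a.+1 == n) = false by lia.
have -> : inord a = a by apply: inord_val.
have -> : inord a.+1 = b by rewrite -ab; apply: inord_val.
rewrite eqSS; case: tpermP => [->|->|/eqP ca /eqP cb].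
- by rewrite eqxx (_ : (a == a.+1 :> nat) = false) /=; [ring | lia].
- by rewrite ab eqxx (_ : (a.+1 == a) = false) /=; [ring | lia].
rewrite -val_eqE /= in ca; rewrite -val_eqE /= ab in cb.
by rewrite (negPf ca) (negPf cb) /=; ring.
Qed.

(** A signed permutation (s, e) of the coordinates followed by the translation by b
    at the level of v; the last equation expresses the invariance of the form. *)
Definition weyl_param (w : 'M[F]_(n.+2)) (s : 'S_n) (e : {ffun 'I_n -> bool})
    (b : {ffun 'I_n -> int}) : Prop :=
  forall v, [/\ level (v *m w) = level v,
    forall a, coord (v *m w) a = (-1) ^+ e a * coord v (s a) + (b a)%:~R * level v &
    dcoord (v *m w) = dcoord v - \sum_a ((-1) ^+ e a * coord v (s a) * (b a)%:~R +
       (b a)%:~R ^+ 2 / 2 * level v)].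

(** Every simple reflection preserves the shape of these formulas: reflection 0 is
    the sign change of the first coordinate followed by a translation. *)
Lemma weyl_paramP w : weyl_group F n w -> exists s e b, weyl_param w s e b.
Proof.
case=> r -> {w}; elim/last_ind: r => [|r i IH].
  exists 1%g, [ffun => false], [ffun => 0] => v; rewrite big_nil mulmx1.
  split=> [//|a|]; first by rewrite !ffunE perm1 mul0r addr0 mul1r.
  by rewrite big1 ?subr0 // => a _; rewrite !ffunE mulr0 mulr0z expr0n mul0r mul0r addr0.
have {IH} [s [e [b Pw]]] := IH; rewrite big_rcons /=.
set w := \prod_(j <- r) _ in Pw *.
have [i0|i0] := eqVneq i ord0.
  exists s, [ffun a => (a == ord0) (+) e a], [ffun a => if a == ord0 then 1 - b a else b a].
  move=> v; have [Pl Pc Pd] := Pw v; rewrite mulmxA i0 refl_level refl0_dcoord Pl Pd.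
  split=> [//|a|].
    rewrite refl0_coord Pc Pl !ffunE; case: eqP => //= _; rewrite signrN; ring.
  rewrite Pc (bigD1 ord0) //= [in RHS](bigD1 ord0) //= !ffunE eqxx /= signrN.
  rewrite [in RHS](eq_bigr (fun a => (-1) ^+ e a * coord v (s a) * (b a)%:~R +
       (b a)%:~R ^+ 2 / 2 * level v)).
    by rewrite rmorphB /=; field.
  by move=> a /negPf a0; rewrite !ffunE a0.
have [im|im] := eqVneq i ord_max.
  exists s, [ffun a => (a == ord_max) (+) e a], [ffun a => if a == ord_max then - b a else b a].
  move=> v; have [Pl Pc Pd] := Pw v; rewrite mulmxA im refl_level refl_dcoord // Pl Pd.
  split=> [//|a|].
    rewrite refl_max_coord Pc !ffunE; case: eqP => //= _; rewrite signrN; ring.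
  congr (_ - _); apply: eq_bigr => a _; rewrite !ffunE; case: eqP => //= _.
  by rewrite signrN rmorphN /= sqrrN; congr (_ + _); ring.
have lt_i := ltn_ord i.
have i_gt0 : (0 < i)%N by rewrite lt0n -[_ == _]/(i == ord0).
have i_lt : (i < n)%N.
  by rewrite ltn_neqAle -ltnS lt_i andbT -[_ == _]/(i == ord_max).
have i1_lt : (i.-1 < n)%N by lia.
pose a0 := Ordinal i1_lt; pose b0 := Ordinal i_lt.
have ab : b0 = a0.+1 :> nat by rewrite /= prednK.
pose p := tperm a0 b0.
exists (p * s)%g, [ffun a => e (p a)], [ffun a => b (p a)].
move=> v; have [Pl Pc Pd] := Pw v; rewrite mulmxA refl_level refl_dcoord // Pl Pd.
split=> [//|a|].
  by rewrite (@refl_mid_coord _ a0 b0) // Pc !ffunE permM.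
congr (_ - _); rewrite (reindex_inj (@perm_inj _ p)) /=; apply: eq_bigr => a _.
by rewrite !ffunE permM.
Qed.

Lemma weyl_group1 : weyl_group F n 1%:M.
Proof. by exists [::]; rewrite big_nil. Qed.

Lemma weyl_groupM w i : weyl_group F n w -> weyl_group F n (w *m refl i).
Proof. by case=> r ->; exists (rcons r i); rewrite big_rcons. Qed.

(** The sign is a power of -1, because each simple reflection has determinant -1. *)
Lemma weyl_det w : weyl_group F n w -> exists b : bool, \det w = (-1) ^+ b.
Proof.
case=> r ->; elim/last_ind: r => [|r i [b e]].
  by exists false; rewrite big_nil expr0; exact: det1.
exists (~~ b); rewrite big_rcons /= -[_ * _]/(_ *m _) det_mulmx e det_simple_reflection.
by rewrite mulrN1; case: b {e}; rewrite ?opprK.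
Qed.

Lemma sign_det (w : 'M[F]_(n.+2)) (b : bool) : \det w = (-1) ^+ b -> sign w = (-1) ^+ b.
Proof.
rewrite /sign => ->; rewrite /sgz signr_eq0; case: b; rewrite ?expr0 ?expr1.
  by rewrite ltrN10.
by rewrite ltr10.
Qed.

Lemma sign_refl w i : weyl_group F n w -> sign (w *m refl i) = - sign w.
Proof.
move=> Ww; have [b e] := weyl_det Ww.
rewrite (sign_det e) (@sign_det _ (~~ b)) ?signrN //.
by rewrite det_mulmx det_simple_reflection e mulrN1.
Qed.

Lemma sign1 : sign (1%:M : 'M[F]_(n.+2)) = 1.
Proof. by rewrite (@sign_det _ false) ?det1. Qed.

End WeylAction.

(** * The orbit of Lambda_0 + rho *)

Section WeylOrbit.
Variables (F : numFieldType) (l : nat).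
Notation n := l.+1.
Variable rho : hdual F n.
Hypothesis hrho : weyl_vector rho.
Let Lam : hdual F n := Lambda0 + rho.
Notation refl i := (reflection (simple_root F (i : 'I_n.+1))).

Lemma coord_rho a : coord rho a = (n - a)%N%:R.
Proof.
have gen m : forall b : 'I_n, (b + m = l)%N -> coord rho b = m.+1%:R.
  elim: m => [|m IH] b bm.
    have := hrho ord_max; rewrite pairing_simple /= eqxx => <-.
    by congr coord; apply: val_inj; rewrite /=; lia.
  have lt_b : (b.+1 < n)%N by lia.
  have := hrho (widen_ord (leqnSn _) (Ordinal lt_b)).
  rewrite pairing_simple /=; have -> : (b.+1 == n) = false by lia.
  have -> : inord b = b by apply: inord_val.
  have -> : inord b.+1 = Ordinal lt_b by apply: val_inj; rewrite /= inordK.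
  rewrite (IH (Ordinal lt_b)) /=; last by lia.
  by move/eqP; rewrite subr_eq => /eqP ->; rewrite -[m.+2]add1n natrD.
have lt_a := ltn_ord a; rewrite (gen (l - a)%N); last by lia.
by congr (_%:R); lia.
Qed.

Lemma level_rho : level rho = (2 * n).+1%:R.
Proof.
have := hrho ord0; rewrite pairing_simple /= coord_rho subn0.
by move/eqP; rewrite subr_eq => /eqP ->; rewrite -natrM -[(2 * n).+1]add1n natrD.
Qed.

Lemma level_Lam : level Lam = (2 * n).+2%:R.
Proof. by rewrite /Lam levelD level_Lambda0 level_rho -[in RHS]add1n natrD. Qed.

Lemma coord_Lam a : coord Lam a = (n - a)%N%:R.
Proof. by rewrite /Lam coordD coord_Lambda0 add0r coord_rho. Qed.

Definition in_orbit (w : 'M[F]_(n.+2)) (g : {ffun 'I_n -> int}) : Prop :=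
  weyl_group F n w /\ forall a, coord (Lam *m w) a = (g a)%:~R.

Definition norm2 (g : {ffun 'I_n -> int}) : int := \sum_a g a ^+ 2.

(** The translation part of w moves the coordinates by multiples of 2 n + 2, the level
    of Lambda_0 + rho.  The drop D along delta is a sum of theta exponents, hence
    nonnegative, and the invariance of the form relates it to the length of g. *)
Lemma weyl_orbit w : weyl_group F n w -> exists (g : {ffun 'I_n -> int}) (D : nat),
  [/\ in_orbit w g, dcoord (Lam *m w) = dcoord Lam - D%:R &
      norm2 g - norm2 (rho_wt l) = (4 * n.+1)%N%:Z * D%:Z].
Proof.
move=> Ww; have [s [e [b Pw]]] := weyl_paramP Ww; have [Pl Pc Pd] := Pw Lam.
pose r a : int := (n - s a)%N%:Z; pose d a := (-1) ^+ e a * r a * b a + b a ^+ 2 * n.+1%:Z.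
have d0 a : 0 <= d a.
  have lt_s := ltn_ord (s a).
  have := @theta_exp_ge n (n - s a) ((-1) ^+ e a * b a) (leq_subr _ _).
  rewrite /theta_exp exprMn sqrr_sign mul1r /d /r => le1.
  by apply: le_trans (sqr_ge0 (b a)) _; apply: le_trans le1 _; rewrite le_eqVlt; apply/orP; left; apply/eqP; ring.
have sum0 : 0 <= \sum_a d a by apply: sumr_ge0.
exists [ffun a => (-1) ^+ e a * r a + b a * (2 * n).+2%:Z], (absz (\sum_a d a)).
split.
- split=> // a; rewrite Pc level_Lam coord_Lam ffunE rmorphD !rmorphM /= rmorph_sign.
  by rewrite /r -!pmulrn.
- rewrite Pd natr_absz ger0_norm // rmorph_sum /=; congr (_ - _); apply: eq_bigr => a _.
  have e1 : (d a)%:~R = (-1) ^+ e a * (n - s a)%N%:R * (b a)%:~R + (b a)%:~R ^+ 2 * n.+1%:R :> F.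
    by rewrite /d rmorphD [X in _ + X]rmorphM rmorphXn !rmorphM /= rmorph_sign -!pmulrn.
  rewrite e1 level_Lam coord_Lam; congr (_ + _); rewrite -mulrA; congr (_ * _).
  have -> : (2 * n).+2%:R = 2 * n.+1%:R :> F by rewrite -natrM; congr (_%:R); lia.
  by field.
have -> : norm2 (rho_wt l) = \sum_a (r a) ^+ 2.
  rewrite /norm2 (reindex_inj (@perm_inj _ s)) /=.
  by apply: eq_bigr => a _; rewrite ffunE.
rewrite gez0_abs // mulr_sumr /norm2 -sumrB; apply: eq_bigr => a _.
rewrite ffunE sqrrD exprMn sqrr_sign mul1r /d.
have -> : (2 * n).+2%:Z = 2 * n.+1%:Z by lia.
have -> : (4 * n.+1)%N%:Z = 4 * n.+1%:Z by lia.
ring.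
Qed.

(** The stabilizer of Lambda_0 + rho is trivial: its coordinates are
    n, ..., 1, and the residues of +-1, ..., +-n modulo 2 n + 2 are distinct. *)
Lemma weyl_orbit_inj w w' g : in_orbit w g -> in_orbit w' g -> w = w'.
Proof.
move=> [Ww gw] [Ww' gw'].
have [s [e [b Pw]]] := weyl_paramP Ww; have [s' [e' [b' Pw']]] := weyl_paramP Ww'.
have key a : [/\ s a = s' a, e a = e' a & b a = b' a].
  have [_ Pc _] := Pw Lam; have [_ Pc' _] := Pw' Lam.
  have := gw' a; rewrite -gw Pc Pc' level_Lam !coord_Lam.
  have lt_s := ltn_ord (s a); have lt_s' := ltn_ord (s' a).
  have toZ (c : bool) (x : nat) (y : int) : (-1) ^+ c * x%:R + y%:~R * (2 * n).+2%:R =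
      ((-1) ^+ c * x%:Z + y * (2 * n).+2%:Z)%:~R :> F.
    by rewrite rmorphD !rmorphM /= rmorph_sign -!pmulrn.
  rewrite !toZ => /eqP; rewrite eqr_int => /eqP.
  case: (e a) (e' a) => -[]; rewrite ?expr0 ?expr1 ?mul1r ?mulN1r => E.
  - have bb : b' a = b a by nia.
    by split=> //; apply: val_inj; rewrite /=; nia.
  - have bb : b' a = b a by nia.
    by exfalso; nia.
  - have bb : b' a = b a by nia.
    by exfalso; nia.
  have bb : b' a = b a by nia.
  by split=> //; apply: val_inj; rewrite /=; nia.
have act (v : hdual F n) : v *m w = v *m w'.
  have [Pl Pc Pd] := Pw v; have [Pl' Pc' Pd'] := Pw' v.
  apply: hdualP; first by rewrite Pl Pl'.
    by move=> a; rewrite Pc Pc'; have [-> -> ->] := key a.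
  rewrite Pd Pd'; congr (_ - _); apply: eq_bigr => a _.
  by have [-> -> ->] := key a.
by apply/row_matrixP => i; rewrite !rowE act.
Qed.

(** The drop along delta of the point of the orbit with finite part g. *)
Definition defect (g : {ffun 'I_n -> int}) : nat :=
  `|((norm2 g - norm2 (rho_wt l)) %/ (4 * n.+1)%N%:Z)%Z|%N.

Lemma in_orbit_defect w g : in_orbit w g ->
  dcoord (Lam *m w) = dcoord Lam - (defect g)%:R /\
  norm2 g - norm2 (rho_wt l) = (4 * n.+1)%N%:Z * (defect g)%:Z.
Proof.
move=> [Ww gw]; have [g' [D [[_ gw'] dD ND]]] := weyl_orbit Ww.
have gg : g' = g.
  by apply/ffunP => a; apply/eqP; rewrite -(eqr_int F) -gw' gw.
rewrite gg in ND; have -> : defect g = D by rewrite /defect ND mulrC mulzK.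
by [].
Qed.

Lemma in_orbit_rho : in_orbit 1%:M (rho_wt l).
Proof.
split; first exact: weyl_group1.
by move=> a; rewrite mulmx1 coord_Lam ffunE -pmulrn.
Qed.

Section Coefficients.
Variables (k : comUnitRingType) (q : k).
Hypothesis U2 : (2 : k) \is a GRing.unit.

(** The coefficient at g of the alternating sum of the e^{w(Lambda_0 + rho)}. *)
Definition weyl_coef (g : {ffun 'I_n -> int}) : k :=
  let w := xget 0 [set w | in_orbit w g] in
  if `[< in_orbit w g >] then (sign w)%:~R * q ^+ defect g else 0.

Lemma weyl_coef_in w g : in_orbit w g -> weyl_coef g = (sign w)%:~R * q ^+ defect g.
Proof.
move=> og; rewrite /weyl_coef; case: xgetP => [w' -> /= og'|/(_ w)] //.
by rewrite (asboolT og') (weyl_orbit_inj og' og).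
Qed.

Lemma weyl_coef_out g : (forall w, ~ in_orbit w g) -> weyl_coef g = 0.
Proof. by move=> ng; rewrite /weyl_coef asboolF. Qed.

(** A simple reflection pairs the elements w for g with those for h. *)
Lemma weyl_coef_step (i : 'I_n.+1) c g h :
    (forall w, in_orbit w g -> in_orbit (w *m refl i) h) ->
    (forall w, in_orbit w h -> in_orbit (w *m refl i) g) ->
    (forall w, in_orbit w g -> q ^+ defect g = c * q ^+ defect h) ->
  weyl_coef g = - c * weyl_coef h.
Proof.
move=> gh hg ch; case: (pselect (exists w, in_orbit w g)) => [[w og]|ng].
  have [Ww _] := og.
  rewrite (weyl_coef_in og) (weyl_coef_in (gh _ og)) (sign_refl _ Ww).
  by rewrite (ch _ og) rmorphN /=; ring.
rewrite (@weyl_coef_out h) ?mulr0; last first.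
  by move=> w oh; apply: ng; exists (w *m refl i); apply: hg.
by apply: weyl_coef_out => w og; apply: ng; exists w.
Qed.

Lemma weyl_coef_antisym : affine_antisym q weyl_coef.
Proof.
split; [split|].
- move=> i j g ij; have lt_j := ltn_ord j.
  pose m : 'I_n.+1 := widen_ord (leqnSn _) j.
  have stepP h w : in_orbit w h -> in_orbit (w *m refl m) (swap_at i j h).
    move=> [Ww hw]; split; first exact: weyl_groupM.
    by move=> a; rewrite mulmxA (@refl_mid_coord _ _ _ i j) // hw ffunE.
  have ss h : swap_at i j (swap_at i j h) = h by apply/ffunP => a; rewrite !ffunE tpermK.
  rewrite -[in RHS](mul1r (weyl_coef g)) -mulNr.
  apply: (weyl_coef_step (i := m)) => [w /stepP|w /stepP //|w _]; first by rewrite ss.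
  rewrite mul1r /defect; congr (_ ^+ absz ((_ - _) %/ _)%Z).
  rewrite /norm2 (reindex_inj (@perm_inj _ (tperm i j))) /=.
  by apply: eq_bigr => a _; rewrite ffunE tpermK.
- move=> g.
  have stepP h w : in_orbit w h -> in_orbit (w *m refl ord_max) (negate_at ord_max h).
    move=> [Ww hw]; split; first exact: weyl_groupM.
    by move=> a; rewrite mulmxA refl_max_coord hw ffunE; case: eqP => // _; rewrite rmorphN.
  have ss h : negate_at ord_max (negate_at ord_max h) = h.
    by apply/ffunP => a; rewrite !ffunE; case: eqP; rewrite ?opprK.
  rewrite -[in RHS](mul1r (weyl_coef g)) -mulNr.
  apply: (weyl_coef_step (i := ord_max)) => [w /stepP|w /stepP //|w _]; first by rewrite ss.
  rewrite mul1r /defect; congr (_ ^+ absz ((_ - _) %/ _)%Z).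
  by apply: eq_bigr => a _; rewrite ffunE; case: eqP => // _; rewrite sqrrN.
move=> g u g0.
have stepP h w : in_orbit w h -> in_orbit (w *m refl ord0) (affine_at ord0 h).
  move=> [Ww hw]; split; first exact: weyl_groupM.
  have [s [e [b Pw]]] := weyl_paramP Ww; have [Pl _ _] := Pw Lam.
  move=> a; rewrite mulmxA refl0_coord Pl level_Lam hw ffunE; case: eqP => // _.
  have -> : 2 * l.+2%:Z = (2 * n).+2%:Z by lia.
  by rewrite rmorphB /= -pmulrn.
have ss h : affine_at ord0 (affine_at ord0 h) = h.
  by apply/ffunP => a; rewrite !ffunE; case: eqP => // _; ring.
apply: (weyl_coef_step (i := ord0)) => [w /stepP //|w /stepP|w og]; first by rewrite ss.
have [_ Dg] := in_orbit_defect og; have [_ Dh] := in_orbit_defect (stepP _ _ og).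
rewrite -exprD; congr (_ ^+ _).
have : norm2 g - norm2 (affine_at ord0 g) = (4 * n.+1)%N%:Z * u%:Z.
  rewrite /norm2 -sumrB (bigD1 ord0) //= big1 ?addr0.
    by rewrite ffunE eqxx g0; lia.
  by move=> a /negPf a0; rewrite ffunE a0 subrr.
move: Dg Dh; move: (norm2 g) (norm2 _) (norm2 _) (defect g) (defect _) => x y z d d'.
nia.
Qed.

(** Both sides are antisymmetric for the affine Weyl group and equal 1 at rho. *)
Lemma weyl_coef_theta g : weyl_coef g = theta_det q g.
Proof.
have [[Ws Wn] Wa] := weyl_coef_antisym; have [[Ts Tn] Ta] := @theta_det_antisym k q l.
have W1 : weyl_coef (rho_wt l) = 1.
  rewrite (weyl_coef_in in_orbit_rho) sign1 mul1r /defect subrr div0z //.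
apply/eqP; rewrite -subr_eq0; apply/eqP.
pose B (h : {ffun 'I_n -> int}) := weyl_coef h - theta_det q h.
have aB : affine_antisym q B.
  split; [split|].
  - by move=> i j h ij; rewrite /B Ws // Ts //; ring.
  - by move=> h; rewrite /B Wn // Tn //; ring.
  by move=> h u h0; rewrite /B (Wa _ _ h0) (Ta _ _ h0); ring.
apply: (antisym_affine U2 aB); rewrite /B W1 theta_det_rho subrr //.
Qed.

End Coefficients.
End WeylOrbit.

(** * Formal sums supported in the positive cone *)

Section FormalSums.
Variables (F : numFieldType) (l : nat).
Notation n := l.+1.
Notation H := (hdual F n).
Notation fsum := (formal_sum F n).

Definition cone (b : H) : Prop :=
  exists c : 'I_n.+1 -> nat, b = \sum_i simple_root F i *+ c i.

Lemma cone0 : cone 0.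
Proof. by exists (fun=> 0%N); rewrite big1. Qed.

Lemma coneD a b : cone a -> cone b -> cone (a + b).
Proof.
move=> [c ->] [d ->]; exists (fun i => (c i + d i)%N).
by rewrite -big_split; apply: eq_bigr => i _; rewrite mulrnDr.
Qed.

Lemma coneMn a m : cone a -> cone (a *+ m).
Proof. by move=> ca; elim: m => [|m IH]; [rewrite mulr0n; exact: cone0 | rewrite mulrS; exact: coneD]. Qed.

(** The linear form taking the value 1 on every simple root. *)
Definition height (v : H) : F :=
  \sum_(a < n) coord v a * (n%:R - a%:R - 2^-1) + dcoord v * (2 * n%:R + 1).

Lemma heightD v v' : height (v + v') = height v + height v'.
Proof.
rewrite /height dcoordD (eq_bigr (fun a : 'I_n => coord v a * (n%:R - a%:R - 2^-1) +
  coord v' a * (n%:R - a%:R - 2^-1))).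
  by rewrite big_split /=; ring.
by move=> a _; rewrite coordD mulrDl.
Qed.

Lemma height0 : height 0 = 0.
Proof. by rewrite /height /dcoord mxE mul0r addr0 big1 // => a _; rewrite /coord mxE mul0r. Qed.

Lemma height_simple i : height (simple_root F i : H) = 1.
Proof.
have lt_i := ltn_ord i; rewrite /height dcoord_simple.
have n2 : (2 : F) != 0 by rewrite pnatr_eq0.
have [i0|i0] := eqVneq (i : nat) 0%N.
  rewrite (bigD1 ord0) //= big1 => [|a a0].
    by rewrite coord_simple i0 /=; field.
  rewrite coord_simple i0 /= (_ : (a == 0 :> nat) = false) ?oppr0 ?mul0r //; exact: negPf.
have [im|im] := eqVneq (i : nat) n.
  rewrite (bigD1 ord_max) //= big1 => [|a a0].
    by rewrite coord_simple im /= eqxx -[n%:R]natr1 mulr1; field.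
  rewrite -val_eqE /= in a0.
  by rewrite coord_simple im /= eqxx eqSS (negPf a0) mulr0 mul0r.
have i1 : (i.-1 < n)%N by lia. have i2 : (i < n)%N by lia.
rewrite mul0r addr0 (eq_bigr (fun a : 'I_n => (a == Ordinal i1)%:R * (n%:R - a%:R - 2^-1) -
   (a == Ordinal i2)%:R * (n%:R - a%:R - 2^-1))); last first.
  move=> a _; rewrite coord_simple (negPf i0) (negPf im) mulrBl -!val_eqE /=.
  by congr (_%:R * _ - _); lia.
rewrite sumrB (bigD1 (Ordinal i1)) //= big1 => [|a /negPf ->]; last by rewrite mul0r.
rewrite (bigD1 (Ordinal i2)) //= big1 => [|a /negPf ->]; last by rewrite mul0r.
rewrite !eqxx !mul1r !addr0 (_ : i = i.-1.+1 :> nat); last by lia.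
by rewrite -natr1 /=; ring.
Qed.

Lemma height_sum (c : 'I_n.+1 -> nat) :
  height (\sum_i simple_root F i *+ c i) = (\sum_i c i)%N%:R.
Proof.
rewrite (big_morph height heightD height0) natr_sum; apply: eq_bigr => i _.
elim: (c i) => [|m IH]; first by rewrite mulr0n height0.
by rewrite mulrS heightD IH height_simple nat1r.
Qed.

(** The height is additive, and it is the sum of the coefficients for elements of the
    cone; so the coefficients of c are bounded by the height of b. *)
Lemma cone_below_finite (b : H) : exists X : {fset H},
  forall c, cone c -> cone (b - c) -> c \in X.
Proof.
case: (pselect (cone b)) => [[B bB]|nb]; last first.
  by exists fset0 => c cc cbc; case: nb; rewrite -[b](subrK c); exact: coneD.
pose m := (\sum_i B i)%N.
pose f (c : {ffun 'I_n.+1 -> 'I_m.+1}) : H := \sum_i simple_root F i *+ c i.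
exists [fset f c | c in [set: {ffun 'I_n.+1 -> 'I_m.+1}]%SET]%fset => c [C cC] [D dD].
have C_le i : (C i < m.+1)%N.
  have : height b = (\sum_i D i + \sum_i C i)%N%:R.
    by rewrite -[b](subrK c) heightD dD cC !height_sum natrD.
  rewrite bB height_sum => /eqP; rewrite eqr_nat -/m => /eqP ->.
  by rewrite ltnS; apply: leq_trans (leq_addl _ _); rewrite (bigD1 i) //= leq_addr.
apply/imfsetP; exists [ffun i => Ordinal (C_le i)]; first by rewrite inE.
by rewrite cC; apply: eq_bigr => i _; rewrite ffunE.
Qed.

Definition cone_supported (f : fsum) : Prop := forall b, f b != 0 -> cone b.

Lemma fs_mulE (f g : fsum) b (X : {fset H}) : cone_supported f -> cone_supported g ->
  (forall c, cone c -> cone (b - c) -> c \in X) ->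
  fs_mul f g b = \sum_(c <- X) f c * g (b - c).
Proof.
move=> sf sg XP; rewrite /fs_mul (@fsbigTE _ _ _ _ X) // => c /negP nX.
have [->|fc] := eqVneq (f c) 0; first by rewrite mul0r.
have [->|gc] := eqVneq (g (b - c)) 0; first by rewrite mulr0.
by case: nX; apply: XP; [exact: sf | exact: sg].
Qed.

Lemma cone_supported_mul f g : cone_supported f -> cone_supported g ->
  cone_supported (fs_mul f g).
Proof.
move=> sf sg b; have [X XP] := cone_below_finite b; rewrite (fs_mulE sf sg XP).
move=> nz; case: (pselect (cone b)) => // nb; case/negP: nz; rewrite big1 // => c _.
have [->|fc] := eqVneq (f c) 0; first by rewrite mul0r.
have [->|gc] := eqVneq (g (b - c)) 0; first by rewrite mulr0.
by case: nb; rewrite -[b](subrK c); apply: coneD; [exact: sg | exact: sf].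
Qed.

Lemma cone_supported_one : cone_supported (@fs_one F n).
Proof.
move=> b; rewrite /fs_one; have [->|_] := eqVneq b 0; first by move=> _; exact: cone0.
by rewrite eqxx.
Qed.

(** Lets any factor be moved to the front of a product. *)
Lemma fs_mulCA f g h : cone_supported f -> cone_supported g -> cone_supported h ->
  fs_mul f (fs_mul g h) = fs_mul g (fs_mul f h).
Proof.
move=> sf sg sh; apply/funext => b; have [X XP] := cone_below_finite b.
have half f' g' : cone_supported f' -> cone_supported g' ->
    fs_mul f' (fs_mul g' h) b = \sum_(c <- X) \sum_(d <- X) f' c * (g' d * h (b - c - d)).
  move=> sf' sg'; rewrite (fs_mulE sf' (cone_supported_mul sg' sh) XP).
  apply: eq_bigr => c _; have [->|fc] := eqVneq (f' c) 0.
    by rewrite mul0r big1 // => d _; rewrite mul0r.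
  rewrite -mulr_sumr; congr (_ * _); apply: (fs_mulE sg' sh) => d cd cbcd.
  apply: XP => //; have -> : b - d = (b - c - d) + c by rewrite [in RHS]addrAC subrK.
  by apply: coneD => //; exact: sf'.
rewrite !half // exchange_big; apply: eq_bigr => d _; apply: eq_bigr => c _.
by rewrite mulrCA addrAC.
Qed.

End FormalSums.

(** * Evaluation of formal sums at points *)

Section Lattice.
Variables (F : numFieldType) (l : nat).
Notation n := l.+1.
Notation H := (hdual F n).

Definition affine_wt (g : {ffun 'I_n -> int}) (m : nat) : H :=
  \sum_(a < n) (g a)%:~R *: eps a.+1 + (m%:R / 2) *: delta.

Lemma level_affine_wt g m : level (affine_wt g m) = 0.
Proof.
rewrite /affine_wt levelD levelZ level_delta mulr0 addr0 /level summxE big1 // => a _.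
have lt_a := ltn_ord a.
by rewrite mxE -/(level _) level_eps ?mulr0 //; lia.
Qed.

Lemma coord_affine_wt g m a : coord (affine_wt g m) a = (g a)%:~R.
Proof.
rewrite /affine_wt coordD coordZ coord_delta mulr0 addr0 /coord summxE (bigD1 a) //= big1.
  by rewrite mxE -/(coord _ _) coord_eps ?eqxx ?mulr1 ?addr0 //; have := ltn_ord a; lia.
move=> b nb; rewrite mxE -/(coord _ _) coord_eps; last by have := ltn_ord b; lia.
by rewrite eqSS (_ : (b == a :> nat) = false) ?mulr0 //; apply: negPf.
Qed.

Lemma dcoord_affine_wt g m : dcoord (affine_wt g m) = m%:R / 2.
Proof.
rewrite /affine_wt dcoordD dcoordZ dcoord_delta mulr1 /dcoord summxE big1 ?add0r // => a _.
have lt_a := ltn_ord a.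
by rewrite mxE -/(dcoord _) dcoord_eps ?mulr0 //; lia.
Qed.

Lemma affine_wt_inj g m g' m' : affine_wt g m = affine_wt g' m' -> g = g' /\ m = m'.
Proof.
move=> e; split.
  by apply/ffunP => a; apply/eqP; rewrite -(eqr_int F) -(coord_affine_wt g m) -(coord_affine_wt g' m') e.
have : dcoord (affine_wt g m) = dcoord (affine_wt g' m') by rewrite e.
rewrite !dcoord_affine_wt => /mulIf -/(_ _)/eqP; rewrite eqr_nat => h; apply/eqP/h.
by rewrite invr_eq0 pnatr_eq0.
Qed.

Lemma affine_wtD g m g' m' : affine_wt (g + g') (m + m') = affine_wt g m + affine_wt g' m'.
Proof.
apply: hdualP => [|a|]; first by rewrite levelD !level_affine_wt addr0.
  by rewrite coordD !coord_affine_wt ffunE rmorphD.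
by rewrite dcoordD !dcoord_affine_wt natrD mulrDl.
Qed.

Lemma affine_wt0 : affine_wt 0 0 = 0.
Proof.
apply: hdualP => [|a|]; first by rewrite level_affine_wt /level mxE.
  by rewrite coord_affine_wt ffunE /coord mxE.
by rewrite dcoord_affine_wt mul0r /dcoord mxE.
Qed.

(** Simple roots, hence the elements of the cone, have integral finite part and a
    natural number of halves of delta. *)
Lemma cone_affine_wt b : cone b -> exists g m, b = affine_wt g m.
Proof.
case=> c ->; elim/big_ind: _ => [|x y [g [m ->]] [g' [m' ->]]|i _].
- by exists 0, 0%N; rewrite affine_wt0.
- by exists (g + g'), (m + m')%N; rewrite affine_wtD.
have [g [m e]] : exists g m, simple_root F i = affine_wt g m.
  pose g : {ffun 'I_n -> int} := [ffun a : 'I_n => if i == 0 :> nat then - (a == 0 :> nat)%:R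
    else if i == n :> nat then 2 * (a.+1 == n)%:R
    else (a.+1 == i :> nat)%:R - (a == i :> nat)%:R].
  exists g, (i == 0 :> nat); apply: hdualP => [|a|].
  - by rewrite level_simple level_affine_wt.
  - rewrite coord_simple coord_affine_wt ffunE; case: ifP => _; first by rewrite rmorphN /= rmorph_nat.
    case: ifP => _; first by rewrite rmorphM /= !rmorph_nat.
    by rewrite rmorphB /= !rmorph_nat.
  by rewrite dcoord_simple dcoord_affine_wt; case: eqP => _; rewrite /= ?mul1r ?mul0r.
rewrite e; elim: (c i) => [|p [g' [m' e']]]; first by exists 0, 0%N; rewrite mulr0n affine_wt0.
by exists (g + g'), (m + m')%N; rewrite mulrS e' affine_wtD.
Qed.

(** The inverse of affine_wt, with a default value off the lattice. *)
Definition decode (b : H) : {ffun 'I_n -> int} * nat :=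
  xget (0, 0%N) [set u | b = affine_wt u.1 u.2].

Lemma decodeK g m : decode (affine_wt g m) = (g, m).
Proof.
rewrite /decode; case: xgetP => [u _ /= e|/(_ (g, m)) /= [] //].
by case: u e => g' m' /= /affine_wt_inj [-> ->].
Qed.

Lemma decodeD b b' : cone b -> cone b' ->
  decode (b + b') = ((decode b).1 + (decode b').1, ((decode b).2 + (decode b').2)%N).
Proof.
move=> /cone_affine_wt [g [m ->]] /cone_affine_wt [g' [m' ->]].
by rewrite -affine_wtD !decodeK.
Qed.

End Lattice.

Section Evaluation.
Variables (F : numFieldType) (l : nat).
Notation n := l.+1.
Notation H := (hdual F n).
Notation fsum := (formal_sum F n).
Variables (k : comUnitRingType) (N : nat) (phi : {rmorphism Zst -> k}) (Q : k).

(** The value at the node x of the monomial e^b, with e^{delta / 2} = Q. *)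
Definition chi (x : 'I_n -> k) (b : H) : k := mono (decode b).1 x * Q ^+ (decode b).2.

Lemma chi_affine_wt x g m : chi x (affine_wt F g m) = mono g x * Q ^+ m.
Proof. by rewrite /chi decodeK. Qed.

Lemma chi0 x : chi x 0 = 1.
Proof. by rewrite -(affine_wt0 F l) chi_affine_wt mono0 mul1r. Qed.

Notation units x := (forall i, x i \is a GRing.unit).

Lemma chiD x b b' : units x -> cone b -> cone b' -> chi x (b + b') = chi x b * chi x b'.
Proof. by move=> Ux cb cb'; rewrite /chi decodeD //= monoD // exprD mulrACA. Qed.

Lemma chiMn x b m : units x -> cone b -> chi x (b *+ m) = chi x b ^+ m.
Proof.
move=> Ux cb; elim: m => [|m IH]; first by rewrite mulr0n chi0 expr0.
by rewrite mulrS chiD ?IH ?exprS //; exact: coneMn.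
Qed.

(** The formal sum f evaluates to v; S contains the finitely many terms that do
    not evaluate to 0. *)
Definition evaluates (f : fsum) (S : {fset H}) (v : ('I_n -> k) -> k) : Prop :=
  [/\ cone_supported f,
      forall x b, units x -> b \notin S -> phi (f b) * chi x b = 0 &
      forall x, units x -> \sum_(b <- S) phi (f b) * chi x b = v x].

(** Pairs (c, b - c) with b outside the sum set have a factor that evaluates to 0. *)
Lemma evaluates_mul f S v g T v' : evaluates f S v -> evaluates g T v' ->
  evaluates (fs_mul f g) [fset (a + b)%R | a in S, b in T]%fset (fun x => v x * v' x).
Proof.
move=> [sf zf ef] [sg zg eg].
have key x b : units x -> phi (fs_mul f g b) * chi x b =
    \sum_(c <- S) (phi (f c) * chi x c) * (phi (g (b - c)) * chi x (b - c)).
  move=> Ux; have [X XP] := cone_below_finite b.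
  pose Y := (X `|` S)%fset.
  rewrite (fs_mulE (X := Y) sf sg); last by move=> c cc cbc; rewrite inE XP.
  rewrite rmorph_sum mulr_suml [RHS](big_fset_incl _ (fsubsetUr X S)) /=; last first.
    by move=> c _ nS; rewrite zf // mul0r.
  apply: eq_bigr => c _; rewrite rmorphM.
  have [->|fc] := eqVneq (f c) 0; first by rewrite rmorph0 !mul0r.
  have [->|gc] := eqVneq (g (b - c)) 0; first by rewrite rmorph0 mulr0 !mul0r mulr0.
  have -> : chi x b = chi x (b - c) * chi x c.
    by rewrite -chiD ?subrK //; [exact: sg | exact: sf].
  ring.
split; first exact: cone_supported_mul.
  move=> x b Ux nb; rewrite key // big_seq big1 // => c cS.
  rewrite zg ?mulr0 //; apply: contra nb => bcT; apply/imfset2P.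
  by exists c => //; exists (b - c) => //; rewrite addrC subrK.
move=> x Ux; rewrite (eq_bigr _ (fun b _ => key x b Ux)) exchange_big /= -ef // mulr_suml.
rewrite big_seq [RHS]big_seq; apply: eq_bigr => c cS; rewrite -mulr_sumr; congr (_ * _).
rewrite -eg //; set U := [fset _ | _ in _, _ in _]%fset.
pose V := [fset (c + d)%R | d in T]%fset.
have VU : (V `<=` U)%fset.
  by apply/fsubsetP => b /imfsetP [d dT ->]; apply/imfset2P; exists c => //; exists d.
rewrite -(big_fset_incl _ VU) /=; last first.
  move=> b _ nV; rewrite zg //; apply: contra nV => bcT.
  by apply/imfsetP; exists (b - c) => //; rewrite addrC subrK.
rewrite big_imfset /=; last by move=> d d' _ _; exact: addrI.
by apply: eq_bigr => d _; rewrite addrAC subrr add0r.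
Qed.

Lemma evaluates_one : evaluates (@fs_one F n) [fset 0]%fset (fun=> 1).
Proof.
split; first exact: cone_supported_one.
  by move=> x b _; rewrite inE /fs_one => /negPf ->; rewrite rmorph0 mul0r.
by move=> x _; rewrite big_seq_fset1 /fs_one eqxx rmorph1 mul1r chi0.
Qed.

Lemma fs_geom_mul u (a : H) m : a != 0 -> fs_geom u a (a *+ m) = u ^+ m.
Proof.
move=> a0; rewrite /fs_geom (_ : [set _ | _] = [set m]) ?fsbig_set1 //.
apply/seteqP; split=> p /=; last by move=> ->.
move/eqP; rewrite -![a *+ _]scaler_nat -subr_eq0 -scalerBl scaler_eq0 (negPf a0) orbF.
by rewrite subr_eq0 eqr_nat => /eqP.
Qed.

Lemma fs_geom_out u (a b : H) : (forall m, b <> a *+ m) -> fs_geom u a b = 0.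
Proof. by move=> nb; rewrite /fs_geom fsbig1 // => m /= /nb. Qed.

(** The geometric series is finite because phi u is nilpotent. *)
Lemma evaluates_geom u a : cone a -> a != 0 -> phi u ^+ N = 0 ->
  exists S, evaluates (fs_geom u a) S (fun x => (1 - phi u * chi x a)^-1).
Proof.
move=> ca a0 uN.
exists [fset (a *+ (m : 'I_N))%R | m in [set: 'I_N]%SET]%fset; split.
- move=> b; case: (pselect (exists m, b = a *+ m)) => [[m ->] _|nb]; first exact: coneMn.
  by rewrite fs_geom_out ?eqxx // => m bm; apply: nb; exists m.
- move=> x b Ux nS; case: (pselect (exists m, b = a *+ m)) => [[m bm]|nb]; last first.
    by rewrite fs_geom_out ?rmorph0 ?mul0r // => m bm; apply: nb; exists m.
  rewrite bm fs_geom_mul // rmorphXn /=; case: (ltnP m N) => [lt_m|le_m].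
    by case/negP: nS; apply/imfsetP; exists (Ordinal lt_m); rewrite ?inE.
  by rewrite -(subnK le_m) exprD uN mulr0 mul0r.
move=> x Ux; rewrite big_imfset /=; last first.
  move=> m m' _ _ /eqP; rewrite -![a *+ _]scaler_nat -subr_eq0 -scalerBl scaler_eq0 (negPf a0) orbF.
  by rewrite subr_eq0 eqr_nat => /eqP /val_inj.
have yN : (phi u * chi x a) ^+ N = 0 by exact: nilpM.
rewrite (inv_nilp yN) big_enum /= -[LHS]/(\sum_(m in [set: 'I_N]%SET) _).
transitivity (\sum_(m < N) phi (fs_geom u a (a *+ m)) * chi x (a *+ m)).
  by apply: eq_bigl => m; rewrite inE.
by apply: eq_bigr => m _; rewrite fs_geom_mul // rmorphXn /= chiMn // [RHS]exprMn.
Qed.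

Lemma evaluates_root a : cone a -> a != 0 -> phi (root_var a) ^+ N = 0 ->
  exists S, evaluates (root_factor a) S
    (fun x => (1 - phi (root_var a) * chi x a)^-1 ^+ mult a).
Proof.
move=> ca a0 uN; have [S eS] := evaluates_geom ca a0 uN; rewrite /root_factor.
elim: (mult a) => [|m [T eT]]; first by exists [fset 0]%fset; exact: evaluates_one.
eexists; have [h1 h2 h3] := evaluates_mul eS eT; split; [exact: h1 | exact: h2 |].
by move=> x Ux; rewrite h3 // exprS.
Qed.

Lemma evaluates_prod (s : seq H) :
  (forall a, a \in s -> [/\ cone a, a != 0 & phi (root_var a) ^+ N = 0]) ->
  exists S, evaluates (\big[@fs_mul F n/@fs_one F n]_(a <- s) root_factor a) S
    (fun x => \prod_(a <- s) (1 - phi (root_var a) * chi x a)^-1 ^+ mult a).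
Proof.
elim: s => [|a s IH] sP.
  exists [fset 0]%fset; rewrite big_nil; have [h1 h2 h3] := evaluates_one.
  by split=> // x Ux; rewrite big_nil h3.
have [ca a0 uN] := sP a (mem_head a s).
have [S eS] := evaluates_root ca a0 uN.
have [T eT] := IH (fun b bs => sP b (@mem_behead _ (a :: s) b bs)).
eexists; rewrite big_cons; have [h1 h2 h3] := evaluates_mul eS eT; split; [exact: h1 | exact: h2 |].
by move=> x Ux; rewrite h3 // big_cons.
Qed.

End Evaluation.

(** * Enumeration of the positive roots *)

Section Roots.
Variables (F : numFieldType) (l : nat).
Notation n := l.+1.
Notation H := (hdual F n).
Notation affine_wt := (@affine_wt F l).

Definition unit_wt (i : 'I_n) : {ffun 'I_n -> int} := [ffun a => (a == i)%:R].

Lemma froot_wtE p : froot_wt p =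
  unit_wt p.1.1 + (if p.2 then unit_wt p.1.2 else - unit_wt p.1.2).
Proof. by apply/ffunP => a; rewrite !ffunE; case: (p.2); rewrite !ffunE. Qed.

Lemma simple0_affine_wt : simple_root F ord0 = affine_wt (- unit_wt ord0) 1.
Proof.
apply: hdualP => [|a|]; first by rewrite level_simple level_affine_wt.
  by rewrite coord_simple coord_affine_wt !ffunE rmorphN /= rmorph_nat.
by rewrite dcoord_simple dcoord_affine_wt mul1r.
Qed.

Lemma simple_max_affine_wt : simple_root F ord_max = affine_wt (unit_wt ord_max *+ 2) 0.
Proof.
apply: hdualP => [|a|]; first by rewrite level_simple level_affine_wt.
  rewrite coord_simple coord_affine_wt ffunMnE ffunE /= eqxx eqSS.
  by rewrite rmorphMn /= rmorph_nat mulr_natl.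
by rewrite dcoord_simple dcoord_affine_wt mul0r.
Qed.

Lemma simple_mid_affine_wt (i j : 'I_n) (m : 'I_n.+1) : j = i.+1 :> nat -> m = j :> nat ->
  simple_root F m = affine_wt (unit_wt i - unit_wt j) 0.
Proof.
move=> ij mj; have lt_j := ltn_ord j; apply: hdualP => [|a|].
- by rewrite level_simple level_affine_wt.
- rewrite coord_simple coord_affine_wt !ffunE mj ij /= (_ : (i.+1 == n) = false); last by lia.
  by rewrite eqSS rmorphB /= !rmorph_nat -!val_eqE /= ij.
by rewrite dcoord_simple dcoord_affine_wt mj ij mul0r.
Qed.

Lemma cone_simple i : cone (simple_root F i : H).
Proof.
exists (fun j => (j == i)%N); rewrite (bigD1 i) //= eqxx big1 ?addr0 // => j /negPf ->.
by rewrite mulr0n.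
Qed.

Lemma cone_affine_wtD g m g' m' : cone (affine_wt g m) -> cone (affine_wt g' m') ->
  cone (affine_wt (g + g') (m + m')).
Proof. by rewrite affine_wtD; exact: coneD. Qed.

Lemma cone_diff (i j : 'I_n) : (i <= j)%N -> cone (affine_wt (unit_wt i - unit_wt j) 0).
Proof.
move=> le_ij; have [d jE] : exists d, (j = i + d :> nat)%N by exists (j - i)%N; lia.
elim: d j jE {le_ij} => [|d IH] j jE.
  have -> : j = i by apply: val_inj; rewrite /= jE addn0.
  by rewrite subrr affine_wt0; exact: cone0.
have lt_j := ltn_ord j; have lt_d : (i + d < n)%N by lia.
pose j' := Ordinal lt_d.
have -> : unit_wt i - unit_wt j = (unit_wt i - unit_wt j') + (unit_wt j' - unit_wt j).
  by rewrite addrA subrK.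
apply: (@cone_affine_wtD _ 0 _ 0); first exact: IH.
have jm : (j < n.+1)%N by lia.
rewrite -(@simple_mid_affine_wt j' j (Ordinal jm)) //=; last by rewrite jE addnS.
exact: cone_simple.
Qed.

Lemma cone_long i : cone (affine_wt (unit_wt i *+ 2) 0).
Proof.
have -> : unit_wt i *+ 2 = (unit_wt i - unit_wt ord_max) *+ 2 + unit_wt ord_max *+ 2.
  by rewrite mulrnBl subrK.
apply: (@cone_affine_wtD _ 0 _ 0); last by rewrite -simple_max_affine_wt; exact: cone_simple.
have le_i : (i <= (ord_max : 'I_n))%N by rewrite -ltnS.
by rewrite mulr2n; apply: (@cone_affine_wtD _ 0 _ 0); exact: cone_diff.
Qed.

Definition sgn_wt (b : bool) (g : {ffun 'I_n -> int}) := if b then - g else g.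

Lemma cone_short i (b : bool) : cone (affine_wt (sgn_wt b (unit_wt i)) 1).
Proof.
have neg : cone (affine_wt (- unit_wt i) 1).
  have -> : - unit_wt i = (unit_wt ord0 - unit_wt i) + (- unit_wt ord0).
    by rewrite addrAC subrr add0r.
  apply: (@cone_affine_wtD _ 0 _ 1); first exact: cone_diff.
  by rewrite -simple0_affine_wt; exact: cone_simple.
case: b => //=.
have -> : unit_wt i = - unit_wt i + unit_wt i *+ 2 by rewrite mulr2n addKr.
by apply: (@cone_affine_wtD _ 1 _ 0) => //; exact: cone_long.
Qed.

Lemma cone_froot p : froot_pos p -> cone (affine_wt (froot_wt p) 0).
Proof.
case: p => [[i j] b]; rewrite /froot_pos froot_wtE /= => pos_p.
have le_ij : (i <= j)%N by case/orP: pos_p => [/ltnW //|/andP[/eqP ->]].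
case: b pos_p => pos_p; last exact: cone_diff.
have -> : unit_wt i + unit_wt j = (unit_wt i - unit_wt j) + unit_wt j *+ 2.
  by rewrite mulr2n addrA subrK.
by apply: (@cone_affine_wtD _ 0 _ 0); [exact: cone_diff | exact: cone_long].
Qed.

Lemma cone_delta : cone (affine_wt 0 2).
Proof.
have -> : (0 : {ffun 'I_n -> int}) = sgn_wt true (unit_wt ord0) + sgn_wt false (unit_wt ord0).
  by rewrite /= addNr.
by apply: (@cone_affine_wtD _ 1 _ 1); exact: cone_short.
Qed.

Lemma cone_imag m : cone (affine_wt 0 (2 * m)).
Proof.
elim: m => [|m IH]; first by rewrite muln0 affine_wt0; exact: cone0.
by rewrite mulnS -[0]addr0; apply: cone_affine_wtD => //; exact: cone_delta.
Qed.

Lemma cone_level g m m' : cone (affine_wt g m) -> cone (affine_wt g (m + 2 * m')).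
Proof. by move=> cg; rewrite -[g]addr0; apply: cone_affine_wtD => //; exact: cone_imag. Qed.

(** A long root 2 eps_i occurs at even multiples of delta only, the roots
    +- eps_i +- eps_j at all multiples. *)
Definition froot_step (p : froot n) : nat := if p.1.1 == p.1.2 then 2 else 1.

Lemma cone_frootN p m : froot_pos p -> cone (affine_wt (- froot_wt p) (2 * (froot_step p * m.+1))).
Proof.
move=> pos_p; rewrite mulnS mulnDr; apply: cone_level.
case: p pos_p => [[i j] b]; rewrite /froot_pos /froot_step froot_wtE /= => pos_p.
have neg i' := cone_short i' true.
have -> : - (unit_wt i + (if b then unit_wt j else - unit_wt j)) =
    sgn_wt true (unit_wt i) + sgn_wt b (unit_wt j).
  by rewrite opprD; case: b {pos_p} => //=; rewrite opprK.
have base : cone (affine_wt (sgn_wt true (unit_wt i) + sgn_wt b (unit_wt j)) 2).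
  by apply: (@cone_affine_wtD _ 1 _ 1); exact: cone_short.
by case: eqP => _ //; exact: (@cone_level _ 2 1).
Qed.

Lemma form_affine_wt g m : form (affine_wt g m) (affine_wt g m) = (\sum_a g a ^+ 2)%:~R.
Proof.
rewrite formE !level_affine_wt mulr0 mul0r !addr0 rmorph_sum; apply: eq_bigr => a _.
by rewrite coord_affine_wt /= expr2 rmorphM.
Qed.

End Roots.

Section RootList.
Variables (F : numFieldType) (l : nat).
Notation n := l.+1.
Notation H := (hdual F n).
Notation affine_wt := (@affine_wt F l).
Notation sgn_wt := (@sgn_wt l).
Notation unit_wt := (@unit_wt l).

Definition short_root i b m := affine_wt (sgn_wt b (unit_wt i)) (2 * m).+1.
(** The shift by c makes all these roots positive: a negative finite root needs at least
    one step along delta. *)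
Definition fin_root (p : froot n) (c : bool) m :=
  affine_wt (sgn_wt c (froot_wt p)) (2 * (froot_step p * (m + c))).
Definition imag_root m := affine_wt 0 (2 * m.+1).

Lemma sgn_wtE c g a : sgn_wt c g a = (-1) ^+ c * g a.
Proof. by case: c; rewrite /= ?mul1r // ffunE mulN1r. Qed.

Lemma affine_wt_shift g m m' : affine_wt g (m + 2 * m') = affine_wt g m + m'%:Z%:~R *: delta.
Proof.
apply: hdualP => [|a|].
- by rewrite levelD levelZ level_delta !level_affine_wt mulr0 addr0.
- by rewrite coordD coordZ coord_delta !coord_affine_wt mulr0 addr0.
by rewrite dcoordD dcoordZ dcoord_delta !dcoord_affine_wt mulr1 natrD mulrDl natrM mulrAC divff ?mul1r ?pnatr_eq0.
Qed.

Lemma short_rootE i b m : short_root i b m =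
  2^-1 *: ((-1) ^+ b *: (2 *: eps i.+1) + (2 * m.+1%:Z - 1)%:~R *: delta).
Proof.
have lt_i := ltn_ord i; apply: hdualP => [|a|].
- rewrite level_affine_wt levelZ levelD !levelZ level_delta level_eps ?mulr0 ?addr0 ?mulr0 //; lia.
- rewrite coord_affine_wt coordZ coordD !coordZ coord_delta coord_eps; last by lia.
  rewrite mulr0 addr0 sgn_wtE ffunE rmorphM /= rmorph_sign rmorph_nat eqSS.
  by rewrite [RHS]mulrCA mulKf ?pnatr_eq0 // eq_sym.
rewrite dcoord_affine_wt dcoordZ dcoordD !dcoordZ dcoord_delta dcoord_eps; last by lia.
rewrite !mulr0 add0r mulr1 mulrC; congr (_ * _).
by rewrite pmulrn; congr (_%:~R); lia.
Qed.

Lemma long_rootE (j : 'I_n) (c : bool) (m : nat) : fin_root (j, j, true) c m =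
  (-1) ^+ c *: (2 *: eps j.+1) + (2 * (m + c)%N%:Z)%:~R *: delta.
Proof.
have lt_j := ltn_ord j; rewrite /fin_root /froot_step /= eqxx; apply: hdualP => [|a|].
- rewrite level_affine_wt levelD !levelZ level_delta level_eps ?mulr0 ?addr0 //; lia.
- rewrite coord_affine_wt coordD !coordZ coord_delta coord_eps; last by lia.
  rewrite mulr0 addr0 sgn_wtE ffunE /= rmorphM /= rmorph_sign rmorphD /= !rmorph_nat.
  by rewrite eqSS [(j == a :> nat)]eq_sym; congr (_ * _); rewrite -val_eqE /=; ring.
rewrite dcoord_affine_wt dcoordD !dcoordZ dcoord_delta dcoord_eps; last by lia.
by rewrite !mulr0 add0r mulr1 natrM mulrAC divff ?pnatr_eq0 // mul1r pmulrn PoszM.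
Qed.

Lemma mid_rootE (i j : 'I_n) (b c : bool) (m : nat) : (i < j)%N -> fin_root (i, j, b) c m =
  (-1) ^+ c *: eps i.+1 + (-1) ^+ (c (+) ~~ b) *: eps j.+1 + (m + c)%N%:Z%:~R *: delta.
Proof.
move=> lt_ij; have lt_i := ltn_ord i; have lt_j := ltn_ord j.
have ij : i != j by rewrite -val_eqE /= neq_ltn lt_ij.
rewrite /fin_root /froot_step /= (negPf ij) mul1n; apply: hdualP => [|a|].
- rewrite level_affine_wt !levelD !levelZ level_delta !level_eps ?mulr0 ?addr0 //; lia.
- rewrite coord_affine_wt !coordD !coordZ coord_delta !coord_eps; try lia.
  rewrite mulr0 addr0 sgn_wtE ffunE /= rmorphM /= rmorph_sign rmorphD /= mulrDr.
  rewrite !eqSS [(i == a :> nat)]eq_sym [(j == a :> nat)]eq_sym rmorph_nat; congr (_ + _).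
  rewrite signr_addb -mulrA; congr (_ * _).
  by case: b; rewrite /= ?rmorphN /= ?rmorph_nat ?mul1r ?mulN1r.
rewrite dcoord_affine_wt !dcoordD !dcoordZ dcoord_delta !dcoord_eps; try lia.
by rewrite !mulr0 !add0r mulr1 natrM mulrAC divff ?pnatr_eq0 // mul1r pmulrn.
Qed.

Lemma imag_rootE m : imag_root m = m.+1%:Z%:~R *: delta.
Proof.
apply: hdualP => [|a|].
- by rewrite level_affine_wt levelZ level_delta mulr0.
- by rewrite coord_affine_wt coordZ coord_delta mulr0 ffunE.
by rewrite dcoord_affine_wt dcoordZ dcoord_delta mulr1 natrM mulrAC divff ?pnatr_eq0 // mul1r.
Qed.

Lemma short_root_real i b m : @S1 F n (short_root i b m).
Proof.
by exists i.+1, b, m.+1%:Z; split; [exact: ltn_ord | exact: short_rootE].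
Qed.

Lemma fin_root_real (p : froot n) c m : froot_pos p -> (@S2 F n `|` @S4 F n) (fin_root p c m).
Proof.
case: p => [[i j] b] /orP[/= lt_ij|/andP[/= /eqP -> b1]].
  left; exists i.+1, j.+1, c, (c (+) ~~ b), (m + c)%N%:Z.
  by split; [| | exact: ltn_ord | exact: mid_rootE].
right; exists j.+1, c, (m + c)%N%:Z; split; first exact: ltn_ord.
by rewrite b1; exact: long_rootE.
Qed.

Lemma imag_root_imag m : imaginary_roots F n (imag_root m).
Proof. by exists m.+1%:Z; split=> //; exact: imag_rootE. Qed.

Lemma norm_unit i : \sum_a unit_wt i a ^+ 2 = 1.
Proof.
rewrite (bigD1 i) //= ffunE eqxx big1 // => a /negPf na.
by rewrite ffunE na.
Qed.

Lemma norm_sgn c g : \sum_a sgn_wt c g a ^+ 2 = \sum_a g a ^+ 2.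
Proof. by apply: eq_bigr => a _; rewrite sgn_wtE exprMn sqrr_sign mul1r. Qed.

(** Separates the real roots of norm 1 from the others. *)
Lemma norm_froot (p : froot n) : froot_pos p -> 2 <= \sum_a froot_wt p a ^+ 2.
Proof.
case: p => [[i j] b]; rewrite /froot_pos /= => pos_p.
have nonneg a : 0 <= froot_wt (i, j, b) a ^+ 2 := sqr_ge0 _.
rewrite (bigD1 i) //=; have [ij|ij] := eqVneq i j.
  have b1 : b by case/orP: pos_p => [|/andP[] //]; rewrite ij ltnn.
  have : 0 <= \sum_(a | a != i) froot_wt (i, j, b) a ^+ 2 by apply: sumr_ge0 => a _.
  have -> : froot_wt (i, j, b) i ^+ 2 = 4 by rewrite ffunE /= ij eqxx b1.
  by move: (\sum_(a | _) _) => z; lia.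
rewrite (bigD1 j) /=; last by rewrite eq_sym.
have : 0 <= \sum_(a | (a != i) && (a != j)) froot_wt (i, j, b) a ^+ 2 by apply: sumr_ge0 => a _.
have -> : froot_wt (i, j, b) i ^+ 2 = 1.
  by rewrite ffunE /= eqxx (negPf ij); case: b {pos_p nonneg}.
have -> : froot_wt (i, j, b) j ^+ 2 = 1.
  by rewrite ffunE /= eqxx eq_sym (negPf ij); case: b {pos_p nonneg}.
move: (\sum_(a | _) _) => z; lia.
Qed.

Lemma not_imag g m : g != 0 -> ~ imaginary_roots F n (affine_wt g m).
Proof.
move=> /eqP g0 [z [_ e]]; apply: g0; apply/ffunP => a; apply/eqP.
by rewrite -(eqr_int F) -(coord_affine_wt F g m) e coordZ coord_delta mulr0 ffunE.
Qed.

Lemma sgn_unit_neq0 b i : sgn_wt b (unit_wt i) != 0.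
Proof.
apply/eqP => /ffunP /(_ i); rewrite sgn_wtE !ffunE eqxx mulr1 => /eqP.
by rewrite signr_eq0.
Qed.

Lemma sgn_froot_neq0 c (p : froot n) : froot_pos p -> sgn_wt c (froot_wt p) != 0.
Proof.
move=> pos_p; apply/eqP => e; have := norm_froot pos_p; rewrite -(norm_sgn c) e big1 //.
by move=> a _; rewrite ffunE expr0n.
Qed.

Lemma short_root_positive i b m : positive_roots F n (short_root i b m).
Proof.
split; first by left; left; left; exact: short_root_real.
by rewrite /short_root -[(2 * m).+1]add1n; apply: cone_level; exact: cone_short.
Qed.

Lemma fin_root_positive p c m : froot_pos p -> positive_roots F n (fin_root p c m).
Proof.
move=> pos_p; split.
  by left; have [S|S] := fin_root_real c m pos_p; [left; right | right].
rewrite /fin_root; case: c => /=; first by rewrite addn1; exact: cone_frootN.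
by rewrite -[X in affine_wt _ X]add0n; apply: cone_level; exact: cone_froot.
Qed.

Lemma imag_root_positive m : positive_roots F n (imag_root m).
Proof. by split; [right; exact: imag_root_imag | exact: cone_imag]. Qed.

Lemma short_root_data i b m :
  root_var (short_root i b m) = s_var /\ mult (short_root i b m) = 1%N.
Proof.
have real : real_roots F n (short_root i b m) by left; left; exact: short_root_real.
split; rewrite /root_var /mult.
  by rewrite asboolT //; split=> //; rewrite form_affine_wt norm_sgn norm_unit.
by rewrite asboolF ?asboolT //; apply: not_imag; exact: sgn_unit_neq0.
Qed.

Lemma fin_root_data p c m : froot_pos p ->
  root_var (fin_root p c m) = t_var /\ mult (fin_root p c m) = 1%N.
Proof.
move=> pos_p; have real : real_roots F n (fin_root p c m).
  by have [S|S] := fin_root_real c m pos_p; [left; right | right].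
split; rewrite /root_var /mult.
  rewrite asboolF // => -[_ /eqP]; rewrite form_affine_wt norm_sgn -[1]/(1%:~R) eqr_int => /eqP e.
  by have := norm_froot pos_p; rewrite e.
by rewrite asboolF ?asboolT //; apply: not_imag; exact: sgn_froot_neq0.
Qed.

Lemma imag_root_data m : root_var (imag_root m) = t_var /\ mult (imag_root m) = n.
Proof.
split; rewrite /root_var /mult; last by rewrite asboolT //; exact: imag_root_imag.
rewrite asboolF // => -[_ /eqP]; rewrite form_affine_wt big1; last first.
  by move=> a _; rewrite ffunE expr0n.
by rewrite eq_sym rmorph0 oner_eq0.
Qed.

Lemma height_affine_wt g m :
  height (affine_wt g m) = \sum_(a < n) (g a)%:~R * (n%:R - a%:R - 2^-1) + m%:R / 2 * (2 * n%:R + 1).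
Proof.
rewrite /height dcoord_affine_wt; congr (_ + _); apply: eq_bigr => a _.
by rewrite coord_affine_wt.
Qed.

Lemma height_froot (p : froot n) : froot_pos p -> 0 < height (affine_wt (froot_wt p) 0).
Proof.
have half_lt (a : 'I_n) : 0 < n%:R - a%:R - 2^-1 :> F.
  have : 1 <= n%:R - a%:R :> F by rewrite lerBrDr addrC natr1 ler_nat ltn_ord.
  move=> h; rewrite subr_gt0; apply: lt_le_trans h.
  by rewrite invf_lt1 ?ltr1n.
have dual (a : 'I_n) (g : {ffun 'I_n -> int}) (h : 'I_n -> F) c :
    (forall b, g b = (-1) ^+ c * (b == a)%:R) -> \sum_b (g b)%:~R * h b = (-1) ^+ c * h a.
  move=> gE; rewrite (bigD1 a) //= gE eqxx mulr1 big1 ?addr0.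
    by rewrite rmorph_sign.
  by move=> b /negPf nb; rewrite gE nb mulr0 mul0r.
case: p => [[i j] b]; rewrite /froot_pos /= => pos_p.
rewrite height_affine_wt mul0r mul0r addr0.
rewrite (eq_bigr (fun a : 'I_n => (unit_wt i a)%:~R * (n%:R - a%:R - 2^-1) +
  (sgn_wt (~~ b) (unit_wt j) a)%:~R * (n%:R - a%:R - 2^-1))); last first.
  move=> a _; rewrite -mulrDl -rmorphD; congr (_%:~R * _).
  by rewrite sgn_wtE !ffunE /=; case: b {pos_p}; rewrite /= ?mul1r ?mulN1r.
rewrite big_split /= (dual i _ _ false); last by move=> a; rewrite ffunE mul1r.
rewrite (dual j _ _ (~~ b)); last by move=> a; rewrite sgn_wtE ffunE.
rewrite mul1r; case/orP: pos_p => [lt_ij|/andP[/eqP -> ->]]; last by rewrite mul1r addr_gt0.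
case: b => /=; rewrite ?mul1r ?mulN1r; first exact: addr_gt0.
have : i%:R + 1 <= j%:R :> F by rewrite natr1 ler_nat.
by rewrite -subr_ge0 => h; rewrite [X in 0 < X](_ : _ = (j%:R - (i%:R + 1)) + 1) ?ltr_wpDl //; ring.
Qed.

Lemma cone_height b : cone b -> 0 <= height (b : H).
Proof. by case=> c ->; rewrite height_sum ler0n. Qed.

Lemma cone_dcoord b : cone b -> 0 <= dcoord (b : H).
Proof. by move=> /cone_affine_wt [g [m ->]]; rewrite dcoord_affine_wt divr_ge0 ?ler0n. Qed.

(** The cone has nonnegative heights, and positive finite roots positive ones. *)
Lemma fin_root_neg0 (p : froot n) : froot_pos p -> ~ cone (affine_wt (- froot_wt p) 0).
Proof.
move=> pos_p /cone_height; rewrite height_affine_wt mul0r mul0r addr0.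
have := height_froot pos_p; rewrite height_affine_wt mul0r mul0r addr0.
have -> : \sum_(a < n) ((- froot_wt p) a)%:~R * (n%:R - a%:R - 2^-1) =
   - (\sum_(a < n) (froot_wt p a)%:~R * (n%:R - a%:R - 2^-1)) :> F.
  by rewrite -sumrN; apply: eq_bigr => a _; rewrite ffunE rmorphN mulNr.
by rewrite oppr_ge0 => /lt_le_trans h /h; rewrite ltxx.
Qed.

(** Elements of the cone have a nonnegative coefficient at delta, and at level 0 the
    finite part must be positive. *)
Lemma positive_root_cases a : positive_roots F n a ->
  [\/ exists i b m, a = short_root i b m,
      exists p c m, froot_pos p /\ a = fin_root p c m |
      exists m, a = imag_root m].
Proof.
move=> [real ca]; have da := cone_dcoord ca.
case: real => [[[[i [b [z [i_rng aE]]]]|[i [j [b [c [z [i1 ij jn aE]]]]]]]|[i [b [z [i_rng aE]]]]]|[z [z0 aE]]].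
- have i_lt : (i.-1 < n)%N by lia.
  have iE : i = (Ordinal i_lt).+1 :> nat by rewrite /=; lia.
  have z1 : 0 < z.
    move: da; rewrite aE dcoordZ dcoordD !dcoordZ dcoord_delta dcoord_eps; last by lia.
    rewrite !mulr0 add0r mulr1 pmulr_rge0 ?invr_gt0 ?ltr0n // ler0z; lia.
  constructor 1; exists (Ordinal i_lt), b, (absz (z - 1)).
  by rewrite short_rootE aE {1}iE; congr (_ *: (_ + _%:~R *: _)); lia.
- have i_lt : (i.-1 < n)%N by lia. have j_lt : (j.-1 < n)%N by lia.
  have iE : i = (Ordinal i_lt).+1 :> nat by rewrite /=; lia.
  have jE : j = (Ordinal j_lt).+1 :> nat by rewrite /=; lia.
  have z0 : 0 <= z.
    move: da; rewrite aE !dcoordD !dcoordZ dcoord_delta !dcoord_eps; try lia.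
    by rewrite !mulr0 !add0r mulr1 ler0z.
  have lt' : (Ordinal i_lt < Ordinal j_lt)%N by rewrite /=; lia.
  pose p : froot n := (Ordinal i_lt, Ordinal j_lt, b == c).
  have pos_p : froot_pos p by rewrite /froot_pos lt'.
  have bc : b (+) ~~ (b == c) = c by case: b {aE p pos_p}; case: c.
  have mE (m : nat) : z = (m + b)%N%:Z -> a = fin_root p b m.
    by move=> zE; rewrite mid_rootE // bc -zE -iE -jE aE.
  have pE : p = (Ordinal i_lt, Ordinal j_lt, b == c) by [].
  constructor 2; case: b aE p pos_p bc mE pE => aE p pos_p bc mE pE; last first.
    by exists p, false, `|z|%N; split=> //; apply: mE; lia.
  have [z_0|z_pos] := eqVneq z 0; last first.
    by exists p, true, (absz (z - 1)); split=> //; apply: mE; lia.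
  exfalso; apply: (fin_root_neg0 pos_p); suff <- : a = affine_wt (- froot_wt p) 0 by []; apply: (addIr ((Posz 1)%:~R *: delta)).
  rewrite aE z_0 scale0r addr0; have := @mid_rootE (Ordinal i_lt) (Ordinal j_lt) (true == c) true 0 lt'.
  rewrite /fin_root -[X in affine_wt _ X]add0n affine_wt_shift bc -iE -jE /= => <-.
  by rewrite /froot_step /= -val_eqE /= (ltn_eqF lt') pE.
- have i_lt : (i.-1 < n)%N by lia.
  have iE : i = (Ordinal i_lt).+1 :> nat by rewrite /=; lia.
  have z0 : 0 <= z.
    move: da; rewrite aE !dcoordD !dcoordZ dcoord_delta !dcoord_eps; last by lia.
    rewrite !mulr0 !add0r mulr1 ler0z; lia.
  pose p : froot n := (Ordinal i_lt, Ordinal i_lt, true).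
  have pos_p : froot_pos p by rewrite /froot_pos eqxx orbT.
  have mE (m : nat) : z = (m + b)%N%:Z -> a = fin_root p b m.
    by move=> zE; rewrite long_rootE // -zE -iE aE.
  constructor 2; case: b aE mE => aE mE; last first.
    by exists p, false, `|z|%N; split=> //; apply: mE; lia.
  have [z_0|z_pos] := eqVneq z 0; last first.
    by exists p, true, (absz (z - 1)); split=> //; apply: mE; lia.
  exfalso; apply: (fin_root_neg0 pos_p); suff <- : a = affine_wt (- froot_wt p) 0 by []; apply: (addIr ((Posz 2)%:~R *: delta)).
  rewrite aE z_0 mulr0 scale0r addr0; have := @long_rootE (Ordinal i_lt) true 0.
  by rewrite /fin_root -[X in affine_wt _ X]add0n affine_wt_shift -iE /= => <-; rewrite /froot_step /= eqxx add0n muln1.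
have z1 : 0 < z.
  by move: da; rewrite aE dcoordZ dcoord_delta mulr1 ler0z lt_neqAle eq_sym z0.
constructor 3; exists (absz (z - 1)); rewrite imag_rootE aE; congr (_%:~R *: _); lia.
Qed.

End RootList.

Section RootSet.
Variables (F : numFieldType) (l : nat).
Notation n := l.+1.
Notation H := (hdual F n).
Notation affine_wt := (@affine_wt F l).
Notation sgn_wt := (@sgn_wt l).
Notation unit_wt := (@unit_wt l).

(** The values of the weight at i and i' identify the first index, those at j and j'
    the second one and the sign. *)
Lemma froot_wt_inj (p p' : froot n) : froot_pos p -> froot_pos p' ->
  froot_wt p = froot_wt p' -> p = p'.
Proof.
case: p => [[i j] b]; case: p' => [[i' j'] b']; rewrite /froot_pos /= => pos_p pos_p' /ffunP e.
have i_i' : i = i'.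
  apply: val_inj => /=; have := e i; have := e i'; rewrite !ffunE /= !eqxx -!val_eqE /=.
  move: pos_p pos_p'; rewrite -!val_eqE /=; case: b {e}; case: b' => /=; lia.
rewrite -{i'}i_i' in e pos_p' *; have := e j; have := e j'; rewrite !ffunE /= !eqxx.
rewrite -!val_eqE /= => e1 e2; suff [jj -> //] : j = j' :> nat /\ b = b' by rewrite (val_inj jj).
by move: e1 e2; case: b {e pos_p pos_p'}; case: b' => /=; lia.
Qed.

Lemma sgn_froot_inj c c' (p p' : froot n) : froot_pos p -> froot_pos p' ->
  sgn_wt c (froot_wt p) = sgn_wt c' (froot_wt p') -> c = c' /\ p = p'.
Proof.
have opp (r r' : froot n) : froot_pos r -> froot_pos r' -> - froot_wt r <> froot_wt r'.
  move=> pos_r pos_r' e; apply: (@fin_root_neg0 F l r) => //.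
  by rewrite e; exact: cone_froot.
move=> pos_p pos_p'; case: c; case: c' => /= e.
- by split=> //; apply: froot_wt_inj => //; apply: oppr_inj.
- by case: (opp _ _ pos_p pos_p').
- by case: (opp _ _ pos_p' pos_p).
by split=> //; apply: froot_wt_inj.
Qed.

Lemma sgn_unit_inj b b' i i' : sgn_wt b (unit_wt i) = sgn_wt b' (unit_wt i') -> b = b' /\ i = i'.
Proof.
move=> /ffunP /(_ i); rewrite !sgn_wtE !ffunE eqxx mulr1.
have [->|ni] := eqVneq i i'; last by rewrite mulr0 => /eqP; rewrite signr_eq0.
by rewrite mulr1 => /eqP; rewrite (inj_eq signr_inj) => /eqP ->.
Qed.

(** Codes for the three families of positive roots, with bounded step along delta. *)
Definition root_index N : finType :=
  ('I_n * bool * 'I_N + 'I_n * 'I_n * bool * bool * 'I_N + 'I_N)%type.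

Definition root_at N (u : root_index N) : H :=
  match u with
  | inl (inl (i, b, m)) => short_root F i b m
  | inl (inr (p, c, m)) => fin_root F p c m
  | inr m => imag_root F l m
  end.

Definition root_ok N (u : root_index N) : bool :=
  if u is inl (inr (p, _, _)) then froot_pos p else true.

Lemma root_at_inj N : {in @root_ok N &, injective (@root_at N)}.
Proof.
move=> [[[[i b] m]|[[p c] m]]|m] [[[[i' b'] m']|[[p' c'] m']]|m'] /= ok ok';
  rewrite /short_root /fin_root /imag_root => /affine_wt_inj [g_eq m_eq]; try (exfalso; lia).
- have [-> ->] := sgn_unit_inj g_eq; have -> // : m = m' by apply: val_inj => /=; lia.
- have [cc pp] := sgn_froot_inj ok ok' g_eq; rewrite -{p' ok' g_eq}pp -{c'}cc in m_eq *.
  have -> // : m = m'; apply: val_inj => /=; move: m_eq; rewrite /froot_step; case: ifP => _; lia.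
- by have := sgn_froot_neq0 c ok; rewrite g_eq eqxx.
- by have := sgn_froot_neq0 c' ok'; rewrite -g_eq eqxx.
by have -> // : m = m' by apply: val_inj => /=; lia.
Qed.

Definition root_set N : {fset H} := 
  [fset root_at u | u in finset.finset (@root_ok N)]%fset.

Lemma root_set_positive N a : a \in root_set N -> positive_roots F n a.
Proof.
case/imfsetP => u; rewrite inE => ok ->; case: u ok => [[[[i b] m]|[[p c] m]]|m] /= ok.
- exact: short_root_positive.
- exact: fin_root_positive.
exact: imag_root_positive.
Qed.

Lemma root_set_level N a : positive_roots F n a -> ((decode a).2 < N)%N -> a \in root_set N.
Proof.
move=> /positive_root_cases [[i [b [m ->]]]|[p [c [m [pos_p ->]]]]|[m ->]]; rewrite decodeK /= => lt_N.
- have lt_m : (m < N)%N by lia.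
  by apply/imfsetP => /=; exists (inl (inl (i, b, Ordinal lt_m))); rewrite ?inE.
- have lt_m : (m < N)%N by move: lt_N; rewrite /froot_step; case: ifP => _; lia.
  by apply/imfsetP => /=; exists (inl (inr (p, c, Ordinal lt_m))); rewrite ?inE.
have lt_m : (m < N)%N by lia.
by apply/imfsetP => /=; exists (inr (Ordinal lt_m)); rewrite ?inE.
Qed.

End RootSet.

(** * The product over the positive roots at a point *)

Lemma prodV (k : comUnitRingType) I (r : seq I) (P : pred I) (f : I -> k) :
  (forall i, P i -> f i \is a GRing.unit) ->
  (\prod_(i <- r | P i) f i \is a GRing.unit) *
  (\prod_(i <- r | P i) (f i)^-1 = (\prod_(i <- r | P i) f i)^-1).
Proof.
move=> U; suff [] : \prod_(i <- r | P i) f i \is a GRing.unit /\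
    \prod_(i <- r | P i) (f i)^-1 = (\prod_(i <- r | P i) f i)^-1 by [].
apply: (big_rec2 (fun x y => x \is a GRing.unit /\ y = x^-1)).
  by rewrite unitr1 invr1.
by move=> i x y Pi [Ux ->]; rewrite unitrM U // Ux invrM ?U // mulrC.
Qed.

Section Value.
Variables (F : numFieldType) (l : nat).
Notation n := l.+1.
Notation H := (hdual F n).
Variables (k : comUnitRingType) (N : nat) (phi : {rmorphism Zst -> k}) (Q tau s : k).
Hypotheses (phi_s : phi s_var = s) (phi_t : phi t_var = tau ^+ 2).
Hypotheses (QN : (Q ^+ 2) ^+ N = 0) (tN : nilp N tau) (sN : nilp N s).
Notation q := (Q ^+ 2).
Notation t := (tau ^+ 2).
Notation units x := (forall i, x i \is a GRing.unit).

Let nilp_t : nilp N t.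
Proof. by rewrite /nilp expr2; apply: nilpM. Qed.

Lemma mono_unit_wt i (x : 'I_n -> k) : mono (unit_wt i) x = x i.
Proof.
rewrite /mono (bigD1 i) //= ffunE eqxx expr1z big1 ?mulr1 // => a /negPf na.
by rewrite ffunE na expr0z.
Qed.

Lemma mono_inv (g : {ffun 'I_n -> int}) (x : 'I_n -> k) :
  mono g (fun i => (x i)^-1) = mono (- g) x.
Proof. by apply: eq_bigr => i _; rewrite exprz_inv ffunE. Qed.

Lemma mono_froot (p : froot n) (x : 'I_n -> k) : units x ->
  mono (froot_wt p) x = x p.1.1 * (if p.2 then x p.1.2 else (x p.1.2)^-1).
Proof.
move=> Ux; rewrite froot_wtE monoD // mono_unit_wt; congr (_ * _).
by case: (p.2); rewrite ?monoN // mono_unit_wt.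
Qed.

Lemma short_value (x : 'I_n -> k) : units x ->
  \prod_(i < n) \prod_(b : bool) \prod_(m < N)
    (1 - s * (mono (sgn_wt b (unit_wt i)) (fun i => (x i)^-1) * Q ^+ (2 * m).+1))^-1 =
  \prod_(i < n) fac N q (s * Q) (x i).
Proof.
move=> Ux; apply: eq_bigr => i _; rewrite big_bool /fac; congr (_ * _).
  rewrite -(prodV _ (f := fun m : 'I_N => 1 - s * Q * x i * q ^+ m) _).2.
    apply: eq_bigr => m _; congr (_^-1); congr (1 - _).
    by rewrite mono_inv /= opprK mono_unit_wt exprS exprM; ring.
  by move=> m _; apply: (@unit_nilp _ N); rewrite -!mulrA; apply: nilpM.
rewrite -(prodV _ (f := fun m : 'I_N => 1 - s * Q / x i * q ^+ m) _).2.
  apply: eq_bigr => m _; congr (_^-1); congr (1 - _).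
  by rewrite /= mono_unit_wt exprS exprM; ring.
by move=> m _; apply: (@unit_nilp _ N); rewrite -!mulrA; apply: nilpM.
Qed.

Lemma imag_value : \prod_(m < N) (1 - t * Q ^+ (2 * m.+1))^-1 ^+ n = ((poch N q (q * t))^-1) ^+ n.
Proof.
rewrite prodrXl; congr (_ ^+ n); rewrite (prodV _ _).2; last first.
  by move=> m _; apply: (@unit_nilp _ N); apply: nilpM.
congr (_^-1); apply: eq_bigr => m _; rewrite exprM [q ^+ m.+1]exprS; congr (1 - _).
by rewrite [RHS]mulrAC mulrC.
Qed.

Definition froot_poch (p : froot n) (X : k) : k :=
  poch N (q ^+ froot_step p) (t / X) * poch N (q ^+ froot_step p) (t * X).

Lemma froot_poch_unit p X : froot_poch p X \is a GRing.unit.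
Proof. by rewrite unitrM !poch_unit //; apply: nilpM. Qed.

Lemma qstepN (p : froot n) : (q ^+ froot_step p) ^+ N = 0.
Proof. by rewrite exprAC QN /froot_step; case: ifP => _; rewrite ?expr0n ?expr1. Qed.

(** The positive translates of p and - p along delta give a product that is symmetric
    under X |-> 1 / X, except that the factor at step 0 is there for one sign only;
    X is the value of e^p at the original variables, of e^{-p} at the inverted ones. *)
Lemma fin_value_step (p : froot n) (X : k) : X \is a GRing.unit ->
  (\prod_(m < N) (1 - t * (X^-1 * Q ^+ (2 * (froot_step p * (m + false)))))^-1) *
  (\prod_(m < N) (1 - t * (X * Q ^+ (2 * (froot_step p * (m + true)))))^-1) =
  (1 - t * X) / froot_poch p X.
Proof.
move=> UX; set r := q ^+ froot_step p.
rewrite (prodV _ _).2; last by move=> m _; apply: (@unit_nilp _ N); apply: nilpM.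
rewrite (prodV _ _).2; last by move=> m _; apply: (@unit_nilp _ N); apply: nilpM.
have -> : \prod_(m < N) (1 - t * (X^-1 * Q ^+ (2 * (froot_step p * (m + false))))) = poch N r (t / X).
  by apply: eq_bigr => m _; rewrite addn0 exprM exprM mulrA.
have -> : \prod_(m < N) (1 - t * (X * Q ^+ (2 * (froot_step p * (m + true))))) = poch N r (r * (t * X)).
  by apply: eq_bigr => m _; rewrite addn1 exprM exprM -/r [r ^+ m.+1]exprS; congr (1 - _); ring.
rewrite /froot_poch -/r [poch N r (t * X)](poch_shift (qstepN p)).
have U1 : poch N r (t / X) \is a GRing.unit by rewrite poch_unit //; apply: nilpM.
have U2 : poch N r (r * (t * X)) \is a GRing.unit.
  by rewrite poch_unit // mulrC; do 2! apply: nilpM.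
have U3 : 1 - t * X \is a GRing.unit by apply: (@unit_nilp _ N); apply: nilpM.
rewrite !invrM ?unitrM ?U2 ?U3 // [RHS](_ : _ = ((1 - t * X) / (1 - t * X)) *
  ((poch N r (t / X))^-1 * (poch N r (r * (t * X)))^-1)); last by ring.
by rewrite divrr // mul1r.
Qed.

(** Short and long finite roots give the cross factors and the parameters + - tau. *)
Lemma froot_poch_prod (x : 'I_n -> k) : units x ->
  \prod_(p : froot n | froot_pos p) froot_poch p (mono (froot_wt p) x) =
  cross_pairs N q t x * \prod_(i < n) (fac N q tau (x i) * fac N q (- tau) (x i))^-1.
Proof.
move=> Ux; rewrite prod_froot; congr (_ * _).
  apply: eq_bigr => -[i j] /= lt_ij; rewrite !mono_froot //= /froot_poch /froot_step /=.
  rewrite -val_eqE /= (ltn_eqF lt_ij) expr1 /cross_poch !invrM ?unitrV // invrK.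
  have -> : t / x i / x j = t * ((x j)^-1 / x i) by ring.
  have -> : t * x j / x i = t * (x j / x i) by ring.
  by rewrite -!mulrA; ring.
apply: eq_bigr => i _; rewrite mono_froot //= /froot_poch /froot_step /= eqxx.
have sq y : poch N (q ^+ 2) (t * y ^+ 2) = poch N q (tau * y) * poch N q (- tau * y).
  rewrite /poch -big_split; apply: eq_bigr => m _ /=.
  by rewrite -exprM mulnC exprM; ring.
have nN : nilp N (- tau) by rewrite /nilp exprNn tN mulr0.
have U y : poch N q (tau * y) \is a GRing.unit by rewrite poch_unit //; apply: nilpM.
have U' y : poch N q (- tau * y) \is a GRing.unit by rewrite poch_unit //; apply: nilpM.
rewrite -expr2 sq -exprVn sq /fac !invrM ?unitrM ?unitrV ?U ?U' // !invrK.
ring.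
Qed.

Lemma fin_value (x : 'I_n -> k) : units x ->
  \prod_(p : froot n | froot_pos p) \prod_(c : bool) \prod_(m < N)
    (1 - t * (mono (sgn_wt c (froot_wt p)) (fun i => (x i)^-1) *
       Q ^+ (2 * (froot_step p * (m + c)))))^-1 =
  froot_factor t x * ((cross N q t (codom x))^-1 *
    \prod_(i < n) (fac N q tau (x i) * fac N q (- tau) (x i))).
Proof.
move=> Ux; have Um (p : froot n) : mono (froot_wt p) x \is a GRing.unit by exact: mono_unit.
rewrite (eq_bigr (fun p : froot n => (1 - t * mono (froot_wt p) x) *
   (froot_poch p (mono (froot_wt p) x))^-1)); last first.
  move=> p _; rewrite big_bool -fin_value_step // mulrC; congr (_ * _).
    by apply: eq_bigr => m _; rewrite mono_inv opprK.
  by apply: eq_bigr => m _; rewrite mono_inv monoN.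
rewrite big_split /=; congr (_ * _).
have := @prodV k _ (index_enum (froot n : finType)) (@froot_pos n)
   (fun p : froot n => froot_poch p (mono (froot_wt p) x)) (fun p _ => froot_poch_unit p _).
move=> [U ->]; rewrite froot_poch_prod // in U *.
move: U; rewrite unitrM => /andP[U1 U2]; rewrite cross_codom invrM // mulrC; congr (_ * _).
have nN : nilp N (- tau) by rewrite /nilp exprNn tN mulr0.
rewrite -(prodV _ _).2; last first.
  move=> i _; rewrite unitrV /fac !unitrM !unitrV !poch_unit //; exact: nilpM.
by apply: eq_bigr => i _; rewrite invrK.
Qed.

(** The three families of positive roots, evaluated at the inverted variables. *)
Lemma root_set_value (x : 'I_n -> k) : units x ->
  \prod_(a <- root_set F l N)
    (1 - phi (root_var a) * chi Q (fun i => (x i)^-1) a)^-1 ^+ mult a =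
  froot_factor t x * sym_weight N q tau (params tau s Q) x * (poch N q (q * t))^-1 ^+ n.
Proof.
move=> Ux; rewrite big_imfset /=; last first.
  by move=> u v; rewrite !inE; exact: root_at_inj.
rewrite big_enum_cond /=.
rewrite (eq_bigl (@root_ok l N)); last by move=> u; rewrite inE andbT.
rewrite !big_sumType /= -imag_value; congr (_ * _); last first.
  by apply: eq_bigr => m _; have [-> ->] := imag_root_data F l m; rewrite phi_t chi_affine_wt mono0 mul1r.
have -> : froot_factor t x * sym_weight N q tau (params tau s Q) x =
  (\prod_(i < n) fac N q (s * Q) (x i)) * (froot_factor t x * ((cross N q t (codom x))^-1 *
    \prod_(i < n) (fac N q tau (x i) * fac N q (- tau) (x i)))).
  rewrite [RHS]mulrCA; congr (_ * _); rewrite [RHS]mulrCA; congr (_ * _).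
  rewrite -big_split; apply: eq_bigr => i _.
  by rewrite /params /facs !big_cons big_nil /= mulr1 [RHS]mulrC !mulrA.
congr (_ * _).
  rewrite -short_value //; rewrite pair_big pair_big /=; apply: eq_bigr => -[[i b] m] _ /=.
  by have [-> ->] := short_root_data F i b m; rewrite phi_s chi_affine_wt expr1.
rewrite -fin_value // pair_big pair_big /=.
apply: eq_big => [[[p c] m]|[[p c] m] ok] /=; first by rewrite !andbT.
by have [-> ->] := fin_root_data F c m ok; rewrite phi_t chi_affine_wt expr1.
Qed.

End Value.

(** * Stabilization of the finite subproducts *)

Section Stabilization.
Variables (F : numFieldType) (l : nat).
Notation n := l.+1.
Notation H := (hdual F n).
Notation fsum := (formal_sum F n).
Notation lev b := ((decode b).2).

Lemma positive_root_neq0 a : positive_roots F n a -> a != 0.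
Proof.
move=> /positive_root_cases C; apply/eqP => a0; rewrite -(affine_wt0 F l) in a0.
case: C => [[i [b [m aE]]]|[p [c [m [pos_p aE]]]]|[m aE]]; rewrite aE in a0.
- by have [_] := affine_wt_inj a0; lia.
- by have [/eqP] := affine_wt_inj a0; rewrite (negPf (sgn_froot_neq0 _ pos_p)).
by have [_] := affine_wt_inj a0; lia.
Qed.

(** The convolution factors that act trivially on the coefficients of level
    less than N. *)
Definition trivial_below N (g : fsum) : Prop :=
  cone_supported g /\ forall b, cone b -> (lev b < N)%N -> g b = (b == 0)%:R.

(** Levels are additive and nonnegative on the cone, so only the term c = 0 survives. *)
Lemma trivial_below_mul N g f b : trivial_below N g -> cone_supported f ->
  cone b -> (lev b < N)%N -> fs_mul g f b = f b.
Proof.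
move=> [sg gN] sf cb lt_N; rewrite /fs_mul (@fsbigTE _ _ _ _ [fset 0]%fset) => [|c].
  rewrite big_seq_fset1 subr0 gN ?eqxx ?mul1r //; first exact: cone0.
  by rewrite -(affine_wt0 F l) decodeK /=; apply: leq_ltn_trans lt_N.
rewrite inE => c0; have [->|gc] := eqVneq (g c) 0; first by rewrite mul0r.
have [->|fc] := eqVneq (f (b - c)) 0; first by rewrite mulr0.
have [cc cbc] := (sg _ gc, sf _ fc).
case/eqP: gc; rewrite gN // ?(negPf c0) //.
have := decodeD cbc cc; rewrite subrK => e; move: lt_N; rewrite e /=; lia.
Qed.

Lemma cone_supported_geom u (a : H) : cone a -> cone_supported (fs_geom u a).
Proof.
move=> ca b; case: (pselect (exists m, b = a *+ m)) => [[m ->] _|nb]; first exact: coneMn.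
by rewrite fs_geom_out ?eqxx // => m bm; apply: nb; exists m.
Qed.

Lemma cone_supported_root (a : H) : cone a -> cone_supported (root_factor a).
Proof.
move=> ca; rewrite /root_factor; elim: (mult a) => [|m IH] /=; first exact: cone_supported_one.
by apply: cone_supported_mul => //; exact: cone_supported_geom.
Qed.

Lemma lev_Mn (a : H) m : cone a -> lev (a *+ m) = (m * lev a)%N.
Proof.
move=> ca; elim: m => [|m IH]; first by rewrite mulr0n -(affine_wt0 F l) decodeK.
by rewrite mulrS decodeD //= ?IH //; exact: coneMn.
Qed.

Lemma root_trivial_below N (a : H) : cone a -> a != 0 -> (N <= lev a)%N ->
  trivial_below N (root_factor a).
Proof.
move=> ca a0 le_N; split; first exact: cone_supported_root.
have geom_triv : trivial_below N (fs_geom (root_var a) a).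
  split=> [|b cb lt_N]; first exact: cone_supported_geom.
  have [->|b0] := eqVneq b 0; first by rewrite -[0](mulr0n a) fs_geom_mul.
  rewrite fs_geom_out // => -[|m] bm; first by rewrite bm mulr0n eqxx in b0.
  by move: lt_N; rewrite bm lev_Mn //; nia.
rewrite /root_factor; elim: (mult a) => [|m IH] b cb lt_N //=.
rewrite (trivial_below_mul geom_triv _ cb lt_N) ?IH //; elim: (m) => [|m' IH'] /=; first exact: cone_supported_one.
by apply: cone_supported_mul => //; exact: cone_supported_geom.
Qed.

Definition list_prod (s : seq H) : fsum := \big[@fs_mul F n/@fs_one F n]_(a <- s) root_factor a.

Lemma cone_supported_list s : (forall a, a \in s -> cone a) -> cone_supported (list_prod s).
Proof.
rewrite /list_prod; elim: s => [|a s IH] sP; first by rewrite big_nil; exact: cone_supported_one.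
rewrite big_cons; apply: cone_supported_mul.
  by apply: cone_supported_root; apply: sP; exact: mem_head.
by apply: IH => b bs; apply: sP; rewrite inE bs orbT.
Qed.

(** Roots of level at least N act trivially below N. *)
Lemma list_prod_low N s b : (forall a, a \in s -> cone a /\ a != 0) ->
  cone b -> (lev b < N)%N ->
  list_prod s b = list_prod [seq a <- s | (lev a < N)%N] b.
Proof.
elim: s b => [//|a s IH] b sP cb lt_N.
have [ca a0] := sP a (mem_head a s).
have sP' c : c \in s -> cone c /\ c != 0 by move=> cs; apply: sP; rewrite inE cs orbT.
have s_cone : cone_supported (list_prod s) by apply: cone_supported_list => c /sP' [].
have f_cone : cone_supported (list_prod [seq a <- s | (lev a < N)%N]).
  by apply: cone_supported_list => c; rewrite mem_filter => /andP[_ /sP' []].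
rewrite /= {1}/list_prod big_cons -/(list_prod s); case: ltnP => [lt_a|le_a]; last first.
  by rewrite (trivial_below_mul (root_trivial_below ca a0 le_a) s_cone cb lt_N) IH.
rewrite [RHS]/list_prod big_cons -/(list_prod _).
have [X XP] := cone_below_finite b; have sa := cone_supported_root ca.
rewrite !(fs_mulE sa _ XP) //; apply: eq_bigr => c _.
have [->|ac] := eqVneq (root_factor a c) 0; first by rewrite !mul0r.
case: (pselect (cone (b - c))) => [cbc|ncbc]; last first.
  have -> : list_prod s (b - c) = 0 by apply/eqP/negPn/negP => /s_cone.
  by have -> : list_prod [seq a <- s | (lev a < N)%N] (b - c) = 0 by apply/eqP/negPn/negP => /f_cone.
rewrite IH //; have := decodeD cbc (sa _ ac); rewrite subrK => e; apply: leq_ltn_trans lt_N; by rewrite e leq_addr.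
Qed.

Lemma list_prod_perm s s' : (forall a, a \in s -> cone a) -> perm_eq s s' ->
  list_prod s = list_prod s'.
Proof.
have move_front a s1 s2 : cone a -> (forall c, c \in s1 ++ s2 -> cone c) ->
    list_prod (s1 ++ a :: s2) = list_prod (a :: s1 ++ s2).
  move=> ca; elim: s1 => [//|c s1 IH] sP.
  have sP' d : d \in s1 ++ s2 -> cone d by move=> ds; apply: sP; rewrite inE ds orbT.
  have cc : cone c by apply: sP; exact: mem_head.
  rewrite {1}/list_prod /= big_cons -/(list_prod _) IH // /list_prod !big_cons.
  rewrite fs_mulCA //; [exact: cone_supported_root | exact: cone_supported_root |].
  exact: cone_supported_list.
elim: s s' => [|a s IH] s' sP e; first by have /perm_size/esym/size0nil -> := e.
have as' : a \in s' by rewrite -(perm_mem e) mem_head.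
have [s1 [s2 s'E]] : exists s1 s2, s' = s1 ++ a :: s2.
  by case/splitPr: as' => s1 s2; exists s1, s2.
have ca : cone a by apply: sP; exact: mem_head.
have e' : perm_eq s (s1 ++ s2).
  by rewrite -(perm_cons a) (perm_trans e) // s'E perm_catC /= perm_cons perm_catC.
have sP' c : c \in s -> cone c by move=> cs; apply: sP; rewrite inE cs orbT.
rewrite s'E move_front //; last by move=> c; rewrite -(perm_mem e'); exact: sP'.
by rewrite /list_prod !big_cons; congr fs_mul; exact: IH.
Qed.

Lemma fs_prod_low N (B : {fset H}) b : (forall a, a \in B -> positive_roots F n a) ->
  {subset root_set F l N <= B} -> cone b -> (lev b < N)%N ->
  fs_prod B b = fs_prod (root_set F l N) b.
Proof.
move=> BP AB cb lt_N.
have pos s : (forall a, a \in s -> positive_roots F n a) -> forall a, a \in s -> cone a /\ a != 0.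
  by move=> sP a /sP ap; split; [case: ap | exact: positive_root_neq0].
rewrite -[fs_prod B]/(list_prod (enum_fset B)) -[fs_prod _]/(list_prod (enum_fset (root_set F l N))).
rewrite (@list_prod_low N (enum_fset B)) //; last exact: pos.
rewrite [RHS](@list_prod_low N) //; last by apply: pos; exact: root_set_positive.
congr (_ b); apply: list_prod_perm => [a|].
  by rewrite mem_filter => /andP[_ /BP []].
apply: uniq_perm; rewrite ?filter_uniq ?fset_uniq // => a; rewrite !mem_filter.
case: ltnP => //= lt_a; apply/idP/idP; last exact: AB.
by move=> /BP ap; exact: root_set_level.
Qed.

(** Enlarging a set that already contains the roots of level below N does not change
    the coefficients of level below N. *)
Lemma kostant_partitionE N b : cone b -> (lev b < N)%N ->
  kostant_partition b = fs_prod (root_set F l N) b.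
Proof.
move=> cb lt_N; rewrite /kostant_partition; case: xgetP => [p _ [A [AP pE]]|/(_ (fs_prod (root_set F l N) b))[]].
  rewrite -(pE (A `|` root_set F l N)%fset).
  - apply: fs_prod_low => // a; last by rewrite inE => ->; rewrite orbT.
    by rewrite inE => /orP[/AP //|]; exact: root_set_positive.
  - by move=> a; rewrite inE => /orP[/AP //|]; exact: root_set_positive.
  by move=> a aA; rewrite inE aA.
by exists (root_set F l N); split=> [|B BP AB]; [exact: root_set_positive | exact: fs_prod_low].
Qed.

Lemma kostant_partition_out b : ~ cone b -> kostant_partition (b : H) = 0.
Proof.
move=> nb; rewrite /kostant_partition; case: xgetP => [p _ [A [AP pE]]|] //.
rewrite -(pE A) //; apply/eqP/negPn/negP => h; apply: nb; move: h.
by apply: cone_supported_list => a /AP [].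
Qed.

End Stabilization.

(** * The ring of truncated power series *)

(** Type I integrals and constant terms need inverses of units; any commutative
    ring has them, and choice makes the inverse a function. *)
Definition with_units (R : comNzRingType) : Type := R.
HB.instance Definition _ (R : comNzRingType) := GRing.ComNzRing.copy (with_units R) R.

Section WithUnits.
Variable R : comNzRingType.

Definition cunit : {pred with_units R} := fun x => `[< exists y : with_units R, y * x = 1 >].
Definition cinv (x : with_units R) : with_units R :=
  if pselect (exists y : with_units R, y * x = 1) is left e then sval (cid e) else x.

Lemma cmulVx : {in cunit, left_inverse 1 cinv *%R}.
Proof.
move=> x /asboolP ex; rewrite /cinv; case: pselect => // e.
exact: (svalP (cid e)).
Qed.

Lemma cunitPl (x y : with_units R) : y * x = 1 -> cunit x.
Proof. by move=> yx; apply/asboolP; exists y. Qed.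

Lemma cinv_out : {in [predC cunit], cinv =1 id}.
Proof. by move=> x /asboolPn nx; rewrite /cinv; case: pselect. Qed.

HB.instance Definition _ :=
  GRing.ComNzRing_hasMulInverse.Build (with_units R) cmulVx cunitPl cinv_out.

End WithUnits.

Section GradedRing.
Variable N : nat.
Hypothesis N0 : (0 < N)%N.
Notation base := {poly {poly algC}}.

(** The coefficients are polynomials in s (inner variable) and tau (outer variable). *)
Definition graded : comUnitRingType := with_units {poly %/ ('X^N : {poly base})}.

Definition gr : {poly base} -> graded := in_qpoly 'X^N.
HB.instance Definition _ := GRing.RMorphism.copy gr (in_qpoly ('X^N : {poly base})).

Lemma grM p p' : gr (p * p') = gr p * gr p'.
Proof. exact: rmorphM. Qed.

Lemma grX p m : gr (p ^+ m) = gr p ^+ m.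
Proof. exact: rmorphXn. Qed.

Lemma gr_coef p i : (i < N)%N -> (gr p : {poly %/ 'X^N})`_i = p`_i.
Proof.
move=> lt_i; rewrite /gr /= mk_monic_Xn prednK //.
have mX := monicXn base N.
have := Pdiv.RingMonic.rdivp_eq mX p => /(congr1 (fun r : {poly base} => r`_i)).
by rewrite coefD coefMXn lt_i add0r => ->.
Qed.

Lemma gr_XN : gr 'X ^+ N = 0.
Proof.
rewrite -rmorphXn; apply: val_inj => /=.
by rewrite mk_monic_Xn prednK // Pdiv.RingMonic.rmodpp // monicXn.
Qed.

(** The degree-1 representatives of s, of tau = sqrt t and of Q = e^{delta / 2}.  A
    common degree for all three makes them nilpotent and still lets the total
    degree determine the exponent of Q from those of s and tau. *)
Definition gs : graded := gr (('X%:P)%:P * 'X).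
Definition gtau : graded := gr ('X%:P * 'X).
Definition gQ : graded := gr 'X.

Lemma gr_mulXN p : gr (p * 'X) ^+ N = 0.
Proof. by rewrite rmorphM exprMn gr_XN mulr0. Qed.

Definition scal : algC -> graded := gr \o polyC \o polyC \o polyC.
HB.instance Definition _ := GRing.RMorphism.on scal.

Lemma natr_unit m : (0 < m)%N -> (m%:R : graded) \is a GRing.unit.
Proof.
move=> m0; rewrite -(rmorph_nat scal); apply: rmorph_unit.
by rewrite unitfE pnatr_eq0 -lt0n.
Qed.

Definition phi_s : {poly int} -> graded := horner_eval gs \o map_poly intr.
HB.instance Definition _ := GRing.RMorphism.on phi_s.

Definition phi : Zst -> graded := horner_eval (gtau ^+ 2) \o map_poly phi_s.
HB.instance Definition _ := GRing.RMorphism.on phi.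

Lemma phiE (P : Zst) : phi P =
  \sum_(b < size P) \sum_(a < size P`_b) (P`_b`_a)%:~R * gs ^+ a * (gtau ^+ 2) ^+ b.
Proof.
rewrite /phi /comp /horner_eval (@horner_coef_wide _ (size P)); last exact: size_poly.
apply: eq_bigr => b _; rewrite coef_map /= /phi_s /comp /horner_eval.
rewrite (@horner_coef_wide _ (size P`_b)); last exact: size_poly.
by rewrite mulr_suml; apply: eq_bigr => a _; rewrite coef_map.
Qed.

Lemma phi_s_var : phi s_var = gs.
Proof.
rewrite /phi /s_var /comp map_polyC /horner_eval hornerC /=.
by rewrite /phi_s /comp map_polyX /horner_eval hornerX.
Qed.

Lemma phi_t_var : phi t_var = gtau ^+ 2.
Proof. by rewrite /phi /t_var /comp map_polyX /horner_eval hornerX. Qed.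

(** The coefficient of s^a t^b Q^m. *)
Definition extract a b m (x : graded) : algC :=
  (x : {poly %/ ('X^N : {poly base})})`_(a + 2 * b + m)`_(2 * b)`_a.

Lemma extractD a b m : {morph extract a b m : x y / x + y}.
Proof. by move=> x y; rewrite /extract /= !coefD. Qed.

Lemma extract0 a b m : extract a b m 0 = 0.
Proof. by rewrite /extract /= !coef0. Qed.

Lemma extract_monomial a b m (z : int) a' b' m' : (a + 2 * b + m < N)%N ->
  extract a b m (z%:~R * gs ^+ a' * (gtau ^+ 2) ^+ b' * gQ ^+ m') =
  if [&& a == a', b == b' & m == m'] then z%:~R else 0.
Proof.
move=> lt_N; rewrite -exprM.
have -> : z%:~R * gs ^+ a' * gtau ^+ (2 * b') * gQ ^+ m' =
  gr ((((z%:~R : algC)%:P * 'X^a')%:P * 'X^(2 * b'))%:P * 'X^(a' + 2 * b' + m')).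
  have -> : (z%:~R : graded) = gr (z%:~R)%:P%:P%:P by rewrite !rmorph_int.
  have -> : (((z%:~R : algC)%:P * 'X^a')%:P * 'X^(2 * b'))%:P * 'X^(a' + 2 * b' + m') =
      (z%:~R)%:P%:P%:P * (('X%:P)%:P * 'X) ^+ a' * ('X%:P * 'X) ^+ (2 * b') * 'X ^+ m' :> {poly base}.
    by rewrite !polyCM !polyC_exp !exprMn !exprD; ring.
  by rewrite !grM !grX.
rewrite /extract gr_coef // coefCM coefXn; case: eqP => e; last first.
  rewrite mulr0 !coef0; case: and3P => // -[/eqP ea /eqP eb /eqP em].
  by case: e; rewrite ea eb em.
rewrite mulr1 coefCM coefXn eqn_mul2l /=; case: eqP => eb; last by rewrite mulr0 coef0 andbF.
rewrite mulr1 coefCM coefXn; case: eqP => ea; last by rewrite mulr0.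
by rewrite mulr1 (_ : m == m') //; apply/eqP; lia.
Qed.

Lemma extract_phi a b m (z : int) (P : Zst) m' : (a + 2 * b + m < N)%N ->
  extract a b m (phi P * gQ ^+ m' * z%:~R) = if m == m' then (P`_b`_a * z)%:~R else 0.
Proof.
move=> lt_N; rewrite phiE !mulr_suml (big_morph _ (extractD a b m) (extract0 a b m)).
under eq_bigr => i _ do rewrite !mulr_suml (big_morph _ (extractD a b m) (extract0 a b m)).
have term i j : extract a b m ((P`_i`_j)%:~R * gs ^+ j * (gtau ^+ 2) ^+ i * gQ ^+ m' * z%:~R) =
    if [&& a == j, b == i & m == m'] then (P`_i`_j * z)%:~R else 0.
  rewrite -(extract_monomial (P`_i`_j * z) j i m' lt_N) rmorphM /=; congr (extract _ _ _ _).
  by rewrite -!mulrA; congr (_ * _); rewrite [RHS]mulrC -!mulrA.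
under eq_bigr => i _ do under eq_bigr => j _ do rewrite term.
case: (m == m'); last by rewrite big1 // => i _; rewrite big1 // => j _; rewrite !andbF.
case: (ltnP b (size P)) => [lt_b|le_b]; last first.
  rewrite (nth_default _ le_b) coef0 mul0r big1 // => i _; rewrite big1 // => j _.
  by rewrite (_ : b == i = false) ?andbF //; apply/eqP => bi; have := ltn_ord i; lia.
rewrite (bigD1 (Ordinal lt_b)) //= [X in _ + X]big1 ?addr0; last first.
  move=> i; rewrite -val_eqE /= => /negPf ni; rewrite big1 // => j _.
  by rewrite [b == _]eq_sym ni andbF.
case: (ltnP a (size P`_b)) => [lt_a|le_a]; last first.
  rewrite (nth_default _ le_a) mul0r big1 // => j _.
  by rewrite (_ : a == j = false) //; apply/eqP => aj; by move: le_a; rewrite aj leqNgt ltn_ord.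
rewrite (bigD1 (Ordinal lt_a)) //= !eqxx big1 ?addr0 // => j; rewrite -val_eqE /= => /negPf nj.
by rewrite [a == _]eq_sym nj.
Qed.

(** A cone of ring elements on which every extracted coefficient is nonnegative. *)
Definition nonneg (x : graded) : Prop :=
  exists p : {poly base}, (forall i j c, 0 <= p`_i`_j`_c) /\ x = gr p.

Lemma nonnegD x y : nonneg x -> nonneg y -> nonneg (x + y).
Proof.
move=> [p [p0 ->]] [p' [p0' ->]]; exists (p + p'); split; last by rewrite rmorphD.
by move=> i j c; rewrite !coefD addr_ge0.
Qed.

Lemma nonnegM x y : nonneg x -> nonneg y -> nonneg (x * y).
Proof.
move=> [p [p0 ->]] [p' [p0' ->]]; exists (p * p'); split; last by rewrite rmorphM.
move=> i j c; rewrite coefM !coef_sum; apply: sumr_ge0 => a _.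
rewrite coefM coef_sum; apply: sumr_ge0 => b _; rewrite coefM; apply: sumr_ge0 => d _.
exact: mulr_ge0.
Qed.

Lemma nonneg1 : nonneg 1.
Proof.
exists 1; split; last by rewrite rmorph1.
move=> i j c; rewrite coef1; case: eqP => _; last by rewrite !coef0.
rewrite coef1; case: eqP => _; last by rewrite coef0.
by rewrite coef1 ler0n.
Qed.

Lemma nonnegX x m : nonneg x -> nonneg (x ^+ m).
Proof.
move=> x0; elim: m => [|m IH]; first by rewrite expr0; exact: nonneg1.
by rewrite exprS; exact: nonnegM.
Qed.

Lemma nonneg_gen (c : base) : (forall i j, 0 <= c`_i`_j) -> nonneg (gr (c%:P * 'X)).
Proof.
move=> c0; exists (c%:P * 'X); split=> // i j d; rewrite coefCM coefX.
by case: eqP => _; rewrite ?mulr1 // mulr0 !coef0.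
Qed.

Lemma nonneg_gs : nonneg gs.
Proof.
apply: nonneg_gen => i j; rewrite coefC; case: ifP => _; last by rewrite coef0.
by rewrite coefX ler0n.
Qed.

Lemma nonneg_gtau : nonneg gtau.
Proof.
apply: nonneg_gen => i j; rewrite coefX; case: eqP => _; last by rewrite coef0.
by rewrite coef1 ler0n.
Qed.

Lemma nonneg_gQ : nonneg gQ.
Proof.
rewrite /gQ -['X]mul1r; apply: nonneg_gen => i j.
by rewrite coef1; case: eqP => _; rewrite ?coef0 // coef1 ler0n.
Qed.

Lemma extract_nonneg a b m x : (a + 2 * b + m < N)%N -> nonneg x -> 0 <= extract a b m x.
Proof. by move=> lt_N [p [p0 ->]]; rewrite /extract gr_coef. Qed.

End GradedRing.

(** For M dividing j all terms are 1; otherwise the sum is a geometric one with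
    ratio z^j <> 1 and (z^j)^M = 1. *)
Lemma sum_unity_root (R : comUnitRingType) (f : {rmorphism algC -> R}) M z (j : int) :
  (0 < M)%N -> M.-primitive_root z ->
  \sum_(i < M) (f z ^+ i) ^ j = if (M %| j)%Z then M%:R else 0.
Proof.
move=> M0 zM; have zMj := prim_expr_order zM; have z0 : z != 0 by rewrite (prim_root_eq0 zM) -lt0n.
have -> : \sum_(i < M) (f z ^+ i) ^ j = f (\sum_(i < M) (z ^ j) ^+ i).
  rewrite rmorph_sum; apply: eq_bigr => i _; rewrite rmorphXn /= rmorphXz ?unitfE //.
  by rewrite !exprnP !exprz_exp mulrC.
have dvd_j : (M %| j)%Z = (z ^ j == 1).
  rewrite dvdzE (prim_order_dvd zM) /=; case: j => j //.
  by rewrite NegzE -exprnN invr_eq1 abszN.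
rewrite dvd_j; case: eqP => [->|/eqP zj1].
  by under eq_bigr => i _ do rewrite expr1n; rewrite sumr_const card_ord rmorph_nat.
have : (z ^ j - 1) * \sum_(i < M) (z ^ j) ^+ i = 0.
  by rewrite -subrX1 !exprnP exprz_exp mulrC -exprz_exp -exprnP zMj exp1rz subrr.
by move=> /eqP; rewrite mulf_eq0 subr_eq0 (negPf zj1) => /eqP ->; rewrite rmorph0.
Qed.

(** * Coefficients of the Kostka-Foulkes polynomials *)

Section CTEvaluates.
Variables (F : numFieldType) (l : nat).
Notation n := l.+1.
Variables (k : comUnitRingType) (N : nat) (phi : {rmorphism Zst -> k}) (Q : k).
Notation q := (Q ^+ 2).
Hypothesis QN : q ^+ N = 0.
Variables (M' : nat) (w : k).
Let M := M'.+1.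
Hypothesis MU : (M%:R : k) \is a GRing.unit.
Hypothesis wM : w ^+ M = 1.
Hypothesis sum_w : forall j : int,
  \sum_(i < M) (w ^+ i) ^ j = if (M %| j)%Z then M%:R else 0.

(** Linearity reduces the constant term to those of single monomials, for which d
    bounds the exponents. *)
Lemma CT_evaluates d (f : formal_sum F n) S v : evaluates phi Q f S v ->
  (theta_deg N n + d < M)%N ->
  (forall b i, b \in S -> `|(rho_wt l + (decode b).1) i| <= d%:Z) ->
  CT N q M' w (fun x : 'I_n -> k => xrho x * v (fun i => (x i)^-1)) =
  \sum_(b <- S) phi (f b) * Q ^+ (decode b).2 * theta_det q (rho_wt l + (decode b).1).
Proof.
move=> [_ _ fv] d_M dS.
rewrite (eq_CT N q wM (G := fun x => \sum_(b <- S) phi (f b) * Q ^+ (decode b).2 *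
    mono (- (rho_wt l + (decode b).1)) x)); last first.
  move=> x Ux; rewrite -fv ?mulr_sumr; last by move=> i; rewrite unitrV.
  apply: eq_bigr => b _; rewrite /chi (mono_inv (decode b).1 x) mono_rho opprD (monoD _ _ Ux).
  by rewrite mulrCA [mono _ _ * Q ^+ _]mulrC [mono _ _ * (_ * _)]mulrCA mulrA.
rewrite CT_sum big_seq [RHS]big_seq; apply: eq_bigr => b bS.
by rewrite CTZ (CT_mono QN MU wM sum_w (d := d)) // => i; exact: dS.
Qed.

End CTEvaluates.

Lemma nonneg_inv N (x r : graded N) : x * r = 1 ->
  r \is a GRing.unit /\ nonneg r^-1 -> nonneg x.
Proof. by move=> xr [Ur r0]; rewrite -[x](mulrK Ur) xr mul1r. Qed.

Section Coefficient.
Variables (F : numFieldType) (l : nat).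
Notation n := l.+1.
Notation H := (hdual F n).
Variable rho : H.
Hypothesis hrho : weyl_vector rho.
Let Lam : H := Lambda0 + rho.
Variables (p a b N : nat).
Hypothesis N_big : (a + 2 * b + 2 * p < N)%N.
Let N0 : (0 < N)%N. Proof. exact: leq_ltn_trans N_big. Qed.
Notation k := (graded N).
Notation Q := (gQ N).
Notation q := (Q ^+ 2).
Notation tau := (gtau N).
Notation s := (gs N).
Notation phi := (phi N).

Let QN : q ^+ N = 0. Proof. by rewrite exprAC gr_XN // expr0n. Qed.
Let tN : nilp N tau. Proof. exact: gr_mulXN. Qed.
Let sN : nilp N s. Proof. exact: gr_mulXN. Qed.

Let f : formal_sum F n := fs_prod (root_set F l N).
Let v (x : 'I_n -> k) : k := \prod_(a <- root_set F l N)
  (1 - phi (root_var a) * chi Q x a)^-1 ^+ mult a.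

Lemma denominator_evaluates : exists S, evaluates phi Q f S v.
Proof.
apply: (evaluates_prod (N := N) Q) => c /root_set_positive pc; split.
- by case: pc.
- exact: positive_root_neq0.
rewrite /root_var; case: ifP => _; first by apply: etrans sN; congr (_ ^+ N); exact: phi_s_var.
transitivity ((tau ^+ 2) ^+ N); first by congr (_ ^+ N); exact: phi_t_var.
by rewrite exprAC tN expr0n.
Qed.

(** 1 / (1 - y) is a geometric series, and every y that occurs is the square of a
    monomial in s, tau and Q. *)
Lemma reduced_denominator_nonneg :
  let r := reduced_denominator N l tau s Q in r \is a GRing.unit /\ nonneg r^-1.
Proof.
rewrite /=; pose good (r : k) := r \is a GRing.unit /\ nonneg r^-1.
have goodM x y : good x -> good y -> good (x * y).
  by move=> [Ux x0] [Uy y0]; split; [rewrite unitrM Ux | rewrite invrM //; exact: nonnegM].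
have good1 : good 1 by split; [exact: unitr1 | rewrite invr1; exact: nonneg1].
have good_nilp y : nonneg y -> y ^+ N = 0 -> good (1 - y).
  move=> y0 yN; split; first exact: unit_nilp yN.
  rewrite (inv_nilp yN); apply: (big_rec (@nonneg N)).
    exists 0; split=> [i j c|]; first by rewrite !coef0.
    by rewrite rmorph0.
  by move=> i z _ z0; apply: nonnegD => //; exact: nonnegX.
apply: (big_rec good) => // j x _ gx; apply: (goodM _ _ _ gx).
apply: (big_rec good) => // m y _ gy; apply: (goodM _ _ _ gy).
have sqN (z : k) : z ^+ N = 0 -> (z ^+ 2) ^+ N = 0 by move=> zN; rewrite exprAC zN expr0n.
have Q0 := nonneg_gQ N; have t0 := nonneg_gtau N; have s0 := nonneg_gs N.
apply: goodM; apply: good_nilp.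
- by do ?[apply: nonnegX|apply: nonnegM].
- by apply: sqN; apply: nilpMl; rewrite (exprS q m); exact: nilpMr.
- by do ?[apply: nonnegX|apply: nonnegM].
by apply: sqN; do 2 apply: nilpMr; exact: nilpMl.
Qed.

Let term (c : H) : k :=
  phi (f c) * Q ^+ (decode c).2 * weyl_coef rho q (rho_wt l + (decode c).1).

(** The sum is the constant term of e^{-rho} times the product over the positive
    roots, hence the inverse of the reduced denominator.  The number of nodes is
    chosen after the finite support S. *)
Lemma generating_nonneg : exists S, evaluates phi Q f S v /\ nonneg (\sum_(c <- S) term c).
Proof.
have [S fS] := denominator_evaluates; exists S; split=> //.
pose d := (\sum_(c <- S) \sum_(i < n) `|(rho_wt l + (decode c).1)%R i|)%N.
(* one summand for each lower bound on the number of nodes *)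
pose M' := (theta_deg N n + d + (n.+1 + (2 * n).+2 * (N * N)) +
  (n + 2 * (N * #|{: 'I_n * 'I_n * bool}|)))%N.
have [z zM] := C_prim_root_exists (ltn0Sn M').
pose w : k := scal N z.
have MU : (M'.+1%:R : k) \is a GRing.unit by exact: natr_unit.
have U2 : (2 : k) \is a GRing.unit by exact: natr_unit.
have wM : w ^+ M'.+1 = 1.
  have e : scal N (z ^+ M'.+1) = 1 by rewrite (prim_expr_order zM) rmorph1.
  by rewrite -e; exact/esym/rmorphXn.
have sum_w (j : int) : \sum_(i < M'.+1) (w ^+ i) ^ j = if (M'.+1 %| j)%Z then M'.+1%:R else 0.
  exact: (@sum_unity_root k (scal N) M'.+1 z j).
have M_enough : enough_nodes N M' n by rewrite /enough_nodes /M'; lia.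
have M_big0 : (theta_deg N n + (n + 2 * (N * #|{: 'I_n * 'I_n * bool}|)) < M'.+1)%N.
  by rewrite /M'; lia.
have d_M : (theta_deg N n + d < M'.+1)%N by rewrite /M'; lia.
have dS c (i : 'I_n) : c \in S -> `|(rho_wt l + (decode c).1) i| <= d%:Z.
  move=> cS; rewrite -abszE lez_nat /d (big_fsetD1 c) //= (bigD1 i) //=.
  by rewrite -addnA leq_addr.
have tot := CT_evaluates QN MU wM sum_w fS d_M dS.
have -> : \sum_(c <- S) term c = CT N q M' w (fun x : 'I_n -> k => xrho x * v (fun i => (x i)^-1)).
  rewrite tot; apply: eq_bigr => c _; rewrite /term; congr (_ * _).
  exact: weyl_coef_theta.
have [Ur r0] := reduced_denominator_nonneg.
apply: (nonneg_inv _ (conj Ur r0)).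
pose P := poch N q (q * tau ^+ 2).
have UP : P \is a GRing.unit by apply: poch_unit; apply: nilpMr.
have val x : (forall i, x i \is a GRing.unit) -> xrho x * v (fun i => (x i)^-1) =
    P^-1 ^+ n * (xrho x * (froot_factor (tau ^+ 2) x * sym_weight N q tau (params tau s Q) x)).
  move=> Ux; rewrite /v (root_set_value F (phi_s_var N) (phi_t_var N) QN tN sN Ux).
  by rewrite [RHS]mulrC mulrA.
rewrite (eq_CT N q wM val) CTZ -mulrA.
rewrite (CT_weight_eval MU U2 wM sum_w M_enough tN sN M_big0 QN) -/P.
by rewrite -exprMn mulVr // expr1n.
Qed.

Let beta (w : 'M[F]_(n.+2)) : H := Lam *m w - (Lambda0 - delta *+ p + rho).

Lemma beta_dcoord w g : in_orbit rho w g -> dcoord (beta w) = p%:R - (defect g)%:R.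
Proof.
move=> og; have [dE _] := in_orbit_defect hrho og.
rewrite /beta dcoordD dcoordN dE -scaler_nat /Lam !dcoordD dcoordN dcoordZ dcoord_delta; ring.
Qed.

Lemma beta_affine_wt w g : in_orbit rho w g -> (defect g <= p)%N ->
  beta w = affine_wt F (g - rho_wt l) (2 * (p - defect g)).
Proof.
move=> og le_p; have [Ww gE] := og; apply: hdualP => [|c|].
- have [s' [e [d Pw]]] := weyl_paramP Ww; have [Pl _ _] := Pw Lam.
  rewrite level_affine_wt /beta levelD levelN Pl -scaler_nat /Lam !levelD levelN levelZ level_delta.
  ring.
- rewrite coord_affine_wt /beta coordD coordN gE -scaler_nat !coordD coordN coordZ coord_delta.
  have := coord_Lam hrho c; rewrite coordD => cL.
  rewrite mulr0 oppr0 addr0 cL !ffunE rmorphB /=; congr (_ - _).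
rewrite (beta_dcoord og) dcoord_affine_wt natrM mulrAC divff ?pnatr_eq0 // mul1r natrB //.
Qed.

Lemma cone_beta w g : in_orbit rho w g -> cone (beta w) -> (defect g <= p)%N.
Proof. by move=> og /cone_dcoord; rewrite (beta_dcoord og) subr_ge0 ler_nat. Qed.

Let G w : Zst := (sign w)%:~R * kostant_partition (beta w).
Let T c : algC := extract a b (2 * p) (term c).

(** The power of Q from the partition function and the drop along delta of the
    orbit add up to 2 p exactly when w contributes to K_p. *)
Lemma term_orbit w g m : in_orbit rho w (rho_wt l + g) ->
  T (affine_wt F g m) = if (2 * p == m + 2 * defect (rho_wt l + g)%R)%N
    then ((f (affine_wt F g m))`_b`_a * sign w)%:~R else 0.
Proof.
move=> og; rewrite /T /term decodeK /= (weyl_coef_in hrho _ og).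
rewrite -(extract_phi N0 (sign w) (f (affine_wt F g m)) _ N_big); congr extract.
rewrite [(sign w)%:~R * _]mulrC mulrA; congr (_ * _).
by rewrite exprD [Q ^+ (2 * _)]exprM mulrA.
Qed.

Lemma coef_int (z : int) (P : Zst) : (z%:~R * P)`_b`_a = P`_b`_a * z.
Proof.
rewrite -[z%:~R](rmorph_int polyC) coefCM -[z%:~R in LHS](rmorph_int polyC) coefCM intz.
exact: mulrC.
Qed.

Lemma G_term w : weyl_group F n w -> cone (beta w) -> ((G w)`_b`_a)%:~R = T (beta w).
Proof.
move=> Ww cb; have [g [_ [og _ _]]] := weyl_orbit hrho Ww.
have le_p := cone_beta og cb; have bE := beta_affine_wt og le_p.
have og' : in_orbit rho w (rho_wt l + (g - rho_wt l)) by rewrite addrC subrK.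
rewrite bE (term_orbit _ og') addrC subrK -mulnDr subnK // eqxx /G coef_int.
rewrite (kostant_partitionE (N := N)) ?bE //; first by rewrite -bE.
by rewrite decodeK /=; lia.
Qed.

Lemma beta_inj w w' : weyl_group F n w -> weyl_group F n w' -> beta w = beta w' -> w = w'.
Proof.
move=> Ww Ww' /addIr e; have [g [_ [og _ _]]] := weyl_orbit hrho Ww.
by apply: (weyl_orbit_inj hrho og); split=> // c; rewrite -e; case: og.
Qed.

(** At the point (1, ..., 1) every monomial in the x_i is 1. *)
Lemma term_out c S : evaluates phi Q f S v -> c \notin S -> T c = 0.
Proof.
move=> [_ fS _] cS; have := fS (fun=> 1) c (fun=> unitr1 _) cS.
rewrite /chi /mono big1 ?mul1r => [e|i _]; last exact: exp1rz.
by rewrite /T /term e mul0r extract0.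
Qed.

Lemma term_in c S : evaluates phi Q f S v -> T c != 0 ->
  exists w, [/\ weyl_group F n w, cone (beta w), beta w = c & G w != 0].
Proof.
move=> [sf _ _] Tc; have cc : cone c.
  apply: sf; apply: contra_neq Tc => fc.
  by rewrite /T /term fc; rewrite raddf0 !mul0r extract0.
have [g [m cE]] := cone_affine_wt cc.
case: (pselect (exists w, in_orbit rho w (rho_wt l + g))) => [[w og]|no]; last first.
  case/eqP: Tc; rewrite /T /term cE decodeK /= weyl_coef_out ?mulr0 ?extract0 // => w og.
  by apply: no; exists w.
move: (Tc); rewrite cE (term_orbit m og); case: ifP => [/eqP pE _|_]; last by rewrite eqxx.
have le_p : (defect (rho_wt l + g)%R <= p)%N by lia.
have bE : beta w = c.
  have gK : rho_wt l + g - rho_wt l = g by rewrite addrC addKr.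
  by rewrite (beta_affine_wt og le_p) cE gK; congr (affine_wt _ g _); lia.
have Ww : weyl_group F n w by case: og.
have cb : cone (beta w) by rewrite bE.
exists w; split=> //; first by rewrite bE.
apply: contra_neq Tc => Gw.
by rewrite -bE -G_term // Gw !coef0.
Qed.

(** The sum over w and the sum over the support S agree term by term through the
    injection beta, once both are extended by zero to the union of the index sets. *)
Lemma kostka_coef_ge0 : 0 <= (kostka_foulkes rho Lambda0 (Lambda0 - delta *+ p))`_b`_a.
Proof.
have [S [fS S0]] := generating_nonneg.
rewrite /kostka_foulkes; case: finite_supportP => [_|X XW _ XE]; first by rewrite big_nil !coef0.
have extr : 0 <= \sum_(c <- S) T c.
  rewrite -(big_morph _ (extractD a b (2 * p)) (extract0 N a b (2 * p))).
  exact: extract_nonneg S0.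
rewrite -(ler0z algC) !coef_sum rmorph_sum -[X in 0 <= X]/(\sum_(w <- X) ((G w)`_b`_a)%:~R).
suff -> : \sum_(w <- X) ((G w)`_b`_a)%:~R = \sum_(c <- S) T c by [].
have XWw w : w \in X -> weyl_group F n w by move=> wX; apply: XW.
pose X' := [fset w in X | `[< cone (beta w) >]]%fset.
have X'X : (X' `<=` X)%fset by apply/fsubsetP => w; rewrite !inE => /andP[].
rewrite -(big_fset_incl _ X'X) /=; last first.
  move=> w wX; rewrite !inE wX /= => /asboolPn nc.
  by rewrite /G kostant_partition_out // mulr0 !coef0.
rewrite big_seq (eq_bigr (fun w => T (beta w))); last first.
  by move=> w; rewrite !inE => /andP[/XWw Ww /asboolP]; exact: G_term.
rewrite -big_seq; set Y := [fset beta w | w in X']%fset.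
have -> : \sum_(w <- X') T (beta w) = \sum_(c <- Y) T c.
  apply/esym; apply: big_imfset => w w' /=; rewrite !inE => /andP[/XWw Ww _] /andP[/XWw Ww' _].
  exact: beta_inj.
rewrite (big_fset_incl _ (fsubsetUl Y S)) /=; last first.
  move=> c _ nY; apply/eqP/negPn/negP => /(term_in fS) [w [Ww cb bE Gw]].
  case/negP: nY; apply/imfsetP; exists w => //=; rewrite !inE asboolT // andbT.
  have : [set` X] w by rewrite XE; split=> //=; exact/eqP.
  by [].
rewrite -(big_fset_incl _ (fsubsetUr Y S)) //= => c _ cS; exact: term_out fS cS.
Qed.

End Coefficient.

Theorem corollary2 (R : realType) (l : nat) (hl : (1 <= l)%N)
    (rho : hdual R[i] l) (hrho : weyl_vector rho) (p : nat) :
  nonneg_coefs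
    (kostka_foulkes rho (Lambda0 : hdual R[i] l) (Lambda0 - delta *+ p)).
Proof.
case: l hl rho hrho => [//|l _] rho hrho a b.
exact: (kostka_coef_ge0 hrho (ltnSn (a + 2 * b + 2 * p))).
Qed.
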